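(* Let $0\le\kappa\le1$ and let $n\ge l+1$ be an integer. Let $(p,u)$ be the exact flux and displacement and let $(p_h,u_h)\in M_h\times L_h$ be the mixed finite element solution on $\mathcal{T}_h$ for the Raviart--Thomas (RT), Brezzi--Douglas--Marini (BDM) or Brezzi--Douglas--Fortin--Marini (BDFM) elements. Then there exists a constant $C>0$, independent of the mesh size, such that $$\eta_{h,\kappa}^{2}\le C\Big(\|A^{-1/2}(p-p_h)\|_{L^2(\Omega)}^2+\|h^{\kappa}\,\mathrm{div}(p-p_h)\|_{L^2(\Omega)}^2+\|u-u_h\|_{L^2(\Omega)}^2+\widetilde{\mathrm{osc}}_h^{\,2}\Big).$$
   Context: Setting. $\Omega\subset\mathbb{R}^2$ is a bounded polygonal domain, $A\in L^\infty(\Omega;\mathbb{R}^{2\times 2})$ is symmetric and uniformly positive definite, $f\in L^2(\Omega)$. $u\in H^1_0(\Omega)$ is the weak solution of $-\mathrm{div}(A\nabla u)=f$ in $\Omega$, $u=0$ on $\partial\Omega$, and $p:=A\nabla u\in H(\mathrm{div},\Omega)$. Mesh. $\mathcal{T}_h$ is a triangulation of $\Omega$ into triangles, shape regular: $c_1^{-1}h_T^2\le |T|\le c_1h_T^2$ for all $T\in\mathcal{T}_h$, with $h_T:=\mathrm{diam}(T)$. $h$ is the mesh-size function: $h|_T=h_T$ on elements and $h|_E=h_E:=\mathrm{diam}(E)$ on edges. $\varepsilon_h$ is the set of edges, $\Gamma_h:=\bigcup\varepsilon_h$. For an edge $E$, $\tau$ is a unit tangent vector along $E$; for an interior edge $E=T_+\cap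 T_-$, $J(v)|_E:=(v|_{T_+})|_E-(v|_{T_-})|_E$, and for a boundary edge $E=\overline{T}\cap\partial\Omega$, $J(v)|_E:=(v|_T)|_E$. $\nabla_h$ and $\mathrm{curl}$ are taken elementwise, in the sense of distributions on each element; $\mathrm{curl}\,\psi:=\partial\psi_2/\partial x_1-\partial\psi_1/\partial x_2$ for $\psi=(\psi_1,\psi_2)^T$. Finite elements. Fix an integer $l\ge0$ and one of the families: RT, $M_l(T)=P_l^2+P_l\,x$; BDM, $M_l(T)=P_{l+1}^2$; BDFM, $M_l(T)=\{q\in P_{l+1}^2:(q\cdot\nu)|_{\partial T}\in R_l(\partial T)\}$. Here $P_l$ are polynomials of total degree $\le l$, $R_l(\partial T)$ are functions on $\partial T$ that are polynomials of degree $\le l$ on each edge (not necessarily continuous), $\nu$ is the unit normal. $M_h:=\{q_h\in H(\mathrm{div},\Omega):q_h|_T\in M_l(T)\ \forall T\in\mathcal{T}_h\}$, $L_h:=\{v_h\in L^2(\Omega):v_h|_T\in P_l\ \forall T\in\mathcal{T}_h\}$. With $f_h$ the $L^2$-projection of $f$ onto $L_h$, $(p_h,u_h)\in M_h\times L_h$ is the solution of $$(A^{-1}p_h,q_h)_{0,\Omega}+(\mathrm{div}\,q_h,u_h)_{0,\Omega}=0\ \ \forall q_h\in M_h,\qquad (\mathrm{div}\,p_h,v_h)_{0,\Omega}=-(f_h,v_h)_{0,\Omega}\ \ \forall v_h\in L_h,$$ where $(\cdot,\cdot)_{0,\Omega}$ is the $L^2(\Omega)$ inner product. Estimator. $\eta_{h,\kappa}^2:=\sum_{T\in\mathcal{T}_h}\eta_{T,\kappa}^2$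 with $$\eta_{T,\kappa}^2:=\|h^\kappa(f+\mathrm{div}\,p_h)\|_{L^2(T)}^2+h_T^2\|\mathrm{curl}(A^{-1}p_h)\|_{L^2(T)}^2+\|h^{1/2}J(A^{-1}p_h\cdot\tau)\|_{L^2(\partial T)}^2+\|h(A^{-1}p_h-\nabla_hu_h)\|_{L^2(T)}^2.$$ Oscillation. $\Pi_n^2$ is the $L^2$-best approximation operator onto piecewise polynomials of degree $\le n$ on the elements $T\in\mathcal{T}_h$ (or on the edges $E\in\varepsilon_h$), $P_n^2:=\mathrm{id}-\Pi_n^2$, and $$\widetilde{\mathrm{osc}}_h^{\,2}:=\|hP_n^2\mathrm{curl}(A^{-1}p_h)\|_{L^2(\Omega)}^2+\|h^{1/2}P_{n+1}^2J(A^{-1}p_h\cdot\tau)\|_{L^2(\Gamma_h)}^2+\|hP_n^2(A^{-1}p_h-\nabla_hu_h)\|_{L^2(\Omega)}^2.$$ *)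

(* Defs.v *)
From HB Require Import structures.
From mathcomp Require Import all_boot all_order all_algebra.
From mathcomp Require Import all_classical all_reals all_analysis.
Set Implicit Arguments.
Unset Strict Implicit.
Unset Printing Implicit Defensive.
Import Order.TTheory GRing.Theory Num.Theory numFieldNormedType.Exports.
Local Open Scope classical_set_scope.
Local Open Scope ring_scope.

(* Points of the plane live in R * R (which carries the product topology and
   the product Lebesgue measure); vector fields take values in 'cV[R]_2. *)
Notation pt R := (R * R)%type.
Notation sfield R := (pt R -> R).
Notation vfield R := (pt R -> 'cV[R]_2).
Notation leb2 R :=
  ((@lebesgue_measure R) \x (@lebesgue_measure R))%E.

Definition vec (R : realType) (x : pt R) : 'cV[R]_2 :=
  \col_i (if i == ord0 then x.1 else x.2).

Definition dotv (R : realType) (v w : 'cV[R]_2) : R :=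
  \sum_(i < 2) v i ord0 * w i ord0.

(* Euclidean distance (the library norms on R * R and 'cV are sup norms). *)
Definition eucl_dist (R : realType) (x y : pt R) : R :=
  Num.sqrt (dotv (vec (x - y)) (vec (x - y))).

Definition ediam (R : realType) (S : set (pt R)) : R :=
  sup [set r | exists x y, [/\ S x, S y & r = eucl_dist x y]].

Definition segment (R : realType) (a b : pt R) : set (pt R) :=
  [set x | exists2 s : R, 0 <= s <= 1 & x = a + s *: (b - a)].

Definition ip (R : realType) (D : set (pt R)) (v w : sfield R) : R :=
  \int[leb2 R]_(x in D) (v x * w x).

Definition ipv (R : realType) (D : set (pt R)) (v w : vfield R) : R :=
  \int[leb2 R]_(x in D) dotv (v x) (w x).

(* Squared L^2 norms, in [0, +oo]. *)
Definition sqL2 (R : realType) (D : set (pt R)) (v : sfield R) : \bar R :=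
  (\int[leb2 R]_(x in D) ((v x) ^+ 2)%:E)%E.

Definition sqL2v (R : realType) (D : set (pt R)) (v : vfield R) : \bar R :=
  (\int[leb2 R]_(x in D) (dotv (v x) (v x))%:E)%E.

Definition L2 (R : realType) (D : set (pt R)) (v : sfield R) : Prop :=
  measurable_fun D v /\ (sqL2 D v < +oo)%E.

Definition L2v (R : realType) (D : set (pt R)) (v : vfield R) : Prop :=
  forall i, L2 D (fun x => v x i ord0).

Definition dir (R : realType) (i : 'I_2) : pt R :=
  if i == ord0 then (1, 0) else (0, 1).

Definition pd (R : realType) (i : 'I_2) (v : sfield R) : sfield R :=
  fun x => 'D_(dir R i) v x.

Fixpoint Ck (R : realType) (k : nat) (v : sfield R) : Prop :=
  continuous v /\
  (if k is k'.+1 then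
     forall i, (forall x, derivable v x (dir R i)) /\ Ck k' (pd i v)
   else True).

Definition smooth (R : realType) (v : sfield R) : Prop := forall k, Ck k v.

Definition grad (R : realType) (v : sfield R) : vfield R :=
  fun x => \col_i pd i v x.

(* C_c^oo(D) *)
Definition test_fun (R : realType) (D : set (pt R)) (phi : sfield R) : Prop :=
  [/\ smooth phi,
      compact (closure [set x | phi x != 0]) &
      closure [set x | phi x != 0] `<=` D].

(* Distributional derivatives on an open set D that are functions in L^2(D).
   The operators wgrad, wdiv, wcurl pick a representative; they are only
   meaningful (and then unique up to null sets) when one exists. *)
Definition is_wgrad (R : realType) (D : set (pt R)) (v : sfield R)
    (g : vfield R) : Prop :=
  L2v D g /\
  forall phi, test_fun D phi -> forall i,
    ip D v (pd i phi) = - ip D (fun x => g x i ord0) phi.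

Definition wgrad (R : realType) (D : set (pt R)) (v : sfield R) : vfield R :=
  xget (fun=> 0) [set g | is_wgrad D v g].

Definition is_wdiv (R : realType) (D : set (pt R)) (q : vfield R)
    (d : sfield R) : Prop :=
  L2 D d /\
  forall phi, test_fun D phi -> ipv D q (grad phi) = - ip D d phi.

Definition wdiv (R : realType) (D : set (pt R)) (q : vfield R) : sfield R :=
  xget (fun=> 0) [set d | is_wdiv D q d].

(* (d_2 v, - d_1 v), the formal adjoint of curl psi = d_1 psi_2 - d_2 psi_1 *)
Definition vcurl (R : realType) (v : sfield R) : vfield R :=
  fun x => vec (pd ord_max v x, - pd ord0 v x).

Definition is_wcurl (R : realType) (D : set (pt R)) (psi : vfield R)
    (c : sfield R) : Prop :=
  L2 D c /\
  forall phi, test_fun D phi -> ip D c phi = ipv D psi (vcurl phi).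

Definition wcurl (R : realType) (D : set (pt R)) (psi : vfield R) : sfield R :=
  xget (fun=> 0) [set c | is_wcurl D psi c].

Definition Hdiv (R : realType) (D : set (pt R)) (q : vfield R) : Prop :=
  L2v D q /\ exists d, is_wdiv D q d.

(* Closure of C_c^oo(D) in H^1(D). *)
Definition H10 (R : realType) (D : set (pt R)) (v : sfield R) : Prop :=
  [/\ L2 D v, exists g, is_wgrad D v g &
      forall eps : R, 0 < eps -> exists2 phi, test_fun D phi &
        (sqL2 D (fun x => v x - phi x)%R
         + sqL2v D (fun x => wgrad D v x - grad phi x)%R < eps%:E)%E].

(* Bounded polygonal domain. The condition interior (closure Om) = Om (Om lies
   on one side of its boundary) excludes slits. *)
Definition polygonal_domain (R : realType) (Om : set (pt R)) : Prop :=
  [/\ Om !=set0, open Om, connected Om, bounded_set Om & (closure Om)° = Om]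
  /\ exists s : seq (pt R * pt R),
       closure Om `\` Om = [set x | exists2 ab, ab \in s & segment ab.1 ab.2 x].

Definition coefficient (R : realType) (Om : set (pt R))
    (A : pt R -> 'M[R]_2) : Prop :=
  [/\ forall i j, measurable_fun Om (fun x => A x i j),
      exists M : R, forall i j,
        {ae leb2 R, forall x, Om x -> `|A x i j| <= M},
      {ae leb2 R, forall x, Om x -> (A x)^T = A x} &
      exists2 alpha : R, 0 < alpha &
        {ae leb2 R, forall x, Om x ->
          forall v : 'cV[R]_2, alpha * dotv v v <= dotv v (A x *m v)}].

Definition weak_solution (R : realType) (Om : set (pt R))
    (A : pt R -> 'M[R]_2) (f u : sfield R) : Prop :=
  H10 Om u /\
  forall v, H10 Om v ->
    ipv Om (fun x => A x *m wgrad Om u x) (wgrad Om v) = ip Om f v.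

Definition spd (R : realType) (M : 'M[R]_2) : Prop :=
  M^T = M /\ forall v : 'cV[R]_2, v != 0 -> 0 < dotv v (M *m v).

(* The symmetric positive definite square root. *)
Definition sqrtmx (R : realType) (M : 'M[R]_2) : 'M[R]_2 :=
  xget 0 [set S | spd S /\ S *m S = M].

(* A mesh is a simplicial complex: vertices are numbered by 'I_nv, X gives
   their positions, and a triangle (an edge) is a set of 3 (of 2) vertices. *)
Definition hull (R : realType) (nv : nat) (X : 'I_nv -> pt R)
    (s : {set 'I_nv}) : set (pt R) :=
  [set x | exists w : 'I_nv -> R,
     [/\ forall i, 0 <= w i, forall i, i \notin s -> w i = 0,
         \sum_i w i = 1 & x = \sum_i w i *: X i]].

Definition elt (R : realType) (nv : nat) (X : 'I_nv -> pt R)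
    (t : {set 'I_nv}) : set (pt R) := (hull X t)°.

Definition triangulation (R : realType) (Om : set (pt R)) (nv : nat)
    (X : 'I_nv -> pt R) (T : {set {set 'I_nv}}) : Prop :=
  [/\ forall t, t \in T -> #|t| = 3 /\ elt X t !=set0,
      closure Om = [set x | exists2 t, t \in T & hull X t x] &
      forall t t', t \in T -> t' \in T ->
        hull X t `&` hull X t' = hull X (t :&: t')].

Definition hsize (R : realType) (nv : nat) (X : 'I_nv -> pt R)
    (s : {set 'I_nv}) : R := ediam (hull X s).

Definition shape_regular (R : realType) (c1 : R) (nv : nat)
    (X : 'I_nv -> pt R) (T : {set {set 'I_nv}}) : Prop :=
  forall t, t \in T ->
    ((c1^-1 * (hsize X t) ^+ 2)%:E <= leb2 R (hull X t))%E
    /\ (leb2 R (hull X t) <= (c1 * (hsize X t) ^+ 2)%:E)%E.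

Definition edges (nv : nat) (T : {set {set 'I_nv}}) : {set {set 'I_nv}} :=
  [set e : {set 'I_nv} | (#|e| == 2) && [exists t in T, e \subset t]].

(* Endpoints of an edge in the order of the vertex numbering; this fixes the
   tangent tau_e = (ept1 - ept0) / |ept1 - ept0|. *)
Definition ept (R : realType) (nv : nat) (X : 'I_nv -> pt R)
    (e : {set 'I_nv}) (k : nat) : pt R :=
  nth 0 [seq X i | i <- enum e] k.

(* Unit normal of the edge, tau_e rotated by a right angle. *)
Definition enormal (R : realType) (nv : nat) (X : 'I_nv -> pt R)
    (e : {set 'I_nv}) : 'cV[R]_2 :=
  let d := ept X e 1 - ept X e 0 in
  (eucl_dist (ept X e 1) (ept X e 0))^-1 *: vec (d.2, - d.1).

(* +1 if t lies to the left of tau_e, i.e. if tau_e is the counterclockwise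
   tangent of the boundary of t, and -1 otherwise. *)
Definition orient (R : realType) (nv : nat) (X : 'I_nv -> pt R)
    (t e : {set 'I_nv}) : R :=
  let d := ept X e 1 - ept X e 0 in
  let d' := ept X (t :\: e) 0 - ept X e 0 in
  Num.sg (d.1 * d'.2 - d.2 * d'.1).

Definition eparam (R : realType) (nv : nat) (X : 'I_nv -> pt R)
    (e : {set 'I_nv}) (s : R) : pt R :=
  ept X e 0 + s *: (ept X e 1 - ept X e 0).

(* Arc-length integrals over an edge. *)
Definition ipE (R : realType) (nv : nat) (X : 'I_nv -> pt R)
    (e : {set 'I_nv}) (v w : sfield R) : R :=
  eucl_dist (ept X e 1) (ept X e 0) *
  \int[@lebesgue_measure R]_(s in `[0%R, (1 : R)%R])
    (v (eparam X e s) * w (eparam X e s)).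

Definition sqL2E (R : realType) (nv : nat) (X : 'I_nv -> pt R)
    (e : {set 'I_nv}) (v : sfield R) : \bar R :=
  ((eucl_dist (ept X e 1) (ept X e 0))%:E *
   \int[@lebesgue_measure R]_(s in `[0%R, (1 : R)%R])
     ((v (eparam X e s)) ^+ 2)%:E)%E.

Definition L2E (R : realType) (nv : nat) (X : 'I_nv -> pt R)
    (e : {set 'I_nv}) (v : sfield R) : Prop :=
  measurable_fun `[0%R, (1 : R)%R] (v \o eparam X e) /\ (sqL2E X e v < +oo)%E.

(* g e is the trace of psi . tau_e on the edge e of the triangle t, in the
   sense of the Green formula of H(curl, t), and belongs to L^2(e). *)
Definition is_ttrace (R : realType) (nv : nat) (X : 'I_nv -> pt R)
    (t : {set 'I_nv}) (psi : vfield R) (g : {set 'I_nv} -> sfield R) : Prop :=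
  (forall e, e \in edges [set t] -> L2E X e (g e)) /\
  forall v, smooth v ->
    ip (elt X t) (wcurl (elt X t) psi) v =
    ipv (elt X t) psi (vcurl v)
    + \sum_(e in edges [set t]) orient X t e * ipE X e (g e) v.

Definition ttrace (R : realType) (nv : nat) (X : 'I_nv -> pt R)
    (t : {set 'I_nv}) (psi : vfield R) : {set 'I_nv} -> sfield R :=
  xget (fun _ _ => 0) [set g | is_ttrace X t psi g].

(* psi has an elementwise curl in L^2 and tangential traces in L^2. *)
Definition curl_regular (R : realType) (nv : nat) (X : 'I_nv -> pt R)
    (T : {set {set 'I_nv}}) (psi : vfield R) : Prop :=
  forall t, t \in T ->
    (exists c, is_wcurl (elt X t) psi c) /\ (exists g, is_ttrace X t psi g).

(* J(psi . tau); the enumeration of the triangles adjacent to an interior edge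
   decides which one is T_+. *)
Definition tjump (R : realType) (nv : nat) (X : 'I_nv -> pt R)
    (T : {set {set 'I_nv}}) (psi : vfield R) (e : {set 'I_nv}) : sfield R :=
  match enum [set t in T | e \subset t] with
  | [:: t] => ttrace X t psi e
  | [:: t; t'] => fun x => ttrace X t psi e x - ttrace X t' psi e x
  | _ => fun=> 0
  end.

Definition is_poly (R : realType) (n : nat) (q : sfield R) : Prop :=
  exists c : nat -> nat -> R, forall x,
    q x = \sum_(i < n.+1) \sum_(j < n.+1 | (i + j <= n)%N)
            c i j * x.1 ^+ i * x.2 ^+ j.

Definition is_polyv (R : realType) (n : nat) (q : vfield R) : Prop :=
  forall i, is_poly n (fun x => q x i ord0).

Inductive mixed_family := RT | BDM | BDFM.

Definition Mloc (R : realType) (fam : mixed_family) (l : nat) (nv : nat)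
    (X : 'I_nv -> pt R) (t : {set 'I_nv}) (q : vfield R) : Prop :=
  match fam with
  | RT => exists q0 r, [/\ is_polyv l q0, is_poly l r &
                          forall x, q x = q0 x + r x *: vec x]
  | BDM => is_polyv l.+1 q
  | BDFM => is_polyv l.+1 q /\
      forall e, e \in edges [set t] -> exists2 r, is_poly l r &
        forall x, hull X e x -> dotv (q x) (enormal X e) = r x
  end.

Definition Mh (R : realType) (Om : set (pt R)) (fam : mixed_family) (l : nat)
    (nv : nat) (X : 'I_nv -> pt R) (T : {set {set 'I_nv}})
    (q : vfield R) : Prop :=
  Hdiv Om q /\
  forall t, t \in T -> exists2 qt, Mloc fam l X t qt &
    {ae leb2 R, forall x, elt X t x -> q x = qt x}.

Definition Lh (R : realType) (Om : set (pt R)) (l : nat)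
    (nv : nat) (X : 'I_nv -> pt R) (T : {set {set 'I_nv}})
    (v : sfield R) : Prop :=
  L2 Om v /\
  forall t, t \in T -> exists2 r, is_poly l r &
    {ae leb2 R, forall x, elt X t x -> v x = r x}.

Definition is_Lh_proj (R : realType) (Om : set (pt R)) (l : nat)
    (nv : nat) (X : 'I_nv -> pt R) (T : {set {set 'I_nv}})
    (f fh : sfield R) : Prop :=
  Lh Om l X T fh /\
  forall v, Lh Om l X T v -> ip Om (fun x => f x - fh x) v = 0.

Definition Ainv (R : realType) (A : pt R -> 'M[R]_2) (q : vfield R) :
    vfield R := fun x => invmx (A x) *m q x.

Definition mixed_solution (R : realType) (Om : set (pt R))
    (A : pt R -> 'M[R]_2) (fam : mixed_family) (l : nat) (nv : nat)
    (X : 'I_nv -> pt R) (T : {set {set 'I_nv}})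
    (fh : sfield R) (ph : vfield R) (uh : sfield R) : Prop :=
  [/\ Mh Om fam l X T ph, Lh Om l X T uh,
      forall qh, Mh Om fam l X T qh ->
        ipv Om (Ainv A ph) qh + ip Om (wdiv Om qh) uh = 0 &
      forall vh, Lh Om l X T vh ->
        ip Om (wdiv Om ph) vh = - ip Om fh vh].

(* Best approximation by polynomials of degree <= n for the (squared) norm N;
   on an edge, polynomials are restrictions of polynomials on the plane. *)
Definition bestappr (R : realType) (N : sfield R -> \bar R) (n : nat)
    (w : sfield R) : sfield R :=
  xget (fun=> 0) [set q | is_poly n q /\ forall r, is_poly n r ->
    (N (fun x => w x - q x)%R <= N (fun x => w x - r x)%R)%E].

Definition rem_elt (R : realType) (nv : nat) (X : 'I_nv -> pt R)
    (t : {set 'I_nv}) (n : nat) (w : sfield R) : sfield R :=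
  fun x => w x - bestappr (sqL2 (elt X t)) n w x.

Definition rem_eltv (R : realType) (nv : nat) (X : 'I_nv -> pt R)
    (t : {set 'I_nv}) (n : nat) (w : vfield R) : vfield R :=
  fun x => \col_i rem_elt X t n (fun y => w y i ord0) x.

Definition rem_edge (R : realType) (nv : nat) (X : 'I_nv -> pt R)
    (e : {set 'I_nv}) (n : nat) (w : sfield R) : sfield R :=
  fun x => w x - bestappr (sqL2E X e) n w x.

(* A^{-1} p_h - grad_h u_h on the triangle t *)
Definition residual (R : realType) (A : pt R -> 'M[R]_2) (nv : nat)
    (X : 'I_nv -> pt R) (t : {set 'I_nv}) (ph : vfield R) (uh : sfield R) :
    vfield R :=
  fun x => Ainv A ph x - wgrad (elt X t) uh x.

Definition eta2_T (R : realType) (Om : set (pt R)) (A : pt R -> 'M[R]_2)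
    (kappa : R) (nv : nat) (X : 'I_nv -> pt R) (T : {set {set 'I_nv}})
    (f : sfield R) (ph : vfield R) (uh : sfield R) (t : {set 'I_nv}) : \bar R :=
  let hT := hsize X t in
  (sqL2 (elt X t) (fun x => hT `^ kappa * (f x + wdiv Om ph x))%R
   + (hT ^+ 2)%:E * sqL2 (elt X t) (wcurl (elt X t) (Ainv A ph))
   + \sum_(e in edges [set t])
       sqL2E X e
         (fun x => Num.sqrt (hsize X e) * tjump X T (Ainv A ph) e x)%R
   + sqL2v (elt X t) (fun x => hT *: residual A X t ph uh x)%R)%E.

Definition eta2 (R : realType) (Om : set (pt R)) (A : pt R -> 'M[R]_2)
    (kappa : R) (nv : nat) (X : 'I_nv -> pt R) (T : {set {set 'I_nv}})
    (f : sfield R) (ph : vfield R) (uh : sfield R) : \bar R :=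
  (\sum_(t in T) eta2_T Om A kappa X T f ph uh t)%E.

Definition osc2 (R : realType) (A : pt R -> 'M[R]_2) (n : nat)
    (nv : nat) (X : 'I_nv -> pt R) (T : {set {set 'I_nv}})
    (ph : vfield R) (uh : sfield R) : \bar R :=
  (\sum_(t in T)
     sqL2 (elt X t)
       (fun x => hsize X t * rem_elt X t n (wcurl (elt X t) (Ainv A ph)) x)%R
   + \sum_(e in edges T)
       sqL2E X e
         (fun x => Num.sqrt (hsize X e)
                   * rem_edge X e n.+1 (tjump X T (Ainv A ph) e) x)%R
   + \sum_(t in T)
       sqL2v (elt X t)
         (fun x => hsize X t *: rem_eltv X t n (residual A X t ph uh) x)%R)%E.

(* || h^kappa div q ||^2 over Om, for the mesh-size function h *)
Definition hdiv_err2 (R : realType) (Om : set (pt R)) (kappa : R)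
    (nv : nat) (X : 'I_nv -> pt R) (T : {set {set 'I_nv}})
    (q : vfield R) : \bar R :=
  (\sum_(t in T)
     sqL2 (elt X t) (fun x => hsize X t `^ kappa * wdiv Om q x)%R)%E.

(* Main.v *)
Require Import Defs.
From HB Require Import structures.
From mathcomp Require Import all_boot all_order all_algebra.
From mathcomp Require Import all_classical all_reals all_analysis.
From mathcomp Require Import measurable_realfun ring lra.

(** The estimator is bounded term by term with localized test functions (bubble
    functions). Write G for the gradient of the exact solution u and psi for
    A^-1 p_h. Since p = A G, the difference d = psi - G is -A^-1 (p - p_h), and
    ellipticity bounds |d|^2 almost everywhere by a multiple of
    |A^(-1/2) (p - p_h)|^2 ([energy_bound]).

    The first term of the estimator is exactly an error term: p has divergence
    -f, so that f + div p_h = - div (p - p_h) ([flux_error_wdiv]).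

    Each of the three other terms is the norm of a quantity r (the curl of psi,
    the tangential jump of psi, or psi - grad u_h) that would vanish if psi and
    u_h were G and u. Let q be a polynomial close to r and let v be q times a
    bubble function that vanishes outside an element or outside the triangles
    that share an edge. Then |q|^2 <= C (q, v) = C ((r, v) - (r - q, v)), where
    r - q is part of the oscillation, while an integration by parts moves the
    derivative that defines r to v, so that (r, v) becomes a product of d, or of
    u - u_h, with derivatives of v. The inverse estimates for v ([elt_bubble],
    [edge_bubble]) and Young's inequality then absorb the powers of the mesh
    size and the norm of v into |q|^2: see [curl_bound], [residual_bound] and
    [edge_bound]. The bubble estimates hold on the reference triangle because
    two quadratic forms on a space of polynomials are comparable
    ([qform_bound]), and are transported by affine maps.

    The exact gradient G drops out of these identities because it is orthogonal
    to the rotated gradient of v. By density ([H10_density]) this need only be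
    checked for the gradient of a test function phi, where it follows from the
    divergence theorem on a triangle ([tri_div], [green_edge]): what remains is
    the integral over an edge of v times the tangential derivative of phi. Two
    triangles that share an edge lie on opposite sides of it
    ([orient_opposite]), so that their contributions cancel, and an edge of a
    single triangle lies on the boundary of the domain
    ([boundary_edge_notin]), where phi vanishes.

    Summing the local bounds, every triangle and every edge is counted a bounded
    number of times. The constant depends on the domain through an upper bound
    for the mesh size, which serves to compare h^2 |d|^2 with |d|^2. *)

Set Implicit Arguments.
Unset Strict Implicit.
Unset Printing Implicit Defensive.
Import Order.TTheory GRing.Theory Num.Theory numFieldNormedType.Exports.
Local Open Scope classical_set_scope.
Local Open Scope ring_scope.

(** * Areas under affine maps *)

Section AffineMeasure.
Context {R : realType}.
Notation mu := (@lebesgue_measure R).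
Notation mu2 := (leb2 R).

Lemma affine_measurable (r m : R) : measurable_fun setT (fun y : R => r * y + m).
Proof.
apply: measurable_funD => //; exact: measurable_funM.
Qed.

(** Both sides are measures that agree on half-open intervals. *)
Lemma lebesgue_measure_affine_pos (r m : R) (A : set R) : 0 < r -> measurable A ->
  mu ((fun y : R => r * y + m) @^-1` A) = (r^-1%:E * mu A)%E.
Proof.
move=> r0 mA.
have mf : @measurable_fun _ _ (measurableTypeR R) (measurableTypeR R) setT (fun y : R => r * y + m) by exact: affine_measurable.
have r0' : 0 <= r by exact: ltW.
pose P : {measure set (measurableTypeR R) -> \bar R} :=
  @measure_function_pushforward__canonical__measure_function_Measure _ _ _ _ _ mu _ mf.
pose nu : {measure set (measurableTypeR R) -> \bar R} := mscale (NngNum r0') P.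
have -> : mu A = nu A.
  apply: lebesgue_measure_unique => //= _ [[a b]] _ <-.
  rewrite /mscale /= /pushforward /=.
  have -> : (fun y : R => r * y + m) @^-1` `]a, b] = `](a - m) / r, (b - m) / r]%classic.
    apply/seteqP; split => y /=; rewrite !in_itv /= ltr_pdivrMr // ler_pdivlMr // ltrBlDr lerBrDr (mulrC y) //.
  rewrite !lebesgue_measure_itv/= !lte_fin ltr_pM2r ?invr_gt0 // ltrD2r.
  case: ifP => _; last by rewrite mule0.
  by rewrite -!EFinD -EFinM; congr (_ %:E); field; rewrite gt_eqF.
rewrite /= /mscale /= /pushforward muleA -EFinM mulVf ?gt_eqF // mul1e //.
Qed.

Lemma lebesgue_measure_affine (r m : R) (A : set R) : r != 0 -> measurable A ->
  mu ((fun y : R => r * y + m) @^-1` A) = (`|r|^-1%:E * mu A)%E.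
Proof.
move=> r0 mA; case: (ltrgtP r 0) r0 => // r0 _; last first.
  by rewrite lebesgue_measure_affine_pos // gtr0_norm.
rewrite ltr0_norm //.
have mB : measurable ((fun y : R => (- r) * y + m) @^-1` A).
  rewrite -[X in measurable X]setTI; exact: (affine_measurable (-r) m).
rewrite -(lebesgue_measure_affine_pos m) ?oppr_gt0 //.
rewrite -[RHS]lebesgue_measureN //; congr (mu _).
by apply/seteqP; split => y /=; rewrite mulrNN.
Qed.

(** [F] multiplies areas by [d^-1] under inverse images. *)
Definition scales_area (F : pt R -> pt R) (d : R) : Prop :=
  measurable_fun setT F /\
  forall B, measurable B -> mu2 (F @^-1` B) = (d^-1%:E * mu2 B)%E.

Lemma scales_area_comp F G d e : scales_area F d -> scales_area G e ->
  scales_area (F \o G) (d * e).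
Proof.
move=> [mF hF] [mG hG]; split; first exact: measurableT_comp.
move=> B mB; rewrite comp_preimage hG; last first.
  by rewrite -[X in measurable X]setTI; exact: mF.
by rewrite hF // muleA -EFinM invfM mulrC.
Qed.

Lemma scales_area_swap : scales_area (fun x => (x.2, x.1)) 1.
Proof.
have mf : measurable_fun [set: pt R] (fun x : pt R => (x.2, x.1)).
  by apply: measurable_fun_pair.
split=> // B mB; rewrite invr1 mul1e.
pose mR := measurableTypeR R.
have mf' : @measurable_fun _ _ (mR * mR)%type (mR * mR)%type setT (fun x => (x.2, x.1)) by [].
pose P := measure_function_pushforward__canonical__measure_function_Measure (leb2 R) mf'.
rewrite -[LHS]/(P B); apply/esym.
apply: (@product_measure_unique _ _ _ _ _ mu mu P) => // A1 A2 mA1 mA2.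
rewrite /P /= /pushforward /=.
rewrite (_ : _ @^-1` _ = A2 `*` A1); last by apply/seteqP; split => -[x y] /= [].
by rewrite product_measure1E // muleC.
Qed.

(** Fubini: every vertical section is scaled by the same factor. *)
Lemma scales_area_yaff (r k m : R) : r != 0 ->
  scales_area (fun x => (x.1, r * x.2 + (k * x.1 + m))) `|r|.
Proof.
move=> r0; split.
  apply: measurable_fun_pair => //; apply: measurable_funD.
    exact: measurable_funM.
  apply: measurable_funD => //; exact: measurable_funM.
move=> B mB.
rewrite /product_measure1 /=.
under eq_integral => x _.
  rewrite (_ : xsection _ x = (fun y => r * y + (k * x + m)) @^-1` (xsection B x)); last first.
    by apply/seteqP; split => y; rewrite /xsection /= !inE.
  rewrite lebesgue_measure_affine //; last exact: measurable_xsection.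
  over.
rewrite ge0_integralZl_EFin //.
exact: measurable_fun_xsection.
Qed.

Lemma scales_area_xaff (r k m : R) : r != 0 ->
  scales_area (fun x => (r * x.1 + (k * x.2 + m), x.2)) `|r|.
Proof.
move=> r0; have := scales_area_comp scales_area_swap
  (scales_area_comp (scales_area_yaff k m r0) scales_area_swap).
by rewrite mul1r mulr1.
Qed.

(** An invertible affine map factors, up to exchanging the coordinates, into
    two maps that each change one coordinate only; for these Fubini reduces
    the claim to the scaling of the measure of the line. *)
Lemma scales_area_affine (p q m r s m' : R) : p * s - q * r != 0 ->
  scales_area (fun x => (p * x.1 + q * x.2 + m, r * x.1 + s * x.2 + m'))
    `|p * s - q * r|.
Proof.
have gen p1 q1 r1 s1 : p1 != 0 -> p1 * s1 - q1 * r1 != 0 ->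
  scales_area (fun x => (p1 * x.1 + q1 * x.2 + m, r1 * x.1 + s1 * x.2 + m'))
    `|p1 * s1 - q1 * r1|.
  move=> p0 d0.
  have e0 : s1 - r1 * q1 / p1 != 0.
    apply: contra_neq d0 => /(congr1 (fun z => z * p1)); rewrite mul0r => <-.
    by field.
  have := scales_area_comp (scales_area_yaff (r1 / p1) (m' - r1 / p1 * m) e0)
    (scales_area_xaff q1 m p0).
  rewrite -normrM (_ : (s1 - r1 * q1 / p1) * p1 = p1 * s1 - q1 * r1); last by field.
  congr (scales_area _ _); apply/funext => x /=; congr (_, _); last by field.
  by ring.
have [->|p0] := eqVneq p 0; last exact: gen.
rewrite mul0r sub0r oppr_eq0 => qr.
have q0 : q != 0 by apply: contra_neq qr => ->; rewrite mul0r.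
have d0 : q * r - 0 * s != 0 by rewrite mul0r subr0.
have := scales_area_comp (gen q 0 s r q0 d0) scales_area_swap.
rewrite mulr1 mul0r subr0 normrN; congr (scales_area _ _).
by apply/funext => x /=; congr (_, _); ring.
Qed.

End AffineMeasure.

(** * Square-integrable functions *)

Section IntegralMonotone.
Context d (T : measurableType d) (R : realType) (mu : {measure set T -> \bar R}).
Local Open Scope ereal_scope.

(** The integral of a nonnegative function is a supremum over the simple
    functions below it, and this set grows with the function. *)
Lemma ge0_le_integral_nonmeas (D E : set T) (f g : T -> \bar R) :
  (forall x, D x -> 0 <= f x) -> (forall x, E x -> 0 <= g x) ->
  D `<=` E -> (forall x, D x -> f x <= g x) ->
  \int[mu]_(x in D) f x <= \int[mu]_(x in E) g x.
Proof.
move=> f0 g0 DE fg; rewrite !ge0_integralE //.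
apply: ereal_sup_le => _ [h /= hf <-]; exists h => //= x.
apply: (le_trans (hf x)); rewrite !patchE.
case: ifPn => [xD|_]; last by case: ifPn => // xE; apply: g0; exact/set_mem.
have Dx : D x by exact/set_mem.
by rewrite (mem_set (DE _ Dx)) fg.
Qed.

(** In the application the larger function involves a matrix square root that is
    only given by choice; the exceptional null set is dropped on the side of the
    smaller one, which is measurable. *)
Lemma ae_le_integral_nonmeas (D : set T) (f g : T -> \bar R) :
  measurable D -> measurable_fun D f ->
  (forall x, D x -> 0 <= f x) -> (forall x, D x -> 0 <= g x) ->
  {ae mu, forall x, D x -> f x <= g x} ->
  \int[mu]_(x in D) f x <= \int[mu]_(x in D) g x.
Proof.
move=> mD mf f0 g0 [N [mN muN fgN]].
rewrite (ge0_negligible_integral mN mD mf f0 muN).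
apply: ge0_le_integral_nonmeas.
- by move=> x [Dx _]; exact: f0.
- exact: g0.
- by move=> x [Dx _].
- by move=> x [Dx Nx]; move/subsetCl : fgN => fgN; exact: fgN Nx Dx.
Qed.

End IntegralMonotone.

Section AlmostEverywhere.
Context d (T : measurableType d) (R : realType) (mu : {measure set T -> \bar R}).

Lemma ae_imp (P Q : T -> Prop) :
  {ae mu, forall x, P x} -> (forall x, P x -> Q x) -> {ae mu, forall x, Q x}.
Proof. by move=> hP h; apply: filterS hP. Qed.

Lemma ae_imp2 (P P' Q : T -> Prop) :
  {ae mu, forall x, P x} -> {ae mu, forall x, P' x} ->
  (forall x, P x -> P' x -> Q x) -> {ae mu, forall x, Q x}.
Proof. by move=> hP hP' h; apply: filterS2 hP hP'. Qed.

End AlmostEverywhere.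

Section SquareIntegrable.
Context d (T : measurableType d) (R : realType) (mu : {measure set T -> \bar R}).
Context (D : set T) (mD : measurable D).
Implicit Types v w : T -> R.

(** The square-integrable functions over an arbitrary measure, so that elements
    and edges are treated alike. *)
Definition sqi v := measurable_fun D v /\
  (\int[mu]_(x in D) ((v x) ^+ 2)%:E < +oo)%E.

Lemma sqi_integrable_sqr v : sqi v -> mu.-integrable D (EFin \o (fun x => v x ^+ 2)).
Proof.
move=> [mv fv]; apply/integrableP; split.
  by apply/measurable_EFinP; exact: measurable_funX.
under eq_integral do rewrite /= ger0_norm ?sqr_ge0//.
exact: fv.
Qed.

Lemma sqi_integrableM v w : sqi v -> sqi w ->
  mu.-integrable D (EFin \o (fun x => v x * w x)).
Proof.
move=> sv sw.
have iD := integrableD mD (sqi_integrable_sqr sv) (sqi_integrable_sqr sw).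
apply: (le_integrable mD _ _ iD).
  by apply/measurable_EFinP/measurable_funM; [case: sv|case: sw].
move=> x _ /=; rewrite lee_fin.
rewrite [leRHS]ger0_norm ?addr_ge0 ?sqr_ge0 // normrM.
rewrite -[v x ^+ 2]real_normK ?num_real // -[w x ^+ 2]real_normK ?num_real //.
by have := normr_ge0 (v x); have := normr_ge0 (w x); nra.
Qed.

(** Domination is only almost everywhere because the coefficient bounds are. *)
Lemma sqi_dom v w c : measurable_fun D v -> sqi w ->
  {ae mu, forall x, D x -> v x ^+ 2 <= c * w x ^+ 2} -> sqi v.
Proof.
move=> mv sw h; split => //.
have [mw fw] := sw.
apply: (@le_lt_trans _ _ (\int[mu]_(x in D) (`|c| * w x ^+ 2)%:E)%E).
  apply: ae_le_integral_nonmeas => //.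
  - by apply/measurable_EFinP; exact: measurable_funX.
  - by move=> x _; rewrite lee_fin sqr_ge0.
  - by move=> x _; rewrite lee_fin mulr_ge0 // sqr_ge0.
  - apply: filterS h => x h Dx; rewrite lee_fin (le_trans (h Dx)) //.
    by rewrite ler_wpM2r ?sqr_ge0 // ler_norm.
under eq_integral do rewrite EFinM.
rewrite ge0_integralZl_EFin //.
- by rewrite lte_mul_pinfty.
- by move=> x _; rewrite lee_fin sqr_ge0.
- by apply/measurable_EFinP; exact: measurable_funX.
Qed.

Lemma sqi_ext v w : (forall x, D x -> v x = w x) -> sqi v -> sqi w.
Proof.
move=> vw [mv fv]; split.
  by apply: eq_measurable_fun mv => x /set_mem; exact: vw.
rewrite (_ : integral _ _ _ = (\int[mu]_(x in D) (v x ^+ 2)%:E)%E) //.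
by apply: eq_integral => x /set_mem Dx; rewrite vw.
Qed.

Lemma sqiZ c v : sqi v -> sqi (fun x => c * v x).
Proof.
move=> sv; have [mv _] := sv; apply: (sqi_dom (c := c ^+ 2) _ sv).
  exact: measurable_funM.
by apply: aeW => x _; rewrite exprMn.
Qed.

Lemma sqiN v : sqi v -> sqi (fun x => - v x).
Proof. by move=> /(sqiZ (-1)); apply: sqi_ext => x _; rewrite mulN1r. Qed.

Lemma sqiD v w : sqi v -> sqi w -> sqi (fun x => v x + w x).
Proof.
move=> sv sw; have [mv fv] := sv; have [mw fw] := sw.
split; first exact: measurable_funD.
have := integrable_lty mD (integrableD mD (integrableD mD (sqi_integrable_sqr sv)
  (sqi_integrable_sqr sw)) (integrableD mD (sqi_integrable_sqr sv)
  (sqi_integrable_sqr sw))).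
apply: le_lt_trans.
apply: ge0_le_integral_nonmeas => //= x _; rewrite ?lee_fin ?sqr_ge0 //.
  by rewrite !addr_ge0 // sqr_ge0.
by rewrite ?lee_fin; have := sqr_ge0 (v x - w x); nra.
Qed.

Lemma sqiB v w : sqi v -> sqi w -> sqi (fun x => v x - w x).
Proof. by move=> sv /sqiN; exact: sqiD. Qed.

Lemma sqi_bounded v M : (mu D < +oo)%E -> measurable_fun D v ->
  (forall x, D x -> `|v x| <= M) -> sqi v.
Proof.
move=> muD mv hM; split=> //.
apply: (@le_lt_trans _ _ (\int[mu]_(x in D) (M ^+ 2)%:E)%E).
  apply: ge0_le_integral_nonmeas => //= x Dx; rewrite lee_fin ?sqr_ge0 //.
  by rewrite -real_normK ?num_real // ler_sqr ?nnegrE // ?hM // (le_trans _ (hM x Dx)).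
by rewrite integral_cst // lte_mul_pinfty // lee_fin sqr_ge0.
Qed.

Definition dp v w := (\int[mu]_(x in D) (v x * w x))%R.

Lemma sqi_sqE v : sqi v -> (\int[mu]_(x in D) (v x ^+ 2)%:E)%E = (dp v v)%:E.
Proof.
move=> [mv fv]; rewrite /dp /Rintegral fineK.
  by apply: eq_integral => x _; rewrite expr2.
rewrite ge0_fin_numE; last by apply: integral_ge0 => x _; rewrite lee_fin -expr2 sqr_ge0.
by under eq_integral do rewrite -expr2.
Qed.

Lemma dp_ge0 v : 0 <= dp v v.
Proof. by apply: Rintegral_ge0 => x _; rewrite -expr2 sqr_ge0. Qed.

Lemma dpC v w : dp v w = dp w v.
Proof. by apply: eq_Rintegral => x _; rewrite mulrC. Qed.

Lemma eq_dp v v' w w' : (forall x, D x -> v x = v' x) ->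
  (forall x, D x -> w x = w' x) -> dp v w = dp v' w'.
Proof. by move=> hv hw; apply: eq_Rintegral => x /set_mem Dx; rewrite hv ?hw. Qed.

Lemma ae_eq_Rintegral f g : measurable_fun D f -> measurable_fun D g ->
  {ae mu, forall x, D x -> f x = g x} ->
  \int[mu]_(x in D) f x = \int[mu]_(x in D) g x.
Proof.
move=> mf mg fg; congr fine; apply: ae_eq_integral => //; try exact/measurable_EFinP.
by apply: filterS fg => x h Dx; rewrite h.
Qed.

Lemma ae_eq_dp v v' w w' : sqi v -> sqi v' -> sqi w -> sqi w' ->
  {ae mu, forall x, D x -> v x = v' x} -> {ae mu, forall x, D x -> w x = w' x} ->
  dp v w = dp v' w'.
Proof.
move=> [? _] [? _] [? _] [? _] h1 h2; apply: ae_eq_Rintegral; try exact: measurable_funM.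
by apply: filterS2 h1 h2 => x h1 h2 Dx; rewrite h1 ?h2.
Qed.

Lemma dpDl v v' w : sqi v -> sqi v' -> sqi w ->
  dp (fun x => v x + v' x) w = dp v w + dp v' w.
Proof.
move=> sv sv' sw; rewrite /dp -RintegralD ?sqi_integrableM //.
by apply: eq_Rintegral => x _; rewrite mulrDl.
Qed.

Lemma dpBl v v' w : sqi v -> sqi v' -> sqi w ->
  dp (fun x => v x - v' x) w = dp v w - dp v' w.
Proof.
move=> sv sv' sw; rewrite /dp -RintegralB ?sqi_integrableM //.
by apply: eq_Rintegral => x _; rewrite mulrBl.
Qed.

Lemma dpZl c v w : sqi v -> sqi w -> dp (fun x => c * v x) w = c * dp v w.
Proof.
move=> sv sw; rewrite /dp -RintegralZl ?sqi_integrableM //.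
by apply: eq_Rintegral => x _; rewrite mulrA.
Qed.

Lemma dpNl v w : sqi v -> sqi w -> dp (fun x => - v x) w = - dp v w.
Proof.
move=> sv sw; rewrite -mulN1r -dpZl //.
by apply: eq_dp => // x _; rewrite mulN1r.
Qed.

Lemma le_dp_ae v w : sqi v -> sqi w ->
  {ae mu, forall x, D x -> v x ^+ 2 <= w x ^+ 2} -> dp v v <= dp w w.
Proof.
move=> sv sw h; rewrite -lee_fin -!sqi_sqE //; apply: ae_le_integral_nonmeas => //.
- by apply/measurable_EFinP/measurable_funX; case: sv.
- by move=> x _; rewrite lee_fin sqr_ge0.
- by move=> x _; rewrite lee_fin sqr_ge0.
Qed.

(** Young's inequality stands in for Cauchy-Schwarz: the free parameter is what
    the absorption arguments below tune. *)
Lemma dp_young (e : R) v w : 0 < e -> sqi v -> sqi w ->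
  `|dp v w| <= e * dp v v + e^-1 * dp w w.
Proof.
move=> e0 sv sw; apply: le_trans (le_normr_Rintegral mD (sqi_integrableM sv sw)) _.
have sev := sqiZ e sv; have sew := sqiZ e^-1 sw.
rewrite -dpZl // -dpZl // /dp -RintegralD ?sqi_integrableM //.
apply: le_Rintegral => //.
- exact/integrable_norm/sqi_integrableM.
- have := integrableD mD (sqi_integrableM sev sv) (sqi_integrableM sew sw).
  by apply: eq_integrable.
move=> x _; rewrite normrM -!mulrA -!expr2.
rewrite -[v x ^+ 2]real_normK ?num_real // -[w x ^+ 2]real_normK ?num_real //.
have := normr_ge0 (v x); have := normr_ge0 (w x).
move: `|v x| `|w x| => a b b0 a0.
have -> : e * a ^+ 2 + e^-1 * b ^+ 2 = a * b + e^-1 * ((e * a - b) ^+ 2 + e * a * b).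
  by field; rewrite gt_eqF.
rewrite lerDl; apply: mulr_ge0; first by rewrite invr_ge0 ltW.
apply: addr_ge0; rewrite ?sqr_ge0 //; do 2! apply: mulr_ge0 => //; exact: ltW.
Qed.

Lemma dp_normD v w : sqi v -> sqi w ->
  dp (fun x => v x + w x) (fun x => v x + w x) <= 2 * dp v v + 2 * dp w w.
Proof.
move=> sv sw; have sD := sqiD sv sw.
have s2v := sqiZ 2 sv; have s2w := sqiZ 2 sw.
rewrite -dpZl // -dpZl // /dp -RintegralD ?sqi_integrableM //.
apply: le_Rintegral => //.
- exact: sqi_integrableM.
- have := integrableD mD (sqi_integrableM s2v sv) (sqi_integrableM s2w sw).
  by apply: eq_integrable.
by move=> x _; have := sqr_ge0 (v x - w x); nra.
Qed.

End SquareIntegrable.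

(** * Borel sets of the plane *)

Section PlaneTopology.
Context {R : realType}.
Notation mu := (@lebesgue_measure R).
Notation mu2 := (leb2 R).

Definition rbox (q : (rat * rat) * (rat * rat)) : set (pt R) :=
  `]ratr q.1.1, ratr q.1.2[%classic `*` `]ratr q.2.1, ratr q.2.2[%classic.
Definition rcbox (q : (rat * rat) * (rat * rat)) : set (pt R) :=
  `[ratr q.1.1, ratr q.1.2]%classic `*` `[ratr q.2.1, ratr q.2.2]%classic.

Lemma rbox_measurable q : measurable (rbox q).
Proof. by apply: measurableX; exact: measurable_itv. Qed.

(** Rational boxes form a countable base: this is what makes open sets of the
    plane measurable for the product sigma-algebra. *)
Lemma open_rbox (A : set (pt R)) (x : pt R) : open A -> A x ->
  exists q, rbox q x /\ rcbox q `<=` A.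
Proof.
move=> oA Ax.
have /nbhs_ballP[e /= e0 eA] : nbhs x A by exact: open_nbhs_nbhs.
have ratb (z : R) : exists q : rat * rat,
    [/\ ratr q.1 < z, z < ratr q.2, z - e < ratr q.1 & ratr q.2 < z + e].
  have [|a] := @rat_in_itvoo R (z - e) z; first by rewrite ltrBlDr ltrDl.
  have [|b] := @rat_in_itvoo R z (z + e); first by rewrite ltrDl.
  by rewrite !in_itv /= => /andP[? ?] /andP[? ?]; exists (a, b).
have [q1 [a1 a2 a3 a4]] := ratb x.1; have [q2 [b1 b2 b3 b4]] := ratb x.2.
exists (q1, q2); split.
  by rewrite /rbox /=; split => /=; rewrite in_itv /= ?a1 ?b1.
move=> y [] /=; rewrite !in_itv /= => /andP[c1 c2] /andP[d1 d2].
apply: eA; split; rewrite /ball /= ltr_norml; lra.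
Qed.

Lemma open_bigcup_rbox (A : set (pt R)) : open A ->
  A = \bigcup_(q in [set q | rcbox q `<=` A]) rbox q.
Proof.
move=> oA; apply/seteqP; split.
  by move=> x Ax; have [q [qx qA]] := open_rbox oA Ax; exists q.
move=> x [q /= qA [/= h1 h2]]; apply: qA; split => /=.
  by move: h1; rewrite !in_itv /= => /andP[/ltW -> /ltW ->].
by move: h2; rewrite !in_itv /= => /andP[/ltW -> /ltW ->].
Qed.

Lemma open_measurable_pt (A : set (pt R)) : open A -> measurable A.
Proof.
move=> oA; rewrite (open_bigcup_rbox oA) bigcup_mkcond.
apply: countable_bigcupT_measurable => // q.
by case: ifP => _ //; exact: rbox_measurable.
Qed.

Lemma closed_measurable_pt (A : set (pt R)) : closed A -> measurable A.
Proof.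
move=> cA; rewrite -[A]setCK; apply: measurableC; apply: open_measurable_pt.
exact: closed_openC.
Qed.

(** Open intervals generate the Borel sets of the line. *)
Lemma continuous_measurable_pt (f : pt R -> R) : continuous f ->
  measurable_fun setT f.
Proof.
move=> cf; apply: (measurability _ (RGenOpens.measurableE R)) => //.
move=> _ [_ [a [b ->]] <-]; rewrite setTI; apply: open_measurable_pt.
by apply: open_comp => // x _; exact: cf.
Qed.

Lemma leb2_box (I J : interval R) :
  mu2 ([set` I] `*` [set` J]) = (mu [set` I] * mu [set` J])%E.
Proof. by rewrite product_measure1E //; exact: measurable_itv. Qed.

Lemma negligible_open_pt (A : set (pt R)) : open A -> mu2.-negligible A -> A = set0.
Proof.
move=> oA nA; apply/seteqP; split => // x Ax.
have [q [[/= q1 q2] qA]] := open_rbox oA Ax.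
move: q1 q2; rewrite !in_itv /= => /andP[a1 a2] /andP[b1 b2].
have : mu2.-negligible (rbox q).
  apply: negligibleS nA => y [/= h1 h2]; apply: qA; split => /=.
    by move: h1; rewrite !in_itv /= => /andP[/ltW -> /ltW ->].
  by move: h2; rewrite !in_itv /= => /andP[/ltW -> /ltW ->].
move/negligibleP => /(_ (rbox_measurable q)) => /(etrans (esym (leb2_box _ _))).
rewrite !lebesgue_measure_itv /= !lte_fin (lt_trans a1 a2) (lt_trans b1 b2).
rewrite -!EFinD -EFinM => -[] /eqP; rewrite mulf_eq0 !subr_eq0.
by rewrite !gt_eqF // (lt_trans _ a2, lt_trans _ b2).
Qed.

Lemma bounded_lty_pt (A : set (pt R)) : measurable A -> bounded_set A ->
  (mu2 A < +oo)%E.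
Proof.
move=> mA [M [_ hM]].
pose B : set (pt R) := `[- (`|M| + 1), `|M| + 1]%classic `*` `[- (`|M| + 1), `|M| + 1]%classic.
apply: (@le_lt_trans _ _ (mu2 B)).
  apply: le_measure; rewrite ?inE //.
    by apply: measurableX; exact: measurable_itv.
  move=> x Ax; have : `|x| <= `|M| + 1.
    by apply: hM => //; rewrite (le_lt_trans (ler_norm M)) // ltrDl.
  rewrite prod_normE ge_max => /andP[h1 h2].
  by split; rewrite /= in_itv /= -ler_norml.
rewrite /B leb2_box.
rewrite !lebesgue_measure_itv /=; case: ifP => _; last by rewrite mule0.
by rewrite -EFinD -EFinM ltry.
Qed.

Lemma scales_area_integral F d (D : set (pt R)) (f : pt R -> R) : scales_area F d ->
  0 < d -> measurable D -> mu2.-integrable D (EFin \o f) ->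
  \int[mu2]_(x in F @^-1` D) f (F x) = d^-1 * \int[mu2]_(x in D) f x.
Proof.
move=> [mF hF] d0 mD iF.
have pos (g : pt R -> \bar R) : measurable_fun D g -> (forall x, (0 <= g x)%E) ->
    (\int[mu2]_(x in F @^-1` D) g (F x) = d^-1%:E * \int[mu2]_(x in D) g x)%E.
  move=> mg g0.
  pose mR := measurableTypeR R.
  have mF' : @measurable_fun _ _ (mR * mR)%type (mR * mR)%type setT F by [].
  have := @ge0_integral_pushforward _ _ (mR * mR)%type (mR * mR)%type R F mF'
    mu2 D g mD mg (fun x _ => g0 x).
  move=> <-.
  have d0' : 0 <= d^-1 by rewrite invr_ge0 ltW.
  rewrite -[RHS](@ge0_integral_mscale _ _ _ mu2 _ mD (NngNum d0')) //.
  by apply: eq_measure_integral => A mA _ /=; rewrite /pushforward hF.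
rewrite /Rintegral integralE.
under [X in (X - _)%E]eq_integral do rewrite -[(fun x => _)]/((EFin \o f) \o F) funepos_comp /=.
under [X in (_ - X)%E]eq_integral do rewrite -[(fun x => _)]/((EFin \o f) \o F) funeneg_comp /=.
have mf := measurable_int _ iF.
rewrite (pos (EFin \o f)^\+%E) //; last exact: measurable_funepos.
rewrite (pos (EFin \o f)^\-%E) //; last exact: measurable_funeneg.
rewrite [in RHS]integralE.
have /fineK <- := integrable_pos_fin_num (mu := mu2) mD iF.
have /fineK <- := integrable_neg_fin_num (mu := mu2) mD iF.
by rewrite -!EFinM -!EFinD /= mulrBr.
Qed.

End PlaneTopology.

(** * Partial derivatives *)

Section PartialDerivatives.
Context {R : realType}.
Implicit Types (v w : sfield R) (k : nat) (x d : pt R).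

Lemma is_derive_line v x d s df :
  is_derive (x + s *: d) d v df -> is_derive s 1 (fun t : R => v (x + t *: d)) df.
Proof.
have E : (fun h : R => h^-1 *: (((fun t : R => v (x + t *: d)) \o shift s) (h *: 1) -
      v (x + s *: d))) =
    (fun h : R => h^-1 *: ((v \o shift (x + s *: d)) (h *: d) - v (x + s *: d))).
  apply/funext => h /=; congr (_ *: (v _ - _)).
  by rewrite [_%:A]mulr1 scalerDl addrCA.
case=> dv <-; split; first by rewrite /derivable E.
by rewrite /derive E.
Qed.

(** Stated without an order on [a] and [b], which spares case distinctions for
    increments of both signs. *)
Lemma mean_value (f df : R -> R) : (forall t : R, is_derive t 1 f (df t)) ->
  forall a b : R, exists2 c, `|c - a| <= `|b - a| & f b - f a = df c * (b - a).
Proof.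
move=> fd a b.
have cf (D : set R) : {within D, continuous f}.
  apply: continuous_subspaceT => z; apply: differentiable_continuous.
  by apply/derivable1_diffP; have [] := fd z.
have [ab|ba] := leP a b.
  have [c] := MVT_segment ab (fun z _ => fd z) (cf _).
  rewrite in_itv /= => /andP[ac cb] E; exists c => //.
  by rewrite !ger0_norm ?subr_ge0 // lerD2r.
have [c] := MVT_segment (ltW ba) (fun z _ => fd z) (cf _).
rewrite in_itv /= => /andP[bc ca] E; exists c.
  have h1 : c - a <= 0 by rewrite subr_le0.
  have h2 : b - a <= 0 by rewrite subr_le0 ltW.
  by rewrite (ler0_norm h1) (ler0_norm h2) lerN2 lerD2r.
by rewrite -[LHS]opprB E -mulrN opprB.
Qed.

Lemma Ck_pred k v : Ck k.+1 v -> Ck k v.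
Proof.
elim: k v => [|k IH] v [cv h]; split=> // i.
by have [dv hv] := h i; split => //; exact: IH.
Qed.

Lemma Ck_le k k' v : (k <= k')%N -> Ck k' v -> Ck k v.
Proof.
by elim: k' => [|k' IH]; rewrite leq_eqVlt => /predU1P[-> //|] // /IH h /Ck_pred.
Qed.

Lemma Ck_cont k v : Ck k v -> continuous v.
Proof. by case: k => [|k] []. Qed.

Lemma Ck_pd k v i : Ck k.+1 v -> Ck k (pd i v).
Proof. by case=> _ /(_ i) []. Qed.

Lemma smooth_pd v i : smooth v -> smooth (pd i v).
Proof. by move=> sv k; exact/Ck_pd/sv. Qed.

Lemma Ck1_derive v : Ck 1 v -> forall i x, is_derive x (dir R i) v (pd i v x).
Proof. by move=> [_ h] i x; have [dv _] := h i; exact: derivableP. Qed.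

Lemma dirE (i : 'I_2) : i = ord0 \/ i = ord_max.
Proof. by case: i => -[|[|]] // ?; [left|right]; exact/val_inj. Qed.

(** The increment along [d] is split into one step along each axis; the mean
    value theorem and the continuity of the partial derivatives do the rest. *)
Lemma Ck1_directional v x d : Ck 1 v ->
  is_derive x d v (d.1 * pd ord0 v x + d.2 * pd ord_max v x).
Proof.
move=> C1.
have D0 (y : pt R) (t : R) : is_derive t 1 (fun s : R => v (y.1 + s, y.2)) (pd ord0 v (y.1 + t, y.2)).
  have E s : (y.1 + s, y.2) = y + s *: dir R ord0.
    by rewrite /dir /= [y in RHS]surjective_pairing; congr (_, _);
      rewrite /= ?[_ *: _]mulr1 // [_ *: _]mulr0 addr0.
  under eq_fun do rewrite E.
  by rewrite E; apply: is_derive_line; exact: Ck1_derive.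
have D1 (y : pt R) (t : R) : is_derive t 1 (fun s : R => v (y.1, y.2 + s)) (pd ord_max v (y.1, y.2 + t)).
  have E s : (y.1, y.2 + s) = y + s *: dir R ord_max.
    by rewrite /dir /= [y in RHS]surjective_pairing; congr (_, _);
      rewrite /= ?[_ *: _]mulr1 // [_ *: _]mulr0 addr0.
  under eq_fun do rewrite E.
  by rewrite E; apply: is_derive_line; exact: Ck1_derive.
have c0 : continuous (pd ord0 v) by exact: (Ck_cont (Ck_pd ord0 C1)).
have c1 : continuous (pd ord_max v) by exact: (Ck_cont (Ck_pd ord_max C1)).
suff cv : (fun h : R => h^-1 *: ((v \o shift x) (h *: d) - v x)) @ 0^' -->
    d.1 * pd ord0 v x + d.2 * pd ord_max v x.
  by split; [apply/cvg_ex; eexists; exact: cv|apply: cvg_lim => //; exact: cv].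
apply/cvgrPdist_le => /= e e0.
pose M : R := `|d.1| + `|d.2| + 1.
have M0 : 0 < M by rewrite /M ltr_wpDl // addr_ge0.
have eM : 0 < e / M by rewrite divr_gt0.
have /cvgrPdist_le /(_ _ eM) /nbhs_ballP[r0 /= r00 h0] := c0 x.
have /cvgrPdist_le /(_ _ eM) /nbhs_ballP[r1 /= r10 h1] := c1 x.
pose r : R := Num.min r0 r1 / M.
have r_gt0 : 0 < r by rewrite /r divr_gt0 // lt_min r00 r10.
exists r => //= h hr hn0; move: hr; rewrite /ball_ /= sub0r normrN => hr.
have hM1 : `|h * d.1| < Num.min r0 r1.
  rewrite normrM (le_lt_trans (y := `|h| * M)) // ?ler_wpM2l // /M.
    by rewrite -addrA lerDl addr_ge0.
  by rewrite -ltr_pdivlMr.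
have hM2 : `|h * d.2| < Num.min r0 r1.
  rewrite normrM (le_lt_trans (y := `|h| * M)) // ?ler_wpM2l // /M.
    by rewrite addrAC lerDr addr_ge0.
  by rewrite -ltr_pdivlMr.
have [c hc Ec] := mean_value (D0 (x.1, x.2 + h * d.2)) 0 (h * d.1).
have [c' hc' Ec'] := mean_value (D1 x) 0 (h * d.2).
rewrite !subr0 /= addr0 in hc Ec; rewrite !subr0 addr0 in hc' Ec'.
have -> : (v \o shift x) (h *: d) - v x =
   h * (d.1 * pd ord0 v (x.1 + c, x.2 + h * d.2) + d.2 * pd ord_max v (x.1, x.2 + c')).
  have -> : (v \o shift x) (h *: d) = v (x.1 + h * d.1, x.2 + h * d.2).
    by rewrite /=; congr v; rewrite addrC; case: (x) (d) => ? ? [].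
  have -> : v x = v (x.1, x.2) by rewrite -surjective_pairing.
  transitivity ((v (x.1 + h * d.1, x.2 + h * d.2) - v (x.1, x.2 + h * d.2))
    + (v (x.1, x.2 + h * d.2) - v (x.1, x.2))); first by ring.
  by rewrite Ec Ec'; ring.
rewrite [_ *: _]mulKf //.
have k0 : `|pd ord0 v x - pd ord0 v (x.1 + c, x.2 + h * d.2)| <= e / M.
  apply: h0; split => /=; rewrite /ball /= opprD addrA subrr add0r normrN.
    by rewrite (le_lt_trans hc) // (lt_le_trans hM1) // ge_min lexx.
  by rewrite (lt_le_trans hM2) // ge_min lexx.
have k1 : `|pd ord_max v x - pd ord_max v (x.1, x.2 + c')| <= e / M.
  apply: h1; split => /=; rewrite /ball /= ?subrr ?normr0 // opprD addrA subrr add0r normrN.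
  by rewrite (le_lt_trans hc') // (lt_le_trans hM2) // ge_min lexx orbT.
rewrite opprD addrACA -!mulrBr (le_trans (ler_normD _ _)) // !normrM.
have : `|d.1| * (e / M) + `|d.2| * (e / M) <= e.
  rewrite -mulrDl mulrA ler_pdivrMr // mulrC ler_wpM2l ?(ltW e0) //.
  by rewrite /M lerDl.
apply: le_trans; apply: lerD; exact: ler_wpM2l.
Qed.

(** Schwarz: both mixed derivatives compute the same second difference of [v]
    at points close to [x]. *)
Lemma pd_comm v : Ck 2 v -> pd ord0 (pd ord_max v) = pd ord_max (pd ord0 v).
Proof.
move=> C2; apply/funext => x.
have C1 := Ck_pred C2.
have C1x : Ck 1 (pd ord0 v) by exact: Ck_pd.
have C1y : Ck 1 (pd ord_max v) by exact: Ck_pd.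
have D0 w (y : pt R) (t : R) : Ck 1 w -> is_derive t 1 (fun s : R => w (s, y.2)) (pd ord0 w (t, y.2)).
  move=> Cw.
  have E s : (s, y.2) = (0, y.2) + s *: dir R ord0 :> pt R.
    by rewrite /dir /=; congr (_, _);
      rewrite /= ?[_ *: _]mulr1 ?add0r // [_ *: _]mulr0 addr0.
  under eq_fun do rewrite E.
  by rewrite E; apply: is_derive_line; exact: Ck1_derive.
have D1 w (y : pt R) (t : R) : Ck 1 w -> is_derive t 1 (fun s : R => w (y.1, s)) (pd ord_max w (y.1, t)).
  move=> Cw.
  have E s : (y.1, s) = (y.1, 0) + s *: dir R ord_max :> pt R.
    by rewrite /dir /=; congr (_, _);
      rewrite /= ?[_ *: _]mulr1 ?add0r // [_ *: _]mulr0 addr0.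
  under eq_fun do rewrite E.
  by rewrite E; apply: is_derive_line; exact: Ck1_derive.
have key (h : R) : h != 0 -> exists p q : pt R,
   [/\ `|p.1 - x.1| <= `|h|, `|p.2 - x.2| <= `|h|, `|q.1 - x.1| <= `|h|, `|q.2 - x.2| <= `|h|
     & pd ord_max (pd ord0 v) p = pd ord0 (pd ord_max v) q].
  move=> hn0.
  pose f1 (s : R) := v (s, x.2 + h) - v (s, x.2).
  have Df1 (t : R) : is_derive t 1 f1 (pd ord0 v (t, x.2 + h) - pd ord0 v (t, x.2)).
    exact: (is_deriveB (D0 v (0, x.2 + h) t C1) (D0 v x t C1)).
  pose f2 (s : R) := v (x.1 + h, s) - v (x.1, s).
  have Df2 (t : R) : is_derive t 1 f2 (pd ord_max v (x.1 + h, t) - pd ord_max v (x.1, t)).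
    exact: (is_deriveB (D1 v (x.1 + h, 0) t C1) (D1 v x t C1)).
  have [a ha Ea] := mean_value Df1 x.1 (x.1 + h).
  have [b hb Eb] := mean_value (fun t : R => D1 (pd ord0 v) (a, 0) t C1x) x.2 (x.2 + h).
  have [b' hb' Eb'] := mean_value Df2 x.2 (x.2 + h).
  have [a' ha' Ea'] := mean_value (fun t : R => D0 (pd ord_max v) (0, b') t C1y) x.1 (x.1 + h).
  rewrite /f1 in Ea; rewrite /f2 in Eb'.
  rewrite /= in Eb Ea'.
  have E (z : R) : z + h - z = h by ring.
  rewrite !E in ha hb ha' hb' Ea Eb Ea' Eb'.
  exists (a, b), (a', b'); split; [exact: ha|exact: hb|exact: ha'|exact: hb'|].
  apply: (mulIf hn0); apply: (mulIf hn0); rewrite -Eb -Ea'.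
  by rewrite -Ea -Eb'; ring.
have c0 : continuous (pd ord0 (pd ord_max v)) by exact: (Ck_cont (Ck_pd ord0 C1y)).
have c1 : continuous (pd ord_max (pd ord0 v)) by exact: (Ck_cont (Ck_pd ord_max C1x)).
apply/eqP; rewrite -subr_eq0 -normr_le0; apply/ler_addgt0Pr => /= e e0; rewrite add0r.
have e2 : 0 < e / 2 by rewrite divr_gt0.
have /cvgrPdist_le /(_ _ e2) /nbhs_ballP[r0 /= r00 h0] := c0 x.
have /cvgrPdist_le /(_ _ e2) /nbhs_ballP[r1 /= r10 h1] := c1 x.
pose r : R := Num.min r0 r1 / 2.
have r_gt0 : 0 < r by rewrite /r divr_gt0 // lt_min r00 r10.
have rr0 : r < r0 by rewrite /r; have : Num.min r0 r1 <= r0 by [rewrite ge_min lexx]; lra.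
have rr1 : r < r1 by rewrite /r; have : Num.min r0 r1 <= r1 by [rewrite ge_min lexx orbT]; lra.
have [p [q [p1 p2 q1 q2 E]]] := key r (lt0r_neq0 r_gt0).
rewrite (gtr0_norm r_gt0) in p1 p2 q1 q2.
have k0 := h0 q; have k1 := h1 p.
have {}k0 : `|pd ord0 (pd ord_max v) x - pd ord0 (pd ord_max v) q| <= e / 2.
  by apply: k0; split; rewrite /ball /= distrC; exact: le_lt_trans rr0.
have {}k1 : `|pd ord_max (pd ord0 v) x - pd ord_max (pd ord0 v) p| <= e / 2.
  by apply: k1; split; rewrite /ball /= distrC; exact: le_lt_trans rr1.
rewrite E in k1.
apply: le_trans (ler_distD (pd ord0 (pd ord_max v) q) _ _) _.
by rewrite (splitr e); apply: lerD; [exact: k0|rewrite distrC; exact: k1].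
Qed.

End PartialDerivatives.

(** * Smooth functions *)

Section SmoothClosure.
Context {R : realType}.
Implicit Types (v w : sfield R) (k : nat) (x d : pt R) (c : R).

Lemma Ck_derivable k v i x : Ck k.+1 v -> derivable v x (dir R i).
Proof. by move=> [_ /(_ i) []]. Qed.

Lemma Ck_cst k c : Ck k (fun=> c : R).
Proof.
elim: k c => [|k IH] c; split => //; try by move=> ?; exact: cvg_cst.
move=> i; split=> [x|]; first exact: derivable_cst.
by rewrite (_ : pd i _ = (fun=> 0)) //; apply/funext => x; exact: derive_cst.
Qed.

Lemma pdD i v w x : derivable v x (dir R i) -> derivable w x (dir R i) ->
  pd i (fun y => v y + w y) x = pd i v x + pd i w x.
Proof. exact: deriveD. Qed.

Lemma pdM i v w x : derivable v x (dir R i) -> derivable w x (dir R i) ->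
  pd i (fun y => v y * w y) x = v x * pd i w x + w x * pd i v x.
Proof. exact: deriveM. Qed.

Lemma CkD k v w : Ck k v -> Ck k w -> Ck k (fun x => v x + w x).
Proof.
elim: k v w => [|k IH] v w [cv hv] [cw hw]; split => //;
  try by move=> x; apply: cvgD; [exact: cv|exact: cw].
move=> i; have [dv Cv] := hv i; have [dw Cw] := hw i; split=> [x|].
  exact: derivableD.
rewrite (_ : pd i _ = (fun x => pd i v x + pd i w x)); last first.
  by apply/funext => x; exact: pdD.
exact: IH.
Qed.

Lemma CkM k v w : Ck k v -> Ck k w -> Ck k (fun x => v x * w x).
Proof.
elim: k v w => [|k IH] v w [cv hv] [cw hw]; split => //;
  try by move=> x; apply: cvgM; [exact: cv|exact: cw].
move=> i; have [dv Cv] := hv i; have [dw Cw] := hw i; split=> [x|].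
  exact: derivableM.
rewrite (_ : pd i _ = (fun x => v x * pd i w x + w x * pd i v x)); last first.
  by apply/funext => x; exact: pdM.
have Cv0 : Ck k v by exact: (Ck_pred (conj cv hv)).
have Cw0 : Ck k w by exact: (Ck_pred (conj cw hw)).
by apply: CkD; exact: IH.
Qed.

Lemma CkZ k c v : Ck k v -> Ck k (fun x => c * v x).
Proof. by apply: CkM; exact: Ck_cst. Qed.

Lemma CkN k v : Ck k v -> Ck k (fun x => - v x).
Proof. by move=> /(CkZ (-1)); congr Ck; apply/funext => x; rewrite mulN1r. Qed.

Lemma CkB k v w : Ck k v -> Ck k w -> Ck k (fun x => v x - w x).
Proof. by move=> Cv /CkN; exact: CkD. Qed.

Lemma CkX k v n : Ck k v -> Ck k (fun x => v x ^+ n).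
Proof.
move=> Cv; elim: n => [|n IH]; first by under eq_fun do rewrite expr0; exact: Ck_cst.
by under eq_fun do rewrite exprS; exact: CkM.
Qed.

Lemma Ck_sum k I (s : seq I) (P : pred I) (F : I -> sfield R) :
  (forall i, P i -> Ck k (F i)) -> Ck k (fun x => \sum_(i <- s | P i) F i x).
Proof.
move=> h; elim: s => [|a s IH].
  by under eq_fun do rewrite big_nil; exact: Ck_cst.
have [Pa|Pa] := boolP (P a).
  by under eq_fun do rewrite big_cons Pa; apply: CkD => //; exact: h.
by under eq_fun do rewrite big_cons (negbTE Pa).
Qed.

(** Affine functions are the building blocks of polynomials, bubble functions
    and affine maps, all of whose regularity is inherited from this one. *)
Definition lin c0 c1 c2 : sfield R := fun x => c0 + c1 * x.1 + c2 * x.2.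

Lemma lin_cont c0 c1 c2 : continuous (lin c0 c1 c2).
Proof.
move=> x; apply: cvgD; first apply: cvgD; first exact: cvg_cst.
  by apply: cvgM; [exact: cvg_cst|exact: cvg_fst].
by apply: cvgM; [exact: cvg_cst|exact: cvg_snd].
Qed.

Lemma lin_derive c0 c1 c2 x d : is_derive x d (lin c0 c1 c2) (c1 * d.1 + c2 * d.2).
Proof.
have cv : (fun h : R => h^-1 *: ((lin c0 c1 c2 \o shift x) (h *: d) - lin c0 c1 c2 x)) @ 0^' -->
    c1 * d.1 + c2 * d.2.
  apply: (@cvg_trans _ ((fun=> c1 * d.1 + c2 * d.2) @ (0 : R)^')); last exact: cvg_cst.
  apply: near_eq_cvg; near=> h; rewrite /lin /= /shift /=.
  have h0 : h != 0 by near: h; exact: nbhs_dnbhs_neq.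
  by rewrite /GRing.scale /=; field.
by split; [apply/cvg_ex; eexists; exact: cv|apply: cvg_lim => //; exact: cv].
Unshelve. all: by end_near. Qed.

Lemma Ck_lin k c0 c1 c2 : Ck k (lin c0 c1 c2).
Proof.
case: k => [|k]; split => //; try exact: lin_cont.
move=> i; split=> [x|]; first by have [] := lin_derive c0 c1 c2 x (dir R i).
rewrite (_ : pd i _ = (fun=> c1 * (dir R i).1 + c2 * (dir R i).2)); first exact: Ck_cst.
by apply/funext => x; have [] := lin_derive c0 c1 c2 x (dir R i).
Qed.

Lemma fst_lin : (fst : sfield R) = lin 0 1 0.
Proof. by apply/funext => x; rewrite /lin add0r mul1r mul0r addr0. Qed.
Lemma snd_lin : (snd : sfield R) = lin 0 0 1.
Proof. by apply/funext => x; rewrite /lin add0r mul1r mul0r add0r. Qed.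

Lemma Ck_poly k n v : is_poly n v -> Ck k v.
Proof.
move=> [c /funext ->]; apply: Ck_sum => i _; apply: Ck_sum => j _.
apply: CkM; first apply: CkM; first exact: Ck_cst.
  by apply: CkX; have := Ck_lin k 0 1 0; rewrite -fst_lin.
by apply: CkX; have := Ck_lin k 0 0 1; rewrite -snd_lin.
Qed.

Lemma smooth_poly n v : is_poly n v -> smooth v.
Proof. by move=> pv k; exact: Ck_poly pv. Qed.

(** The affine map with value [a] at the origin and columns [d1], [d2]. *)
Definition aff (a d1 d2 : pt R) : pt R -> pt R :=
  fun s => (lin a.1 d1.1 d2.1 s, lin a.2 d1.2 d2.2 s).

Lemma aff_shift a d1 d2 x d h :
  aff a d1 d2 (h *: d + x) = h *: (d.1 *: d1 + d.2 *: d2) + aff a d1 d2 x.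
Proof. by rewrite /aff /lin; congr (_, _); rewrite /= /GRing.scale /=; ring. Qed.

Lemma aff_cont a d1 d2 : continuous (aff a d1 d2).
Proof. by move=> x; exact: (cvg_pair (@lin_cont _ _ _ x) (@lin_cont _ _ _ x)). Qed.

Definition cdir (d1 d2 : pt R) (i : 'I_2) := if i == ord0 then d1 else d2.

Lemma aff_dir a d1 d2 x i h :
  aff a d1 d2 (h *: dir R i + x) = h *: cdir d1 d2 i + aff a d1 d2 x.
Proof.
rewrite aff_shift /dir /cdir; case: ifP => _ /=.
  by rewrite scale1r scale0r addr0.
by rewrite scale1r scale0r add0r.
Qed.

Lemma aff_derive v a d1 d2 i x : Ck 1 v ->
  is_derive x (dir R i) (v \o aff a d1 d2)
    ((cdir d1 d2 i).1 * pd ord0 v (aff a d1 d2 x) + (cdir d1 d2 i).2 * pd ord_max v (aff a d1 d2 x)).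
Proof.
move=> Cv; have [h1 h2] := Ck1_directional (aff a d1 d2 x) (cdir d1 d2 i) Cv.
have E : (fun h : R => h^-1 *: (((v \o aff a d1 d2) \o shift x) (h *: dir R i) - (v \o aff a d1 d2) x))
  = (fun h : R => h^-1 *: ((v \o shift (aff a d1 d2 x)) (h *: cdir d1 d2 i) - v (aff a d1 d2 x))).
  by apply/funext => h; rewrite /= aff_dir.
by split; [rewrite /derivable E|rewrite /derive E -h2].
Qed.

Lemma pd_aff v a d1 d2 i x : Ck 1 v -> pd i (v \o aff a d1 d2) x =
  (cdir d1 d2 i).1 * pd ord0 v (aff a d1 d2 x) + (cdir d1 d2 i).2 * pd ord_max v (aff a d1 d2 x).
Proof. by move=> /(aff_derive a d1 d2 i x) []. Qed.

Lemma Ck_aff k v a d1 d2 : Ck k v -> Ck k (v \o aff a d1 d2).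
Proof.
elim: k v => [|k IH] v Cv.
  by split => // x; apply: continuous_comp; [exact: aff_cont|exact: (Ck_cont Cv)].
have C1 : Ck 1 v by exact: Ck_le Cv.
split; first by move=> x; apply: continuous_comp; [exact: aff_cont|exact: (Ck_cont Cv)].
move=> i; split=> [x|]; first by have [] := aff_derive a d1 d2 i x C1.
rewrite (_ : pd i _ = fun x => (cdir d1 d2 i).1 * (pd ord0 v \o aff a d1 d2) x +
  (cdir d1 d2 i).2 * (pd ord_max v \o aff a d1 d2) x).
  by apply: CkD; apply: CkZ; apply: IH; exact: Ck_pd.
by apply/funext => x; exact: pd_aff.
Qed.

Lemma pd_cont i v : Ck 1 v -> continuous (pd i v).
Proof. by move=> C1; exact: (Ck_cont (Ck_pd i C1)). Qed.

Lemma near_eq_pd i v w x : {near x, v =1 w} -> pd i v x = pd i w x.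
Proof.
move=> vw; rewrite /pd; have [->|d0] := eqVneq (dir R i) 0.
  by rewrite !derive0.
exact: near_eq_derive.
Qed.

End SmoothClosure.

(** * The divergence theorem on a triangle *)

Section BoundedDomains.
Context {R : realType}.
Notation mu := (@lebesgue_measure R).
Notation mu2 := (leb2 R).

Lemma continuous_bounded_pt (D : set (pt R)) (g : pt R -> R) :
  bounded_set D -> continuous g -> exists M, forall x, D x -> `|g x| <= M.
Proof.
move=> [M [_ hM]] cg.
pose K := `|M| + 1.
pose B : set (pt R) := `[- K, K]%classic `*` `[- K, K]%classic.
have cB : compact B by apply: compact_setX; exact: segment_compact.
have DB : D `<=` B.
  move=> x Ax; have : `|x| <= K.
    by apply: hM => //; rewrite /K (le_lt_trans (ler_norm M)) // ltrDl.
  rewrite prod_normE ge_max => /andP[h1 h2].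
  by split; rewrite /= in_itv /= -ler_norml.
have cgB : compact (g @` B).
  by apply: continuous_compact => //; exact: continuous_subspaceT.
have [N [_ hN]] := compact_bounded cgB.
exists (`|N| + 1) => x /DB Bx; apply: (hN (`|N| + 1)).
  by rewrite (le_lt_trans (ler_norm N)) // ltrDl.
by exists x.
Qed.

Lemma continuous_sqi_pt (D : set (pt R)) (g : pt R -> R) :
  measurable D -> bounded_set D -> continuous g -> L2 D g.
Proof.
move=> mD bD cg; have [M hM] := continuous_bounded_pt bD cg.
apply: (@sqi_bounded _ _ _ mu2 D mD g M _ _ hM); first exact: bounded_lty_pt.
by apply: measurable_funTS; exact: continuous_measurable_pt.
Qed.

Lemma continuous_integrable_pt (D : set (pt R)) (g : pt R -> R) :
  measurable D -> bounded_set D -> continuous g -> mu2.-integrable D (EFin \o g).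
Proof.
move=> mD bD cg.
have c1 : continuous (fun _ : pt R => 1 : R) by move=> x; exact: cvg_cst.
have := @sqi_integrableM _ _ _ mu2 D mD g (fun=> 1)
  (continuous_sqi_pt mD bD cg) (continuous_sqi_pt mD bD c1).
by apply: (eq_integrable (mu := mu2) mD) => x _ /=; rewrite mulr1.
Qed.

End BoundedDomains.

Section ReferenceTriangle.
Context {R : realType}.
Notation mu := (@lebesgue_measure R).
Notation mu2 := (leb2 R).
Implicit Types W : sfield R.

(** The open reference triangle. *)
Definition T0 : set (pt R) := [set s | [/\ 0 < s.1, 0 < s.2 & s.1 + s.2 < 1]].

Lemma T0_open : open T0.
Proof.
rewrite (_ : T0 = (lin 0 1 0 @^-1` `]0, +oo[) `&` (lin 0 0 1 @^-1` `]0, +oo[) `&`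
   (lin 0 1 1 @^-1` `]-oo, 1[)); last first.
  apply/seteqP; split => -[x y]; rewrite /T0 /lin /= !in_itv /= ?andbT.
    by case => ? ? ?; split; [split|]; lra.
  by case => -[? ?] ?; split; lra.
apply: openI; first apply: openI.
- by apply: open_comp => [x _|]; [exact: lin_cont|exact: interval_open].
- by apply: open_comp => [x _|]; [exact: lin_cont|exact: interval_open].
- by apply: open_comp => [x _|]; [exact: lin_cont|exact: interval_open].
Qed.

Lemma T0_measurable : measurable T0.
Proof. apply: open_measurable_pt; exact: T0_open. Qed.

Lemma T0_bounded : bounded_set T0.
Proof.
exists 1; split => // M M1 -[x y] [/= x0 y0 xy].
rewrite prod_normE ge_max /= !gtr0_norm //; apply/andP; split; lra.
Qed.

Lemma FTC_slice (f F : R -> R) (b : R) : 0 < b -> continuous f ->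
  (forall t : R, is_derive t 1 F (f t)) ->
  (\int[mu]_(x in `]0%R, b[) (f x)%:E)%E = (F b - F 0)%:E.
Proof.
move=> b0 cf dF.
have cF : continuous F.
  move=> z; apply: differentiable_continuous.
  by apply/derivable1_diffP; have [] := dF z.
rewrite -(@integral_itv_bndoo _ _ _ _ true false); last first.
  by apply/measurable_EFinP/measurable_funTS; exact: continuous_measurable_fun.
rewrite (@continuous_FTC2 _ f F) //.
- exact: continuous_subspaceT.
- split; first by move=> x _; have [] := dF x.
  + by apply: cvg_at_right_filter; exact: cF.
  + by apply: cvg_at_left_filter; exact: cF.
- by move=> x _; rewrite derive1E; have [] := dF x.
Qed.

Lemma patch_T0_integrable (g : sfield R) : continuous g ->
  mu2.-integrable setT (EFin \o (g \_ T0)).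
Proof.
move=> cg.
have := continuous_integrable_pt T0_measurable T0_bounded cg.
move/(integrable_mkcond (mu := mu2) _ T0_measurable).
by rewrite restrict_EFin.
Qed.

Lemma line_continuous (v : sfield R) (a d : pt R) : continuous v -> continuous (fun s : R => v (a + s *: d)).
Proof.
move=> cv s; apply: (@continuous_comp _ _ _ (fun s : R => a + s *: d) v); last exact: cv.
by apply: cvgD; [exact: cvg_cst|apply: cvgZr_tmp; exact: cvg_id].
Qed.

Lemma bnd_continuous (v : sfield R) (a d : pt R) : continuous v ->
  continuous (fun s : R => v (a.1 + s * d.1, a.2 + s * d.2)).
Proof. by move=> cv; exact: (@line_continuous v a d cv). Qed.

Lemma continuous_itv01_integral (f : R -> R) : continuous f ->
  (\int[mu]_(x in `]0%R, 1%R[) (f x)%:E = \int[mu]_(x in `[0%R, 1%R]) (f x)%:E)%E.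
Proof.
move=> cf; rewrite -(@integral_itv_bndoo _ _ _ _ true false) //.
by apply/measurable_EFinP/measurable_funTS; exact: continuous_measurable_fun.
Qed.

(** Fubini and the fundamental theorem of calculus on each slice. *)
Lemma div_T0_1 W : Ck 1 W ->
  \int[mu2]_(x in T0) pd ord0 W x = \int[mu]_(s in `[0, 1]) (W (1 - s, s) - W (0, s)).
Proof.
move=> C1; have cg := @pd_cont R ord0 W C1; have cW := Ck_cont C1.
have iP := patch_T0_integrable cg.
rewrite Rintegral_mkcond /Rintegral -(integral21_prod_meas1 iP).
rewrite -continuous_itv01_integral; last first.
  move=> s; apply: cvgB.
    have := @bnd_continuous W (1, 0) (-1, 1) cW s.
    by under eq_fun do rewrite /= mulrN1 mulr1 add0r.
  have := @bnd_continuous W (0, 0) (0, 1) cW s.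
  by under eq_fun do rewrite /= mulr0 mulr1 !add0r.
rewrite [in RHS]integral_mkcond; congr fine.
apply: eq_integral => y _; rewrite [in RHS]patchE.
case: ifPn => [|/negP]; rewrite inE /= in_itv /=; last move=> hy; first move=> /andP[y0 y1].
  have <- : (\int[mu]_(x in `]0%R, (1 - y)%R[) (pd ord0 W (x, y))%:E)%E = (W (1 - y, y) - W (0, y))%:E.
    apply: (@FTC_slice _ (fun x => W (x, y))); first by rewrite subr_gt0.
      move=> x; have := @bnd_continuous _ (0, y) (1, 0) cg x.
      by under eq_fun do rewrite /= mulr0 mulr1 addr0 add0r.
    move=> t; have E (z : R) : (0, y) + z *: dir R ord0 = (z, y).
      by rewrite /dir /=; congr (_, _); rewrite /= /GRing.scale /=; ring.
    have := @is_derive_line _ W (0, y) (dir R ord0) t _ (Ck1_derive C1 _ _).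
    by under eq_fun do rewrite E; rewrite E.
  rewrite [RHS]integral_mkcond; apply: eq_integral => x _ /=.
  have EE : ((x, y) \in T0) = (x \in `]0, 1 - y[%classic).
    apply/idP/idP; rewrite !inE /T0 /= in_itv /=.
      by case => ? ? ?; apply/andP; split => //; lra.
    by move=> /andP[? ?]; split => //; lra.
  by rewrite !patchE EE; case: ifP.
apply: integral0_eq => x _; rewrite /= patchE; case: ifPn => //.
by rewrite inE /T0 /= => -[? ? ?]; case: hy; apply/andP; split; lra.
Qed.

Lemma div_T0_2 W : Ck 1 W ->
  \int[mu2]_(x in T0) pd ord_max W x = \int[mu]_(s in `[0, 1]) (W (s, 1 - s) - W (s, 0)).
Proof.
move=> C1; have cg := @pd_cont R ord_max W C1; have cW := Ck_cont C1.
have iP := patch_T0_integrable cg.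
rewrite Rintegral_mkcond /Rintegral -(integral12_prod_meas1 iP).
rewrite -continuous_itv01_integral; last first.
  move=> s; apply: cvgB.
    have := @bnd_continuous W (0, 1) (1, -1) cW s.
    by under eq_fun do rewrite /= mulrN1 mulr1 add0r.
  have := @bnd_continuous W (0, 0) (1, 0) cW s.
  by under eq_fun do rewrite /= mulr0 mulr1 !add0r.
rewrite [in RHS]integral_mkcond; congr fine.
apply: eq_integral => x _; rewrite [in RHS]patchE.
case: ifPn => [|/negP]; rewrite inE /= in_itv /=; last move=> hx; first move=> /andP[x0 x1].
  have <- : (\int[mu]_(y in `]0%R, (1 - x)%R[) (pd ord_max W (x, y))%:E)%E = (W (x, 1 - x) - W (x, 0))%:E.
    apply: (@FTC_slice _ (fun y => W (x, y))); first by rewrite subr_gt0.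
      move=> y; have := @bnd_continuous _ (x, 0) (0, 1) cg y.
      by under eq_fun do rewrite /= mulr0 mulr1 addr0 add0r.
    move=> t; have E (z : R) : (x, 0) + z *: dir R ord_max = (x, z).
      by rewrite /dir /=; congr (_, _); rewrite /= /GRing.scale /=; ring.
    have := @is_derive_line _ W (x, 0) (dir R ord_max) t _ (Ck1_derive C1 _ _).
    by under eq_fun do rewrite E; rewrite E.
  rewrite [RHS]integral_mkcond; apply: eq_integral => y _ /=.
  have EE : ((x, y) \in T0) = (y \in `]0, 1 - x[%classic).
    apply/idP/idP; rewrite !inE /T0 /= in_itv /=.
      by case => ? ? ?; apply/andP; split => //; lra.
    by move=> /andP[? ?]; split => //; lra.
  by rewrite !patchE EE; case: ifP.
apply: integral0_eq => y _; rewrite /= patchE; case: ifPn => //.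
by rewrite inE /T0 /= => -[? ? ?]; case: hx; apply/andP; split; lra.
Qed.

End ReferenceTriangle.

Section Triangles.
Context {R : realType}.
Notation mu := (@lebesgue_measure R).
Notation mu2 := (leb2 R).
Implicit Types (a b c x : pt R) (w : sfield R).

Definition cross (u v : pt R) : R := u.1 * v.2 - u.2 * v.1.
Definition tdet a b c := cross (b - a) (c - a).

(** The affine map sending the reference vertices to [a], [b], [c]; [tcoord] is
    its inverse, with components the barycentric coordinates of [b] and [c]. *)
Definition tmap a b c := aff a (b - a) (c - a).
Definition tcoord a b c :=
  let D := tdet a b c in
  aff ((- cross a (c - a)) / D, (- cross (b - a) a) / D)
      ((c - a).2 / D, - (b - a).2 / D) (- (c - a).1 / D, (b - a).1 / D).
Definition tri a b c : set (pt R) := tcoord a b c @^-1` T0.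

Section OneTriangle.
Context (a b c : pt R) (D0 : tdet a b c != 0).
Let D := tdet a b c.
Let F := tmap a b c.

Lemma tmapK : cancel (tmap a b c) (tcoord a b c).
Proof.
move=> s; rewrite [RHS]surjective_pairing /tmap /tcoord /aff /lin.
move: D0; rewrite /tdet /cross /= => D0'.
by congr (_, _); field.
Qed.

Lemma tcoordK : cancel (tcoord a b c) (tmap a b c).
Proof.
move=> s; rewrite [RHS]surjective_pairing /tmap /tcoord /aff /lin.
move: D0; rewrite /tdet /cross /= => D0'.
by congr (_, _); field.
Qed.

Lemma tri_open : open (tri a b c).
Proof. by apply: open_comp => [x _|]; [exact: aff_cont|exact: T0_open]. Qed.

Lemma tri_measurable : measurable (tri a b c).
Proof. by apply: open_measurable_pt; exact: tri_open. Qed.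

Lemma tmap_tri : tmap a b c @^-1` tri a b c = T0.
Proof. by apply/seteqP; split => s; rewrite /tri /= tmapK. Qed.

Lemma tri_bounded : bounded_set (tri a b c).
Proof.
have [M1 h1] := continuous_bounded_pt (@T0_bounded R)
  (@lin_cont R a.1 (b - a).1 (c - a).1).
have [M2 h2] := continuous_bounded_pt (@T0_bounded R)
  (@lin_cont R a.2 (b - a).2 (c - a).2).
exists (Num.max M1 M2); split; first exact: num_real.
move=> M hM x Tx; change (`|x| <= M); rewrite -(tcoordK x) /tmap /aff prod_normE ge_max.
move: hM; rewrite gt_max => /andP[m1 m2].
apply/andP; split; [exact: le_trans (h1 _ Tx) (ltW m1)|exact: le_trans (h2 _ Tx) (ltW m2)].
Qed.

Lemma tmap_scales : scales_area (tmap a b c) `|D|.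
Proof.
have := @scales_area_affine R (b - a).1 (c - a).1 a.1 (b - a).2 (c - a).2 a.2.
rewrite [_ * _ - _](_ : _ = D); last by rewrite /D /tdet /cross; ring.
move=> /(_ D0); congr scales_area; apply/funext => s.
by rewrite /tmap /aff /lin; congr (_, _); ring.
Qed.

Lemma tri_integral (f : sfield R) : mu2.-integrable (tri a b c) (EFin \o f) ->
  \int[mu2]_(x in tri a b c) f x = `|D| * \int[mu2]_(s in T0) f (F s).
Proof.
move=> iF; have D0' : 0 < `|D| by rewrite normr_gt0.
rewrite -tmap_tri (scales_area_integral tmap_scales D0' tri_measurable iF).
by rewrite mulrA mulfV ?mul1r // gt_eqF.
Qed.

Lemma tri_measure : mu2 (tri a b c) = (`|D|%:E * mu2 T0)%E.
Proof.
rewrite -tmap_tri; have [_ ->] := tmap_scales; last exact: tri_measurable.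
by rewrite muleA -EFinM mulfV ?mul1e // normr_eq0.
Qed.

(** The mean of [w] over the segment, rather than its arc-length integral. *)
Definition segint w p q := \int[mu]_(s in `[0, 1]) w (p + s *: (q - p)).

Lemma segint_sym w p q : continuous w -> segint w p q = segint w q p.
Proof.
move=> cw; rewrite /segint.
have := @Rintegration_by_substitution_onem R (fun s => w (p + s *: (q - p))) 1.
rewrite ler01 lexx => /(_ isT) ->; last first.
  exact/continuous_subspaceT/line_continuous.
rewrite unstable.onem1; apply: eq_Rintegral => s _; congr w.
by rewrite [LHS]surjective_pairing [RHS]surjective_pairing; congr (_, _);
  rewrite /= /unstable.onem /GRing.scale /=; ring.
Qed.

Lemma continuous_itv_integrable (f : R -> R) : continuous f ->
  mu.-integrable `[0%R, 1%R] (EFin \o f).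
Proof.
move=> cf; apply: continuous_compact_integrable; first exact: segment_compact.
exact: continuous_subspaceT.
Qed.

(** The integrals over the three sides are those of the Gauss formula, with
    the unnormalized normals of the sides; the sign of the determinant accounts
    for the orientation of [a], [b], [c]. *)
Lemma tri_div w : Ck 1 w ->
  Num.sg D * \int[mu2]_(x in tri a b c) pd ord0 w x =
    (c - a).2 * (segint w b c - segint w a c) - (b - a).2 * (segint w b c - segint w a b) /\
  Num.sg D * \int[mu2]_(x in tri a b c) pd ord_max w x =
    (b - a).1 * (segint w b c - segint w a b) - (c - a).1 * (segint w b c - segint w a c).
Proof.
move=> C1; have cw := Ck_cont C1.
have cT i : continuous (pd i w) by exact: pd_cont.
have mT := tri_measurable; have bT := tri_bounded.
have CW : Ck 1 (w \o F) by exact: Ck_aff.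
have cWi i : mu2.-integrable T0 (EFin \o pd i (w \o F)).
  by apply: continuous_integrable_pt; [exact: T0_measurable|exact: T0_bounded|exact: pd_cont].
have cF i : mu2.-integrable T0 (EFin \o (fun s => pd i w (F s))).
  apply: continuous_integrable_pt; [exact: T0_measurable|exact: T0_bounded|].
  by move=> s; apply: (@continuous_comp _ _ _ F (pd i w)); [exact: aff_cont|exact: cT].
have E1 : \int[mu2]_(s in T0) pd ord0 (w \o F) s = segint w b c - segint w a c.
  rewrite div_T0_1 // -RintegralB //.
  - apply: eq_Rintegral => s _; congr (_ - _); congr w.
      by rewrite [RHS]surjective_pairing /F /tmap /aff /lin; congr (_, _);
        rewrite /= /GRing.scale /=; ring.
    by rewrite [RHS]surjective_pairing /F /tmap /aff /lin; congr (_, _);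
        rewrite /= /GRing.scale /=; ring.
  - exact/continuous_itv_integrable/line_continuous.
  - exact/continuous_itv_integrable/line_continuous.
have E2 : \int[mu2]_(s in T0) pd ord_max (w \o F) s = segint w b c - segint w a b.
  rewrite div_T0_2 // (segint_sym b c) // -RintegralB //.
  - apply: eq_Rintegral => s _; congr (_ - _); congr w.
      by rewrite [RHS]surjective_pairing /F /tmap /aff /lin; congr (_, _);
        rewrite /= /GRing.scale /=; ring.
    by rewrite [RHS]surjective_pairing /F /tmap /aff /lin; congr (_, _);
        rewrite /= /GRing.scale /=; ring.
  - exact/continuous_itv_integrable/line_continuous.
  - exact/continuous_itv_integrable/line_continuous.
have P i s := @pd_aff R w a (b - a) (c - a) i s C1.
have lc (f g : sfield R) (r t : R) : mu2.-integrable T0 (EFin \o f) ->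
    mu2.-integrable T0 (EFin \o g) ->
    r * \int[mu2]_(s in T0) f s - t * \int[mu2]_(s in T0) g s =
    \int[mu2]_(s in T0) (r * f s - t * g s).
  move=> i1 i2; rewrite RintegralB; [|exact: T0_measurable| |].
  - by rewrite !(RintegralZl (mu := mu2)) //; exact: T0_measurable.
  - exact: (integrableZl (mu := mu2) T0_measurable r i1).
  - exact: (integrableZl (mu := mu2) T0_measurable t i2).
split; rewrite tri_integral ?mulrA -?numEsg; try exact: continuous_integrable_pt.
- rewrite -E1 -E2 lc //; rewrite -(RintegralZl (mu := mu2) D T0_measurable (cF _)).
  apply: eq_Rintegral => s _; rewrite !P /cdir /= /D /tdet /cross /=; ring.
- rewrite -E1 -E2 lc //; rewrite -(RintegralZl (mu := mu2) D T0_measurable (cF _)).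
  apply: eq_Rintegral => s _; rewrite !P /cdir /= /D /tdet /cross /=; ring.
Qed.

End OneTriangle.
End Triangles.

(** * Test functions and the fundamental lemma of the calculus of variations *)

Section FlatFunctions.
Context {R : realType}.
Implicit Types (n k : nat).

(** Up to the factor [x^-n] these are the classical flat function
    [exp (-1/x)]; the linear span of the family is closed under
    differentiation. *)
Definition flat n (x : R) : R := if 0 < x then x^-1 ^+ n * expR (- x^-1) else 0.

Lemma flat_ge0 n x : 0 <= flat n x.
Proof.
rewrite /flat; case: ifPn => // x0; rewrite mulr_ge0 ?expR_ge0 // exprn_ge0 //.
by rewrite invr_ge0 ltW.
Qed.

Lemma flat0_le1 x : flat 0 x <= 1.
Proof.
rewrite /flat; case: ifPn => // x0; rewrite expr0 mul1r expR_le1 oppr_le0.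
by rewrite invr_ge0 ltW.
Qed.

(** The exponential dominates every power, so that all these functions vanish
    at 0 to first order; this gives their derivative there. *)
Lemma flat_le n x : 0 <= x -> flat n x <= (n.+1)`!%:R * x.
Proof.
rewrite le_eqVlt => /predU1P[<-|x0]; first by rewrite /flat ltxx mulr0.
rewrite /flat x0 expRN ler_pdivrMr ?expR_gt0 //.
have x1 : 0 <= x^-1 by rewrite invr_ge0 ltW.
have h : x^-1 * x^-1 ^+ n <= expR x^-1 * (n.+1)`!%:R.
  rewrite -exprS -ler_pdivrMr ?ltr0n ?fact_gt0 //.
  by apply: le_trans (expR_ge1Dxn n x1); rewrite lerDr.
have -> : x^-1 ^+ n = x * (x^-1 * x^-1 ^+ n) by rewrite mulrA mulfV ?mul1r ?gt_eqF.
rewrite (_ : _ * x * _ = x * (expR x^-1 * (n.+1)`!%:R)); last by ring.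
by rewrite ler_wpM2l // ltW.
Qed.

Definition flat' n (x : R) : R := flat n.+2 x - n%:R * flat n.+1 x.

Lemma flat_derive n (x : R) : is_derive x (1 : R) (flat n) (flat' n x).
Proof.
have [x0|x0|x0] := ltrgtP x 0.
- apply: (@near_eq_is_derive _ _ _ (cst 0)) => //.
    near=> y; rewrite /flat ltNge (_ : y <= 0) //; apply: ltW; near: y.
    exact: lt_nbhsl.
  rewrite /flat' /flat !ltNge (ltW x0) /= mulr0 subr0; exact: is_derive_cst.
- apply: (@near_eq_is_derive _ _ _ (fun y : R => y^-1 ^+ n * expR (- y^-1))) => //.
    near=> y; rewrite /flat (_ : 0 < y) //; near: y.
    exact: lt_nbhsr.
  have xn0 : x != 0 by rewrite gt_eqF.
  have dV : is_derive x (1 : R) (fun y : R => y^-1) (- (x^-1 ^+ 2)).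
    have := @is_deriveV R id x 1 1 xn0 (is_derive_id _ _).
    by congr is_derive; rewrite exprVn /GRing.scale /= mulr1.
  have dE : is_derive x (1 : R) (expR \o (fun y : R => - y^-1)) (expR (- x^-1) * x^-1 ^+ 2).
    by apply: is_derive1_comp; rewrite -[x^-1 ^+ 2]opprK; exact: is_deriveN.
  have := is_deriveM (is_deriveX n dV) dE.
  have -> : (fun y : R => y^-1) ^+ n = (fun y : R => y^-1 ^+ n).
    elim: (n) => [|m IH]; first by apply/funext => y; rewrite !expr0.
    by apply/funext => y; rewrite exprS IH /= exprS.
  move=> h; apply: (is_derive_eq h); rewrite /flat' /flat x0 /GRing.scale /=.
  case: (n) => [|m]; first by rewrite !expr0 !mul0r; ring.
  by rewrite /= !exprS; ring.
rewrite x0; have cv : (fun h : R => h^-1 *: ((flat n \o shift 0) (h *: 1) - flat n 0)) @ 0^' --> (0 : R).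
  apply/cvgrPdist_le => /= e e0.
  pose K : R := (n.+2)`!%:R.
  have K0 : 0 < K by rewrite /K ltr0n fact_gt0.
  exists (e / K); first by rewrite /= divr_gt0.
  move=> h; rewrite /ball_ /= sub0r normrN => hK hn0.
  rewrite sub0r normrN [X in _ - X](_ : _ = 0) ?subr0; last by rewrite /flat ltxx.
  rewrite /shift /= addr0 [h *: 1]mulr1 /flat.
  case: ifPn => h0; last by rewrite scaler0 normr0 ltW.
  rewrite [_ *: _]mulrA -exprS; have := flat_le n.+1 (ltW h0); have := flat_ge0 n.+1 h.
  rewrite /flat h0 => h1 h2; rewrite ger0_norm //; apply: le_trans h2 _.
  by rewrite mulrC -ler_pdivlMr // ltW // (le_lt_trans _ hK) // ler_norm.
have E0 : flat' n 0 = 0 by rewrite /flat' /flat ltxx mulr0 subr0.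
rewrite E0; split; [by apply/cvg_ex; eexists; exact: cv|apply: cvg_lim => //; exact: cv].
Unshelve. all: by end_near. Qed.

End FlatFunctions.

Section Bumps.
Context {R : realType}.
Implicit Types (n k : nat) (x d : pt R).
Notation mu2 := (leb2 R).

Lemma is_derive_scale (f : R -> R) (y c a : R) :
  is_derive y (1 : R) f a -> is_derive y c f (c * a).
Proof.
move=> [df <-]; have dd : differentiable f y by apply/derivable1_diffP.
split; first exact: diff_derivable.
by rewrite !deriveE // -[c in LHS]mulr1 -[c * 1]/(c *: (1 : R)) linearZ.
Qed.

Lemma flat_lin_derive n c0 c1 c2 x d :
  is_derive x d (flat n \o lin c0 c1 c2)
    ((c1 * d.1 + c2 * d.2) * flat' n (lin c0 c1 c2 x)).
Proof.
set c := c1 * d.1 + c2 * d.2.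
have [h1 h2] := is_derive_scale c (flat_derive n (lin c0 c1 c2 x)).
have E : (fun h : R => h^-1 *: (((flat n \o lin c0 c1 c2) \o shift x) (h *: d) - (flat n \o lin c0 c1 c2) x))
  = (fun h : R => h^-1 *: ((flat n \o shift (lin c0 c1 c2 x)) (h *: c) - flat n (lin c0 c1 c2 x))).
  apply/funext => h; rewrite /= /shift; congr (_ *: (flat n _ - _)).
  by rewrite /lin /c /= /GRing.scale /=; ring.
by split; [rewrite /derivable E|rewrite /derive E -h2].
Qed.

Lemma flat_continuous n : continuous (@flat R n).
Proof.
move=> x; apply: differentiable_continuous; apply/derivable1_diffP.
by have [] := flat_derive n x.
Qed.

Lemma Ck_flat_lin k n c0 c1 c2 : Ck k (@flat R n \o lin c0 c1 c2).
Proof.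
have C n' : continuous (@flat R n' \o lin c0 c1 c2).
  by move=> x; apply: continuous_comp; [exact: lin_cont|exact: flat_continuous].
elim: k n => [|k IH] n; split => // i; split=> [x|].
  by have [] := flat_lin_derive n c0 c1 c2 x (dir R i).
rewrite (_ : pd i _ = fun x => (c1 * (dir R i).1 + c2 * (dir R i).2) *
   ((flat n.+2 \o lin c0 c1 c2) x - n%:R * (flat n.+1 \o lin c0 c1 c2) x)).
  by apply: CkZ; apply: CkB; [exact: IH|apply: CkZ; exact: IH].
by apply/funext => x; have [] := flat_lin_derive n c0 c1 c2 x (dir R i).
Qed.

(** Smooth approximations of the indicator of the box [(a,b) x (c,e)]. *)
Definition bump (a b c e : R) k : sfield R := fun x =>
  (flat 0 \o lin (- (k%:R * a)) k%:R 0) x * (flat 0 \o lin (k%:R * b) (- k%:R) 0) x *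
  ((flat 0 \o lin (- (k%:R * c)) 0 k%:R) x * (flat 0 \o lin (k%:R * e) 0 (- k%:R)) x).

Lemma bump_smooth a b c e k : smooth (bump a b c e k).
Proof. by move=> m; apply: CkM; apply: CkM; exact: Ck_flat_lin. Qed.

Lemma flat_neq0 n (y : R) : flat n y != 0 -> 0 < y.
Proof. by rewrite /flat; case: ifP => //; rewrite eqxx. Qed.

Lemma bump_support a b c e k x : bump a b c e k.+1 x != 0 ->
  (`]a, b[ `*` `]c, e[)%classic x.
Proof.
have k0 : 0 < (k.+1)%:R :> R by rewrite ltr0n.
rewrite /bump !mulf_eq0 !negb_or /= => /andP[/andP[/flat_neq0 h1 /flat_neq0 h2]].
move=> /andP[/flat_neq0 h3 /flat_neq0 h4].
move: h1 h2 h3 h4; rewrite /lin !mul0r !addr0 !mulNr => h1 h2 h3 h4.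
split; rewrite /= in_itv /=.
  rewrite -(ltr_pM2l k0 a) -(ltr_pM2l k0 x.1 b); apply/andP; split; lra.
rewrite -(ltr_pM2l k0 c) -(ltr_pM2l k0 x.2 e); apply/andP; split; lra.
Qed.

Lemma bump_01 a b c e k x : 0 <= bump a b c e k x <= 1.
Proof.
rewrite /bump /= !mulr_ge0 ?flat_ge0 //=.
by do 2! (apply: mulr_ile1; rewrite ?mulr_ge0 ?flat_ge0 ?flat0_le1 //); apply: mulr_ile1; rewrite ?flat_ge0 ?flat0_le1.
Qed.

Lemma bump_test (D : set (pt R)) a b c e k :
  (`[a, b] `*` `[c, e])%classic `<=` D -> test_fun D (bump a b c e k.+1).
Proof.
move=> bD.
have cB : compact (`[a, b] `*` `[c, e])%classic.
  by apply: compact_setX; exact: segment_compact.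
have clB : closed (`[a, b] `*` `[c, e] : set (pt R))%classic.
  by apply: compact_closed => //; exact: norm_hausdorff.
have sub : closure [set x | bump a b c e k.+1 x != 0] `<=` (`[a, b] `*` `[c, e])%classic.
  rewrite [X in _ `<=` X]((closure_id _).1 clB); apply: closure_subset => x /= /bump_support[].
  rewrite /= !in_itv /= => /andP[h1 h2] /andP[h3 h4].
  by split; rewrite /= ?h1; apply/andP; split; exact: ltW.
split; [exact: bump_smooth| |exact: subset_trans bD].
by apply: (subclosed_compact _ cB sub); exact: closed_closure.
Qed.

Lemma flat0_cvg (t : R) : 0 < t -> (fun k => flat 0 (k.+1%:R * t)) @ \oo --> (1 : R).
Proof.
move=> t0.
have E k : flat 0 (k.+1%:R * t) = expR (- (t^-1 * k.+1%:R^-1)).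
  by rewrite /flat mulr_gt0 ?ltr0n // expr0 mul1r invfM mulrC.
under eq_fun do rewrite E.
have h0 : (fun k : nat => - (t^-1 * k.+1%:R^-1)) @ \oo --> (0 : R).
  rewrite -[X in _ --> X]oppr0; apply: cvgN; rewrite -[X in _ --> X](mulr0 t^-1).
  by apply: cvgMl_tmp; exact: cvg_harmonic.
have := cvg_comp _ _ h0 (@continuous_expR R 0); rewrite expR0; exact.
Qed.

Lemma bump_cvg a b c e x :
  (fun k => bump a b c e k.+1 x) @ \oo -->
  (\1_((`]a, b[ `*` `]c, e[)%classic : set (pt R)) x : R).
Proof.
rewrite indicE; have [|/negP] := boolP (_ \in _); rewrite inE.
  move=> [/=]; rewrite !in_itv /= => /andP[h1 h2] /andP[h3 h4].
  rewrite (_ : true%:R = 1 * 1 * (1 * 1) :> R); last by rewrite !mulr1.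
  have L' (u v w : nat -> R) (t : R) : 0 < t ->
      (forall k, lin (u k) (v k) (w k) x = k.+1%:R * t) ->
      (fun k => (flat 0 \o lin (u k) (v k) (w k)) x) @ \oo --> (1 : R).
    by move=> t0 h; under eq_fun do rewrite /= h; exact: flat0_cvg.
  apply: cvgM; apply: cvgM.
  - by apply: (L' _ _ _ (x.1 - a)); [rewrite subr_gt0|move=> k; rewrite /lin; ring].
  - by apply: (L' _ _ _ (b - x.1)); [rewrite subr_gt0|move=> k; rewrite /lin; ring].
  - by apply: (L' _ _ _ (x.2 - c)); [rewrite subr_gt0|move=> k; rewrite /lin; ring].
  - by apply: (L' _ _ _ (e - x.2)); [rewrite subr_gt0|move=> k; rewrite /lin; ring].
move=> nB; rewrite (_ : (fun k => _) = (fun=> 0)); first exact: cvg_cst.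
by apply/funext => k; apply/eqP; apply: contra_notT nB => /bump_support.
Qed.

End Bumps.

Section VanishingIntegrals.
Context {R : realType}.
Notation mu := (@lebesgue_measure R).
Notation mu2 := (leb2 R).
Notation mR := (measurableTypeR R).
Local Open Scope ereal_scope.

Lemma integral_setC_split (Q S : set (mR * mR)) (d : pt R -> \bar R) :
  measurable Q -> measurable S -> mu2.-integrable Q d ->
  \int[mu2]_(x in Q) d x =
  \int[mu2]_(x in Q `&` S) d x + \int[mu2]_(x in Q `&` ~` S) d x.
Proof.
move=> mQ mS iQ.
rewrite -integral_setU; first by rewrite -setIUr setUv setIT.
- exact: measurableI.
- by apply: measurableI => //; exact: measurableC.
- by rewrite -setIUr setUv setIT; exact: measurable_int iQ.
- by apply/disj_setPS => x [[_ Sx] [_ nSx]].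
Qed.

(** Dynkin's argument: the sets over which a function has zero integral form a
    lambda-system. *)
Lemma dynkin_integral0 dT (T : measurableType dT) (pi : mR * mR -> T)
    (G : set (set T)) (Q : set (mR * mR)) (d : pt R -> \bar R) :
  measurable_fun setT pi -> measurable Q -> mu2.-integrable Q d ->
  @measurable _ T = <<s G >> -> setI_closed G ->
  \int[mu2]_(x in Q) d x = 0 ->
  (forall A, G A -> \int[mu2]_(x in Q `&` pi @^-1` A) d x = 0) ->
  forall A, measurable A -> \int[mu2]_(x in Q `&` pi @^-1` A) d x = 0.
Proof.
move=> mpi mQ iQ mG GI Q0 G0 A mA.
have mpre B : measurable B -> measurable (pi @^-1` B).
  by move=> mB; rewrite -[X in measurable X]setTI; exact: mpi.
have iI B : measurable B -> mu2.-integrable (Q `&` pi @^-1` B) d.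
  move=> mB; apply: integrableS iQ => //.
  by apply: measurableI => //; exact: mpre.
suff h : forall S, <<s G >> S -> \int[mu2]_(x in Q `&` pi @^-1` S) d x = 0.
  by apply: h; rewrite -mG.
apply: dynkin_induction mG GI _ _ _ _ => /=.
- by rewrite preimage_setT setIT.
- exact: G0.
- move=> S mS S0; have := integral_setC_split mQ (mpre _ mS) iQ.
  by rewrite Q0 S0 add0e => <-.
- move=> F mF tF F0; rewrite preimage_bigcup setI_bigcupr.
  rewrite integral_bigcup.
  + by under eq_eseriesr do rewrite F0; rewrite eseries0.
  + apply/trivIsetP => i j _ _ ij; rewrite setIACA setIid -preimage_setI.
    by move/trivIsetP : tF => /(_ i j I I ij) ->; rewrite preimage_set0 setI0.
  + by move=> k; apply: measurableI => //; exact: mpre.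
  + rewrite -setI_bigcupr -preimage_bigcup; apply: iI.
    exact: bigcup_measurable.
Qed.

Let oitv : set (set mR) := [set A | exists x y : R, A = `]x, y[%classic].

Let oitvI : setI_closed oitv.
Proof.
move=> _ _ [a [b ->]] [c [e ->]]; exists (Num.max a c), (Num.min b e).
apply/seteqP; split => x /=; rewrite !in_itv /= gt_max lt_min.
  by move=> [/andP[-> ->] /andP[-> ->]].
by move=> /andP[/andP[-> ->] /andP[-> ->]].
Qed.

Let m_oitv : @measurable _ mR = <<s oitv >>.
Proof. exact: RGenOpens.measurableE. Qed.

(** The pi-lambda argument is run in one variable at a time, then for products. *)
Lemma integral0_boxes (a0 b0 c0 e0 : R) (Q := (`]a0, b0[ `*` `]c0, e0[)%classic)
    (d : pt R -> \bar R) : mu2.-integrable Q d ->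
  (forall a b c e : R,
    \int[mu2]_(x in Q `&` (`]a, b[ `*` `]c, e[)%classic) d x = 0) ->
  forall S : set (mR * mR), measurable S -> \int[mu2]_(x in Q `&` S) d x = 0.
Proof.
move=> iQ Qbox.
have mI (a b : R) : @measurable _ mR `]a, b[%classic by exact: measurable_itv.
have mQ : measurable (Q : set (mR * mR)) by apply: measurableX; exact: mI.
have Q0 : \int[mu2]_(x in Q) d x = 0 by rewrite -(Qbox a0 b0 c0 e0) setIid.
have step1 (c e : R) A : measurable A ->
    \int[mu2]_(x in Q `&` (A `*` `]c, e[%classic)) d x = 0.
  move=> mA.
  have mQ' : measurable (Q `&` snd @^-1` `]c, e[%classic : set (mR * mR)).
    apply: measurableI => //; rewrite -[X in measurable X]setTI.
    by apply: measurable_snd => //; exact: mI.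
  rewrite (_ : Q `&` (A `*` _) = (Q `&` snd @^-1` `]c, e[%classic) `&` fst @^-1` A); last first.
    by apply/seteqP; split => -[x y] /=; [case=> ? [? ?]|case=> -[? ?] ?].
  apply: (@dynkin_integral0 _ mR fst oitv) => //.
  - by apply: integrableS iQ => // x [].
  - rewrite -[RHS](Qbox a0 b0 c e); congr integral.
    by apply/seteqP; split => -[x y] /= [[? ?]]; [move=> ?; split|case].
  - move=> _ [a [b ->]]; rewrite -[RHS](Qbox a b c e); congr integral.
    by apply/seteqP; split => -[x y] /=; [case=> -[? ?] ?|case=> ? [? ?]].
have step2 A B : measurable A -> measurable B ->
    \int[mu2]_(x in Q `&` (A `*` B)) d x = 0.
  move=> mA mB.
  have mQ' : measurable (Q `&` fst @^-1` A : set (mR * mR)).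
    apply: measurableI => //; rewrite -[X in measurable X]setTI.
    exact: measurable_fst.
  rewrite (_ : Q `&` (A `*` _) = (Q `&` fst @^-1` A) `&` snd @^-1` B); last first.
    by apply/seteqP; split => -[x y] /=; [case=> ? [? ?]|case=> -[? ?] ?].
  apply: (@dynkin_integral0 _ mR snd oitv) => //.
  - by apply: integrableS iQ => // x [].
  - rewrite -[RHS](step1 c0 e0 A mA); congr integral.
    by apply/seteqP; split => -[x y] /= [[? ?]]; [move=> ?; split|case].
  - move=> _ [c [e ->]]; rewrite -[RHS](step1 c e A mA); congr integral.
    by apply/seteqP; split => -[x y] /=; [case=> -[? ?] ?|case=> ? [? ?]].
move=> S mS.
pose G : set (set (mR * mR)) :=
  [set A `*` B | A in @measurable _ mR & B in @measurable _ mR].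
have := @dynkin_integral0 _ (mR * mR)%type id G Q d (@measurable_id _ _ _) mQ iQ _ _ Q0 _ S mS.
apply.
- exact: measurable_prod_measurableType.
- move=> _ _ [A1 mA1 [A2 mA2 <-]] [B1 mB1 [B2 mB2 <-]].
  exists (A1 `&` B1); first exact: measurableI.
  exists (A2 `&` B2); first exact: measurableI.
  by rewrite setXI.
- by move=> _ [A mA [B mB <-]]; exact: step2.
Qed.

End VanishingIntegrals.

Section DuBoisReymond.
Context {R : realType}.
Notation mu2 := (leb2 R).
Notation mR := (measurableTypeR R).

(** Dominated convergence along smooth bumps that tend to the indicator of the
    box. *)
Lemma test_integral_box (D : set (pt R)) (d : sfield R) (a b c e : R) :
  measurable D -> mu2.-integrable D (EFin \o d) ->
  (forall phi, test_fun D phi -> ip D d phi = 0) ->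
  (`[a, b] `*` `[c, e])%classic `<=` D ->
  (\int[mu2]_(x in (`]a, b[ `*` `]c, e[)%classic) (d x)%:E = 0)%E.
Proof.
move=> mD iD h bD.
pose B : set (mR * mR) := (`]a, b[ `*` `]c, e[)%classic.
have mB : measurable B by apply: measurableX; exact: measurable_itv.
have BD : B `<=` D.
  move=> x [/= h1 h2]; apply: bD; split => /=; move: h1 h2; rewrite !in_itv /=.
    by move=> /andP[/ltW -> /ltW ->].
  by move=> _ /andP[/ltW -> /ltW ->].
have md := measurable_int _ iD.
have mbump k : measurable_fun D (bump a b c e k).
  apply: measurable_funTS; apply: continuous_measurable_pt.
  exact: (Ck_cont (bump_smooth a b c e k 0)).
pose f_ k (x : mR * mR) := (d x * bump a b c e k.+1 x)%:E.
pose f (x : mR * mR) := (d x * \1_B x)%:E.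
have mf_ k : measurable_fun D (f_ k).
  apply/measurable_EFinP/measurable_funM; first exact/measurable_EFinP.
  exact: mbump.
have mf : measurable_fun D f.
  by apply/measurable_EFinP/measurable_funM; first exact/measurable_EFinP.
have cvf : {ae mu2, forall x, D x -> f_ ^~ x @ \oo --> f x}.
  apply: aeW => x _; apply: cvg_EFin; first exact: nearW.
  rewrite /f_ /f /=; apply: cvgMl_tmp; exact: bump_cvg.
have iabs : mu2.-integrable D (abse \o (EFin \o d)) by exact: integrable_abse.
have dom : {ae mu2, forall x n, D x -> (`|f_ n x| <= (abse \o (EFin \o d)) x)%E}.
  apply: aeW => x n _; change (`|d x * bump a b c e n.+1 x|%:E <= `|d x|%:E)%E.
  rewrite lee_fin normrM ler_piMr //.
  by have /andP[h0 h1] := bump_01 a b c e n.+1 x; rewrite ger0_norm.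
have [_ _ cvI] := dominated_convergence (mu := mu2) mD mf_ mf cvf iabs dom.
have int0 k : (\int[mu2]_(x in D) f_ k x = 0)%E.
  have := h _ (bump_test k bD); rewrite /ip /Rintegral => E.
  rewrite -[LHS]fineK ?E //; apply: (integrable_fin_num (mu := mu2) mD).
  apply: (le_integrable (mu := mu2) mD (mf_ k) _ iD).
  move=> x Dx; change (`|d x * bump a b c e k.+1 x|%:E <= `|d x|%:E)%E.
  rewrite lee_fin normrM ler_piMr //.
  by have /andP[h0 h1] := bump_01 a b c e k.+1 x; rewrite ger0_norm.
(* the integrals along the sequence vanish, hence so does their limit *)
have E0 : (\int[mu2]_(x in D) f x = 0)%E.
  move/cvg_lim : cvI => <- //; rewrite (_ : (fun n => _) = cst 0%E) ?lim_cst //.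
  by apply/funext => k; exact: int0.
transitivity (\int[mu2]_(x in D `&` B) (d x)%:E)%E; first by rewrite (setIidr BD).
rewrite -[RHS]E0 integral_mkcondr; apply: eq_integral => x _.
by rewrite patchE /f indicE; case: ifP => _; rewrite ?mulr1 ?mulr0.
Qed.

(** An open set is a countable union of rational boxes, and on each of them the
    function integrates to 0 over every measurable subset. *)
Lemma du_bois_reymond (D : set (pt R)) (d : sfield R) :
  open D -> mu2.-integrable D (EFin \o d) ->
  (forall phi, test_fun D phi -> ip D d phi = 0) ->
  {ae mu2, forall x, D x -> d x = 0}.
Proof.
move=> oD iD h; have mD := open_measurable_pt oD.
have box q : rcbox q `<=` D -> {ae mu2, forall x, rbox q x -> d x = 0}.
  move=> qD; have mq := @rbox_measurable R q.
  have qD' : rbox q `<=` D.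
    move=> x [/= h1 h2]; apply: qD; split => /=; move: h1 h2; rewrite !in_itv /=.
      by move=> /andP[/ltW -> /ltW ->].
    by move=> _ /andP[/ltW -> /ltW ->].
  have iq : mu2.-integrable (rbox q) (EFin \o d).
    apply: integrableS iD; [exact: mD|exact: mq|exact: qD'].
  have Z := @integral0_boxes R (ratr q.1.1) (ratr q.1.2) (ratr q.2.1) (ratr q.2.2)
    (EFin \o d) iq.
  have : ae_eq mu2 (rbox q) (EFin \o d) (cst 0%E).
    apply: (@integral_ae_eq _ (mR * mR)%type R mu2 _ mq (cst 0%E) (EFin \o d) iq) => //.
    move=> E EQ mE; rewrite [RHS]integral0 -{}[RHS](Z _ E mE).
      by congr integral; apply/esym/setIidr.
    move=> a b c e.
    rewrite (_ : _ `&` _ = (`]Num.max (ratr q.1.1) a, Num.min (ratr q.1.2) b[ `*`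
      `]Num.max (ratr q.2.1) c, Num.min (ratr q.2.2) e[)%classic); last first.
      apply/seteqP; split => -[x y]; rewrite /= !in_itv /= !gt_max !lt_min.
        by case=> -[/andP[-> ->] /andP[-> ->]] [/andP[-> ->] /andP[-> ->]].
      by case=> /andP[/andP[-> ->] /andP[-> ->]] /andP[/andP[-> ->] /andP[-> ->]].
    apply: (test_integral_box mD iD h) => -[x y] /= [].
    rewrite !in_itv /= !ge_max !le_min.
    move=> /andP[/andP[a1 a2] /andP[a3 a4]] /andP[/andP[b1 b2] /andP[b3 b4]].
    by apply: qD; split; rewrite /= in_itv /= ?a1 ?b1.
  by move=> H; apply: (ae_imp (mu := mu2) H) => x hx Dx; have := hx Dx => /= -[].
have : {ae mu2, forall x, forall n : nat,
    if unpickle n is Some q then rcbox q `<=` D -> rbox q x -> d x = 0 else True}.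
  apply: ae_foralln => n; case: unpickle => [q|]; last exact: aeW.
  have [qD|nqD] := pselect (rcbox q `<=` D).
    by apply: (ae_imp (mu := mu2) (box q qD)) => x hx _.
  by apply: aeW => x /nqD.
move=> H; apply: (ae_imp (mu := mu2) H) => x hx Dx; have [q [qx qD]] := open_rbox oD Dx.
by have := hx (pickle q); rewrite pickleK; apply.
Qed.

End DuBoisReymond.

(** * Weak derivatives *)

Section InnerProducts.
Context {R : realType}.
Notation mu2 := (leb2 R).
Context (D : set (pt R)) (mD : measurable D).
Implicit Types v w : sfield R.

Lemma L2D v w : L2 D v -> L2 D w -> L2 D (fun x => v x + w x).
Proof. exact: (@sqiD _ _ _ mu2 D mD). Qed.
Lemma L2B v w : L2 D v -> L2 D w -> L2 D (fun x => v x - w x).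
Proof. exact: (@sqiB _ _ _ mu2 D mD). Qed.
Lemma L2N v : L2 D v -> L2 D (fun x => - v x).
Proof. exact: (@sqiN _ _ _ mu2 D mD). Qed.
Lemma L2Z c v : L2 D v -> L2 D (fun x => c * v x).
Proof. exact: (@sqiZ _ _ _ mu2 D mD). Qed.
Lemma ip_integrable v w : L2 D v -> L2 D w ->
  mu2.-integrable D (EFin \o (fun x => v x * w x)).
Proof. exact: (@sqi_integrableM _ _ _ mu2 D mD). Qed.
Lemma sqL2E_ip v : L2 D v -> sqL2 D v = (ip D v v)%:E.
Proof. exact: (@sqi_sqE _ _ _ mu2 D). Qed.
Lemma ip_ge0 v : 0 <= ip D v v.
Proof. exact: (@dp_ge0 _ _ _ mu2 D). Qed.
Lemma ipC v w : ip D v w = ip D w v.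
Proof. exact: (@dpC _ _ _ mu2 D). Qed.
Lemma eq_ip v v' w w' : (forall x, D x -> v x = v' x) ->
  (forall x, D x -> w x = w' x) -> ip D v w = ip D v' w'.
Proof. exact: (@eq_dp _ _ _ mu2 D). Qed.
Lemma ae_eq_ip v v' w w' : L2 D v -> L2 D v' -> L2 D w -> L2 D w' ->
  {ae mu2, forall x, D x -> v x = v' x} -> {ae mu2, forall x, D x -> w x = w' x} ->
  ip D v w = ip D v' w'.
Proof. exact: (@ae_eq_dp _ _ _ mu2 D mD). Qed.

Lemma ipBl v v' w : L2 D v -> L2 D v' -> L2 D w ->
  ip D (fun x => v x - v' x) w = ip D v w - ip D v' w.
Proof. exact: (@dpBl _ _ _ mu2 D mD). Qed.
Lemma ipZl c v w : L2 D v -> L2 D w -> ip D (fun x => c * v x) w = c * ip D v w.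
Proof. exact: (@dpZl _ _ _ mu2 D mD). Qed.
Lemma ipNl v w : L2 D v -> L2 D w -> ip D (fun x => - v x) w = - ip D v w.
Proof. exact: (@dpNl _ _ _ mu2 D mD). Qed.
Lemma ip_young e v w : 0 < e -> L2 D v -> L2 D w ->
  `|ip D v w| <= e * ip D v v + e^-1 * ip D w w.
Proof. exact: (@dp_young _ _ _ mu2 D mD). Qed.
Lemma ip_normD v w : L2 D v -> L2 D w ->
  ip D (fun x => v x + w x) (fun x => v x + w x) <= 2 * ip D v v + 2 * ip D w w.
Proof. exact: (@dp_normD _ _ _ mu2 D mD). Qed.
Lemma le_ip_ae v w : L2 D v -> L2 D w ->
  {ae mu2, forall x, D x -> v x ^+ 2 <= w x ^+ 2} -> ip D v v <= ip D w w.
Proof. exact: (@le_dp_ae _ _ _ mu2 D mD). Qed.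
Lemma L2_ext v w : (forall x, D x -> v x = w x) -> L2 D v -> L2 D w.
Proof. exact: (@sqi_ext _ _ _ mu2 D). Qed.

Lemma dotvE (a b : 'cV[R]_2) : dotv a b = a ord0 ord0 * b ord0 ord0 + a ord_max ord0 * b ord_max ord0.
Proof.
rewrite /dotv big_ord_recl big_ord1; congr (_ + _).
by rewrite (_ : lift _ _ = ord_max) //; exact/val_inj.
Qed.

Lemma ipvE (v w : vfield R) : L2v D v -> L2v D w ->
  ipv D v w = ip D (fun x => v x ord0 ord0) (fun x => w x ord0 ord0) +
    ip D (fun x => v x ord_max ord0) (fun x => w x ord_max ord0).
Proof.
move=> Lv Lw; rewrite /ip -(RintegralD (mu := mu2) mD).
- by apply: eq_Rintegral => x _; rewrite dotvE.
- exact: (ip_integrable (Lv ord0) (Lw ord0)).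
- exact: (ip_integrable (Lv ord_max) (Lw ord_max)).
Qed.

Lemma sqL2v_ip (v : vfield R) : L2v D v ->
  sqL2v D v = (ip D (fun x => v x ord0 ord0) (fun x => v x ord0 ord0) +
    ip D (fun x => v x ord_max ord0) (fun x => v x ord_max ord0))%:E.
Proof.
move=> Lv; rewrite EFinD -(sqL2E_ip (Lv ord0)) -(sqL2E_ip (Lv ord_max)) /sqL2 /sqL2v.
rewrite -(ge0_integralD mu2 mD).
- by apply: eq_integral => x _; rewrite dotvE -!expr2 EFinD.
- by move=> x _; rewrite lee_fin sqr_ge0.
- by apply/measurable_EFinP/measurable_funX; case: (Lv ord0).
- by move=> x _; rewrite lee_fin sqr_ge0.
- by apply/measurable_EFinP/measurable_funX; case: (Lv ord_max).
Qed.

End InnerProducts.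

Section WeakDerivatives.
Context {R : realType}.
Notation mu2 := (leb2 R).
Implicit Types (v w : sfield R) (D : set (pt R)).

(** Outside the closed support, a function vanishes near the point. *)
Lemma pd_cst_out D w i x : closure [set x | w x != 0] `<=` D -> ~ D x ->
  w x = 0 /\ pd i w x = 0.
Proof.
move=> sD nDx.
have nc : ~ closure [set x | w x != 0] x by move=> /sD.
have N : \forall y \near x, w y = 0.
  have : open_nbhs x (~` closure [set x | w x != 0]).
    by split => //; apply: closed_openC; exact: closed_closure.
  move=> /open_nbhs_nbhs; apply: filterS => y /= ncy.
  by apply/eqP/negPn/negP => wy; apply: ncy; exact: subset_closure.
split; first exact: nbhs_singleton N.
have := @near_eq_pd R i w (fun=> 0) x N => ->; exact: derive_cst.
Qed.

(** Extending [w] by 0, the integral may be taken over a large triangle on whose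
    boundary [w] vanishes. *)
Lemma integral_pd_compact D w i : open D -> bounded_set D -> Ck 1 w ->
  closure [set x | w x != 0] `<=` D -> \int[mu2]_(x in D) pd i w x = 0.
Proof.
move=> oD bD C1 sD.
have [M hM] : exists M : R, forall x, D x -> `|x.1| <= M /\ `|x.2| <= M.
  have [M1 h1] := continuous_bounded_pt bD (@lin_cont R 0 1 0).
  have [M2 h2] := continuous_bounded_pt bD (@lin_cont R 0 0 1).
  exists (Num.max M1 M2) => x Dx; rewrite !le_max.
  have := h1 x Dx; have := h2 x Dx; rewrite /lin !mul0r !add0r !mul1r addr0.
  by move=> -> ->; rewrite orbT.
pose K : R := `|M| + 1.
have K0 : 0 < K by rewrite /K ltr_wpDl.
have MK : M < K by rewrite /K (le_lt_trans (ler_norm M)) // ltrDl.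
pose a : pt R := (- K, - K); pose b : pt R := (5 * K, - K); pose c : pt R := (- K, 5 * K).
have dE : tdet a b c = 36 * K ^+ 2 by rewrite /tdet /cross /=; ring.
have d0 : tdet a b c != 0 by rewrite dE mulf_neq0 ?pnatr_eq0 // expf_neq0 // gt_eqF.
have DT : D `<=` tri a b c.
  move=> x Dx; have [h1 h2] := hM x Dx.
  move: h1 h2; rewrite !ler_norml => /andP[l1 l2] /andP[l3 l4].
  have E : tcoord a b c x = ((x.1 + K) / (6 * K), (x.2 + K) / (6 * K)).
    rewrite /tcoord dE /aff /lin /cross /=; congr (_, _); field; exact: lt0r_neq0.
  rewrite /tri /= E /T0 /=; split.
  - by apply: divr_gt0; [lra|rewrite mulr_gt0].
  - by apply: divr_gt0; [lra|rewrite mulr_gt0].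
  - by rewrite -mulrDl ltr_pdivrMr ?mulr_gt0 //; lra.
have out p q : (forall s : R, 0 <= s <= 1 -> ~ D (p + s *: (q - p))) -> segint w p q = 0.
  move=> h; rewrite /segint.
  transitivity (\int[@lebesgue_measure R]_(s in `[0%R, 1%R]) (0 : R)).
    apply: eq_Rintegral => t; rewrite inE /= in_itv /= => /h nD.
    by have [] := pd_cst_out ord0 sD nD.
  by rewrite /Rintegral integral0.
have sab : segint w a b = 0.
  apply: out => s _ /hM [_]; rewrite /= /GRing.scale /= subrr mulr0 addr0 normrN gtr0_norm //.
  by rewrite leNgt MK.
have sac : segint w a c = 0.
  apply: out => s _ /hM [+ _]; rewrite /= /GRing.scale /= subrr mulr0 addr0 normrN gtr0_norm //.
  by rewrite leNgt MK.
have sbc : segint w b c = 0.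
  apply: out => s /andP[s0 s1] /hM []; rewrite /= /GRing.scale /= !ler_norml.
  by move=> /andP[_ h1] /andP[_ h2]; nra.
have intT : \int[mu2]_(x in D) pd i w x = \int[mu2]_(x in tri a b c) pd i w x.
  rewrite Rintegral_mkcond [RHS]Rintegral_mkcond; apply: eq_Rintegral => x _.
  rewrite !patchE; case: ifPn => [/set_mem Dx|nDx]; first by rewrite (mem_set (DT _ Dx)).
  case: ifP => // _; rewrite (proj2 (@pd_cst_out D w i x sD _)) //.
  by move=> Dx; move: nDx; rewrite (mem_set Dx).
have sg1 : Num.sg (tdet a b c) = 1 by rewrite gtr0_sg // dE mulr_gt0 // exprn_gt0.
rewrite intT; clear intT DT dE out; clearbody a b c.
have [h1 h2] := tri_div d0 C1.
rewrite sg1 mul1r sab sac sbc subr0 !mulr0 subr0 in h1.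
rewrite sg1 mul1r sab sac sbc subr0 !mulr0 subr0 in h2.
by have [->|->] := dirE i; [exact: h1|exact: h2].
Qed.

Lemma test_ibp D v w i : open D -> bounded_set D -> Ck 1 v -> test_fun D w ->
  ip D v (pd i w) = - ip D (pd i v) w.
Proof.
move=> oD bD Cv [sw cw sD]; have mD := open_measurable_pt oD.
have Cw : Ck 1 w by exact: sw.
have L u : continuous u -> L2 D u by exact: continuous_sqi_pt.
apply/eqP; rewrite -subr_eq0 opprK; apply/eqP.
rewrite /ip -(RintegralD (mu := mu2) mD).
- rewrite -[RHS](@integral_pd_compact D (fun x => v x * w x) i oD bD).
  + apply: eq_Rintegral => x _; rewrite pdM; first by congr (_ + _); rewrite mulrC.
      exact: Ck_derivable Cv.
    exact: Ck_derivable Cw.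
  + exact: CkM.
  + apply: subset_trans sD; apply: closure_subset => x /=.
    by rewrite mulf_eq0 negb_or => /andP[].
- by apply: (ip_integrable mD); apply: L; [exact: Ck_cont Cv|exact: pd_cont].
- by apply: (ip_integrable mD); apply: L; [exact: pd_cont|exact: Ck_cont Cw].
Qed.

Lemma smooth_is_wgrad D v : open D -> bounded_set D -> smooth v ->
  is_wgrad D v (grad v).
Proof.
move=> oD bD sv; have mD := open_measurable_pt oD; split.
  move=> i; rewrite (_ : (fun x => _) = pd i v); last by apply/funext => x; rewrite mxE.
  by apply: continuous_sqi_pt => //; apply: pd_cont; exact: sv.
move=> phi tphi i; rewrite (test_ibp i oD bD (sv 1%N) tphi); congr (- _).
by apply: eq_ip => // x _; rewrite mxE.
Qed.

Lemma test_L2 D phi : open D -> bounded_set D -> test_fun D phi -> L2 D phi.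
Proof.
move=> oD bD [sp _ _]; apply: continuous_sqi_pt => //; first exact: open_measurable_pt.
exact: (Ck_cont (sp 0)).
Qed.

Lemma smooth_L2 D v : open D -> bounded_set D -> smooth v -> L2 D v.
Proof.
move=> oD bD sp; apply: continuous_sqi_pt => //; first exact: open_measurable_pt.
exact: (Ck_cont (sp 0)).
Qed.

Lemma L2_integrable D v : open D -> bounded_set D -> L2 D v ->
  mu2.-integrable D (EFin \o v).
Proof.
move=> oD bD Lv; have mD := open_measurable_pt oD.
have L1 : L2 D (fun=> 1 : R) by apply: smooth_L2 => // k; exact: Ck_cst.
have := ip_integrable mD Lv L1.
by apply: (eq_integrable (mu := mu2) mD) => x _ /=; rewrite mulr1.
Qed.

Lemma L2_ae0 D v : open D -> bounded_set D -> L2 D v ->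
  (forall phi, test_fun D phi -> ip D v phi = 0) ->
  {ae mu2, forall x, D x -> v x = 0}.
Proof. by move=> oD bD Lv h; apply: du_bois_reymond => //; exact: L2_integrable. Qed.

Lemma is_wgrad_unique D v v' g g' i : open D -> bounded_set D ->
  L2 D v -> L2 D v' -> {ae mu2, forall x, D x -> v x = v' x} ->
  is_wgrad D v g -> is_wgrad D v' g' ->
  {ae mu2, forall x, D x -> g x i ord0 = g' x i ord0}.
Proof.
move=> oD bD Lv Lv' vv' [Lg hg] [Lg' hg']; have mD := open_measurable_pt oD.
have H : {ae mu2, forall x, D x -> g x i ord0 - g' x i ord0 = 0}.
  apply: (L2_ae0 oD bD); first exact: (L2B mD (Lg i) (Lg' i)).
  move=> phi tphi; have Lp := test_L2 oD bD tphi.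
  rewrite (ipBl mD (Lg i) (Lg' i) Lp); apply/eqP; rewrite subr_eq0 -eqr_opp.
  rewrite -hg // -hg' //; apply/eqP.
  have Lpd : L2 D (pd i phi) by apply: smooth_L2 => //; apply: smooth_pd; case: tphi.
  by apply: (ae_eq_ip mD) => //; exact: aeW.
by apply: (ae_imp (mu := mu2) H) => x h Dx; apply/eqP; rewrite -subr_eq0 h.
Qed.

Lemma wgradP D v : (exists g, is_wgrad D v g) -> is_wgrad D v (wgrad D v).
Proof. by move=> [g hg]; rewrite /wgrad; case: xgetP => [_ -> //|/(_ g)]. Qed.

(** The weak gradient is only defined through a choice; uniqueness identifies it
    with the classical one for functions that agree almost everywhere with a
    smooth function. *)
Lemma wgrad_smooth D v w i : open D -> bounded_set D -> L2 D v -> smooth w ->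
  {ae mu2, forall x, D x -> v x = w x} ->
  is_wgrad D v (wgrad D v) /\
  {ae mu2, forall x, D x -> wgrad D v x i ord0 = pd i w x}.
Proof.
move=> oD bD Lv sw vw; have mD := open_measurable_pt oD.
have Lw := smooth_L2 oD bD sw; have Gw := smooth_is_wgrad oD bD sw.
have Gv : is_wgrad D v (wgrad D v).
  apply: wgradP; exists (grad w); split; first by case: Gw.
  move=> phi tphi j; rewrite -(Gw.2 phi tphi j).
  apply: (ae_eq_ip mD) => //; try exact: aeW;
    by apply: smooth_L2 => //; apply: smooth_pd; case: tphi.
split=> //; have H := is_wgrad_unique i oD bD Lv Lw vw Gv Gw.
by apply: (ae_imp (mu := mu2) H) => x h Dx; rewrite h // mxE.
Qed.

Lemma test_H10 D phi : open D -> bounded_set D -> test_fun D phi -> H10 D phi.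
Proof.
move=> oD bD tphi; have mD := open_measurable_pt oD.
have [sphi _ _] := tphi; have Lp := test_L2 oD bD tphi.
have W i := wgrad_smooth i oD bD Lp sphi (aeW _ (fun x _ => erefl)).
split=> //; first by exists (grad phi); exact: smooth_is_wgrad.
move=> e e0; exists phi => //.
rewrite (_ : sqL2 D _ = 0%E) ?add0e; last first.
  by apply: integral0_eq => x _; rewrite subrr expr0n.
have [[Lg _] _] := W ord0.
have Lgp : L2v D (grad phi) by have [] := smooth_is_wgrad oD bD sphi.
have Z i : ip D (fun x => (wgrad D phi x - grad phi x) i ord0)
    (fun x => (wgrad D phi x - grad phi x) i ord0) = 0.
  have LB : L2 D (fun x => (wgrad D phi x - grad phi x) i ord0).
    by apply: (@L2_ext _ _ _ _ _ (L2B mD (Lg i) (Lgp i))) => x _; rewrite !mxE.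
  have L0 : L2 D (fun=> 0 : R) by apply: smooth_L2 => // k; exact: Ck_cst.
  have H : {ae mu2, forall x, D x -> (wgrad D phi x - grad phi x) i ord0 = 0}.
    apply: (ae_imp (mu := mu2) (W i).2) => x h Dx.
    by rewrite !mxE h // subrr.
  rewrite (ae_eq_ip mD LB L0 LB L0 H H) /ip /Rintegral.
  by rewrite integral0_eq // => x _; rewrite mulr0.
rewrite (sqL2v_ip mD) ?Z ?addr0 ?lte_fin // => i.
by apply: (@L2_ext _ _ _ _ _ (L2B mD (Lg i) (Lgp i))) => x _; rewrite !mxE.
Qed.

Lemma wdivP D q : (exists d, is_wdiv D q d) -> is_wdiv D q (wdiv D q).
Proof. by move=> [g hg]; rewrite /wdiv; case: xgetP => [_ -> //|/(_ g)]. Qed.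

Lemma is_wdiv_unique D q d d' : open D -> bounded_set D ->
  is_wdiv D q d -> is_wdiv D q d' -> {ae mu2, forall x, D x -> d x = d' x}.
Proof.
move=> oD bD [Lg hg] [Lg' hg']; have mD := open_measurable_pt oD.
have H : {ae mu2, forall x, D x -> d x - d' x = 0}.
  apply: (L2_ae0 oD bD); first exact: L2B.
  move=> phi tphi; have Lp := test_L2 oD bD tphi.
  rewrite (ipBl mD Lg Lg' Lp); apply/eqP; rewrite subr_eq0 -eqr_opp.
  by rewrite -hg // -hg' .
by apply: (ae_imp (mu := mu2) H) => x h Dx; apply/eqP; rewrite -subr_eq0 h.
Qed.

End WeakDerivatives.

(** * Comparison of quadratic forms *)

Section QuadraticForms.
Context {R : realType}.

Definition qform (I : finType) (G : I -> I -> R) (c : I -> R) : R :=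
  \sum_i \sum_j c i * c j * G i j.

Lemma continuous_bigsum (T : topologicalType) I (s : seq I) (F : I -> T -> R) :
  (forall i, continuous (F i)) -> continuous (fun x => \sum_(i <- s) F i x).
Proof.
move=> h; elim: s => [|i s IH].
  by under eq_fun do rewrite big_nil; move=> x; exact: cvg_cst.
by under eq_fun do rewrite big_cons; move=> x; apply: cvgD; [exact: h|exact: IH].
Qed.

(** Two quadratic forms on a finite-dimensional space are comparable as soon as
    one is positive definite; compactness of the unit sphere gives the constant. *)
Lemma qform_bound (I : finType) (G B : I -> I -> R) :
  (forall c, (exists i, c i != 0) -> 0 < qform G c) ->
  exists2 C, 0 < C & forall c, qform B c <= C * qform G c.
Proof.
move=> pG; pose n := #|I|.
pose co (v : 'rV[R]_n) : I -> R := fun i => v ord0 (enum_rank i).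
have qZ (H : I -> I -> R) k v : qform H (co (k *: v)) = k ^+ 2 * qform H (co v).
  rewrite /qform mulr_sumr; apply: eq_bigr => i _; rewrite mulr_sumr.
  by apply: eq_bigr => j _; rewrite /co !mxE; ring.
have coK c : co (\row_k c (enum_val k)) =1 c.
  by move=> i; rewrite /co mxE enum_rankK.
have cq : continuous (fun v => qform G (co v)).
  apply: continuous_bigsum => i; apply: continuous_bigsum => j v.
  apply: (@continuousM _ _ (fun v => co v i * co v j) (fun=> G i j)).
    by apply: (@continuousM _ _ (co^~ i) (co^~ j)); exact: coord_continuous.
  exact: cst_continuous.
pose S : set 'rV[R]_n := [set v | `|v| = 1].
have [[v0 Sv0]|S0] := pselect (S !=set0); last first.
  exists 1 => // c; pose v : 'rV[R]_n := \row_k c (enum_val k).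
  have v0 : v = 0.
    apply/eqP; apply: contra_notT S0 => vn0; exists (`|v|^-1 *: v).
    by rewrite /S /= normrZ normfV normr_id mulVf // normr_eq0.
  have c0 i : c i = 0 by rewrite -coK -/v v0 /co mxE.
  by rewrite mul1r /qform !big1 // => i _; rewrite big1 // => j _; rewrite c0 !mul0r.
have cS : compact S.
  apply: bounded_closed_compact.
    by exists 1; split => // M M1 v; rewrite /S /= => ->; exact: ltW.
  rewrite (_ : S = (fun v : 'rV[R]_n => `|v|) @^-1` [set 1]) //.
  by apply: closed_comp; [move=> v _; exact: norm_continuous|exact: closed_eq].
have [vm Svm hm] := EVT_min_rV (ex_intro _ v0 Sv0) cS (continuous_subspaceT cq).
pose m := qform G (co vm).
have m0 : 0 < m.
  apply: pG; apply: contrapT => h; move: Svm; rewrite inE /S /= => n1.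
  suff v0' : vm = 0 by move: n1; rewrite v0' normr0 => /eqP; rewrite eq_sym oner_eq0.
  apply/rowP => k; rewrite mxE; apply/eqP; apply: contra_notT h => nk.
  by exists (enum_val k); rewrite /co enum_valK.
pose M := 1 + \sum_i \sum_j `|B i j|.
have M0 : 0 < M by rewrite /M ltr_wpDr // sumr_ge0 // => i _; rewrite sumr_ge0.
exists (M / m); first by rewrite divr_gt0.
move=> c; pose v : 'rV[R]_n := \row_k c (enum_val k).
have qE H : qform H c = qform H (co v).
  by apply: eq_bigr => i _; apply: eq_bigr => j _; rewrite !coK.
rewrite !qE; have [->|v1] := eqVneq v 0.
  have -> : (0 : 'rV[R]_n) = 0 *: vm by rewrite scale0r.
  by rewrite !qZ expr0n !mul0r mulr0.
have nv0 : 0 < `|v| by rewrite normr_gt0.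
have hG : m * `|v| ^+ 2 <= qform G (co v).
  have Sv : S (`|v|^-1 *: v) by rewrite /S /= normrZ normfV normr_id mulVf // gt_eqF.
  have := hm _ (mem_set Sv); rewrite qZ exprVn -/m.
  by rewrite mulrC ler_pdivlMr // exprn_gt0.
have hB : qform B (co v) <= M * `|v| ^+ 2.
  apply: (@le_trans _ _ (\sum_i \sum_j `|B i j| * `|v| ^+ 2)).
    apply: ler_sum => i _; apply: ler_sum => j _.
    apply: le_trans (ler_norm _) _; rewrite !normrM mulrC ler_wpM2l // expr2.
    have le_co (k : I) : `|co v k| <= `|v|.
      rewrite /co [leRHS]/Num.norm /= mx_normrE.
      by apply/bigmax_geP; right => /=; exists (ord0, enum_rank k).
    exact: ler_pM.
  rewrite /M mulrDl mul1r ler_wpDl ?sqr_ge0 // mulr_suml.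
  by apply: ler_sum => i _; rewrite mulr_suml.
apply: (le_trans hB); rewrite -mulrA ler_wpM2l ?(ltW M0) //.
by rewrite mulrC ler_pdivlMr // mulrC.
Qed.

End QuadraticForms.

Section GramForms.
Context d (T : measurableType d) (R : realType) (mu : {measure set T -> \bar R}).
Context (D : set T) (mD : measurable D) (I : finType).

Lemma sqi_comb (c : I -> R) (f : I -> T -> R) : sqi mu D (fun=> 0) ->
  (forall i, sqi mu D (f i)) -> sqi mu D (fun x => \sum_i c i * f i x).
Proof.
move=> s0 sf; elim: (index_enum I) => [|i s IH].
  by apply: sqi_ext s0 => x _; rewrite big_nil.
apply: (@sqi_ext _ _ _ _ _ (fun x => c i * f i x + \sum_(j <- s) c j * f j x)).
  by move=> x _; rewrite big_cons.
by apply: sqiD => //; exact: sqiZ.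
Qed.

Lemma dp_suml (s : seq I) (c : I -> R) (f : I -> T -> R) g : sqi mu D (fun=> 0) ->
  (forall i, sqi mu D (f i)) -> sqi mu D g ->
  sqi mu D (fun x => \sum_(i <- s) c i * f i x) /\
  dp mu D (fun x => \sum_(i <- s) c i * f i x) g = \sum_(i <- s) c i * dp mu D (f i) g.
Proof.
move=> s0 sf sg; elim: s => [|i s [IH1 IH2]].
  split; first by apply: sqi_ext s0 => x _; rewrite big_nil.
  rewrite big_nil /dp /Rintegral integral0_eq // => x _.
  by rewrite big_nil mul0r.
split.
  apply: (@sqi_ext _ _ _ _ _ (fun x => c i * f i x + \sum_(j <- s) c j * f j x)).
    by move=> x _; rewrite big_cons.
  by apply: sqiD => //; exact: sqiZ.
rewrite big_cons -IH2 -(dpZl mD) // -(dpDl mD) //; last exact: sqiZ.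
by apply: eq_dp => // x _; rewrite big_cons.
Qed.

Lemma dp_qform (c : I -> R) (f g : I -> T -> R) : sqi mu D (fun=> 0) ->
  (forall i, sqi mu D (f i)) -> (forall i, sqi mu D (g i)) ->
  dp mu D (fun x => \sum_i c i * f i x) (fun x => \sum_i c i * g i x) =
  qform (fun i j => dp mu D (f i) (g j)) c.
Proof.
move=> s0 sf sg.
have Sg' : sqi mu D (fun x => \sum_i c i * g i x) by exact: sqi_comb.
rewrite (dp_suml _ c s0 sf Sg').2; apply: eq_bigr => i _.
rewrite dpC (dp_suml _ c s0 sg (sf i)).2 mulr_sumr.
by apply: eq_bigr => j _; rewrite dpC; ring.
Qed.

End GramForms.

(** * Polynomials in two variables *)

Section PolynomialSpaces.
Context {R : realType}.
Implicit Types (q p : sfield R) (n m : nat).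

(** Lists of terms make sums, products and affine substitutions of polynomials
    immediate, without reindexing coefficient arrays. *)
Definition polyl n q : Prop := exists s : seq (R * (nat * nat)),
  all (fun t => t.2.1 + t.2.2 <= n)%N s /\
  forall x, q x = \sum_(t <- s) t.1 * (x.1 ^+ t.2.1 * x.2 ^+ t.2.2).

Lemma polyl_eq n q p : q =1 p -> polyl n q -> polyl n p.
Proof. by move=> /funext ->. Qed.

Lemma polyl_le n m q : (n <= m)%N -> polyl n q -> polyl m q.
Proof.
move=> nm [s [h1 h2]]; exists s; split => //.
by apply: sub_all h1 => t h; exact: leq_trans nm.
Qed.

Lemma polylD n q p : polyl n q -> polyl n p -> polyl n (fun x => q x + p x).
Proof.
move=> [s [h1 h2]] [s' [h1' h2']]; exists (s ++ s'); split.
  by rewrite all_cat h1.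
by move=> x; rewrite big_cat h2 h2'.
Qed.

Lemma polylM n m q p : polyl n q -> polyl m p -> polyl (n + m) (fun x => q x * p x).
Proof.
move=> [s [h1 h2]] [s' [h1' h2']].
exists [seq (t.1 * t'.1, (t.2.1 + t'.2.1, t.2.2 + t'.2.2)%N) | t <- s, t' <- s'].
split.
  apply/allP => t /allpairsP[[t1 t2] [/= i1 i2 ->]] /=.
  have := allP h1 _ i1; have := allP h1' _ i2; rewrite addnACA /= => a b.
  exact: leq_add.
move=> x; rewrite h2 h2' big_allpairs_dep mulr_suml; apply: eq_bigr => t _.
rewrite mulr_sumr; apply: eq_bigr => t' _ /=; rewrite !exprD; ring.
Qed.

Lemma polyl_cst n (k : R) : polyl n (fun=> k).
Proof.
exists [:: (k, (0, 0)%N)]; split => // x.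
by rewrite big_seq1 /= !expr0 !mulr1.
Qed.

Lemma polyl_lin c0 c1 c2 : polyl 1 (@lin R c0 c1 c2).
Proof.
exists [:: (c0, (0, 0)%N); (c1, (1, 0)%N); (c2, (0, 1)%N)]; split => // x.
by rewrite !big_cons big_nil /= !expr0 !expr1 /lin; ring.
Qed.

Lemma polylX n q m : polyl n q -> polyl (m * n) (fun x => q x ^+ m).
Proof.
move=> pq; elim: m => [|m IH].
  by apply: (@polyl_eq _ (fun=> 1)) (polyl_cst _ _) => x; rewrite expr0.
rewrite mulSn; apply: (@polyl_eq _ (fun x => q x * q x ^+ m)) (polylM pq IH) => x.
by rewrite exprS.
Qed.

Lemma polyl_sum n (s : seq (R * (nat * nat))) (F : R * (nat * nat) -> sfield R) :
  (forall t, t \in s -> polyl n (F t)) -> polyl n (fun x => \sum_(t <- s) F t x).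
Proof.
elim: s => [|t s IH] h.
  by apply: (@polyl_eq _ (fun=> 0)) (polyl_cst _ _) => x; rewrite big_nil.
apply: (@polyl_eq _ (fun x => F t x + \sum_(t <- s) F t x)).
  by move=> x; rewrite big_cons.
apply: polylD; first by apply: h; rewrite mem_head.
by apply: IH => u us; apply: h; rewrite inE us orbT.
Qed.

Lemma is_poly_polyl n q : is_poly n q -> polyl n q.
Proof.
move=> [c hc].
exists [seq (c (nat_of_ord k.1) (nat_of_ord k.2), (nat_of_ord k.1, nat_of_ord k.2)) |
   k <- enum [pred k : 'I_n.+1 * 'I_n.+1 | (k.1 + k.2 <= n)%N]]; split.
  by apply/allP => t /mapP[k]; rewrite mem_enum inE => h ->.
move=> x; rewrite hc big_map big_enum /=.
rewrite pair_big_dep /=; apply: eq_bigr => k _; rewrite mulrA //.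
Qed.

Lemma polyl_aff n q a d1 d2 : polyl n q -> polyl n (q \o @aff R a d1 d2).
Proof.
move=> [s [h1 h2]].
apply: (@polyl_eq _ (fun x => \sum_(t <- s) t.1 * ((aff a d1 d2 x).1 ^+ t.2.1 * (aff a d1 d2 x).2 ^+ t.2.2))).
  by move=> x; rewrite /= h2.
apply: polyl_sum => t ts; apply: (polyl_le (allP h1 _ ts)).
apply: (polylM (n := 0) (polyl_cst 0 t.1)).
apply: polylM; rewrite -[X in polyl X]muln1.
  exact: (polylX _ (polyl_lin _ _ _)).
exact: (polylX _ (polyl_lin _ _ _)).
Qed.

Definition mono n (k : 'I_n.+1 * 'I_n.+1) : sfield R := fun x => x.1 ^+ k.1 * x.2 ^+ k.2.

Lemma polyl_mono n q : polyl n q ->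
  exists c : 'I_n.+1 * 'I_n.+1 -> R, forall x, q x = \sum_k c k * mono k x.
Proof.
move=> [s [+ h2]].
suff h : forall s : seq (R * (nat * nat)), all (fun t => t.2.1 + t.2.2 <= n)%N s ->
   exists c : 'I_n.+1 * 'I_n.+1 -> R,
   forall x : pt R, \sum_(t <- s) t.1 * (x.1 ^+ t.2.1 * x.2 ^+ t.2.2) = \sum_k c k * mono k x.
  by move=> /h [c hc]; exists c => x; rewrite h2 hc.
elim=> [|t u IH] /=.
  by move=> _; exists (fun=> 0) => x; rewrite big_nil big1 // => k _; rewrite mul0r.
move=> /andP[ht /IH [c hc]].
have l1 : (t.2.1 < n.+1)%N by rewrite ltnS (leq_trans _ ht) // leq_addr.
have l2 : (t.2.2 < n.+1)%N by rewrite ltnS (leq_trans _ ht) // leq_addl.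
pose k0 := (Ordinal l1, Ordinal l2).
exists (fun k => (if k == k0 then t.1 else 0) + c k) => x.
rewrite big_cons hc; under [RHS]eq_bigr do rewrite mulrDl.
rewrite big_split /=; congr (_ + _).
rewrite (bigD1 k0) //= eqxx big1 ?addr0 // => k /negbTE ->; exact: mul0r.
Qed.

Lemma Ck_mono m n k : Ck m (@mono n k).
Proof.
apply: (CkM (v := fun x => x.1 ^+ k.1) (w := fun x => x.2 ^+ k.2)).
  by apply: (CkX (v := fst)); rewrite fst_lin; exact: Ck_lin.
by apply: (CkX (v := snd)); rewrite snd_lin; exact: Ck_lin.
Qed.

Lemma mono_cont n k : continuous (@mono n k).
Proof. exact: (Ck_cont (Ck_mono 0 k)). Qed.

(** A nonzero polynomial has fewer roots than its size. *)
Lemma coefs_eq0 n (c : 'I_n.+1 -> R) (e : R) : 0 < e ->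
  (forall x, 0 < x < e -> \sum_i c i * x ^+ i = 0) -> forall i, c i = 0.
Proof.
move=> e0 h; pose p := \poly_(i < n.+1) c (inord i).
have pE x : p.[x] = \sum_i c i * x ^+ i.
  by rewrite horner_poly; apply: eq_bigr => i _; rewrite inord_val.
suff p0 : p = 0.
  by move=> i; have := coef_poly n.+1 (fun i => c (inord i)) i; rewrite -/p p0 coef0 ltn_ord inord_val.
apply/eqP; apply: contraT => pn0.
(* n + 2 roots in ]0, e[, one more than the size of [p] allows *)
pose rs := [seq e / (k.+2)%:R | k <- iota 0 n.+2].
have : (size rs < size p)%N.
  apply: max_poly_roots => //.
    apply/allP => _ /mapP[k _ ->]; apply/eqP; rewrite pE h //.
    rewrite divr_gt0 ?ltr0n //= ltr_pdivrMr ?ltr0n //.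
    by rewrite ltr_pMr // ltr1n.
  rewrite map_inj_uniq ?iota_uniq // => k k' /(mulfI (lt0r_neq0 e0)) /invr_inj /eqP.
  by rewrite eqr_nat => /eqP [].
rewrite size_map size_iota => /leq_trans /(_ (size_poly _ _)).
by rewrite ltnNge leqnSn.
Qed.

(** The monomials are independent on the reference triangle: freeze one variable,
    then use the independence of powers in each variable. *)
Lemma mono_free n (c : 'I_n.+1 * 'I_n.+1 -> R) :
  (forall x, T0 x -> \sum_k c k * mono k x = 0) -> forall k, c k = 0.
Proof.
move=> h [i j].
have half : 0 < 2^-1 :> R by rewrite invr_gt0.
apply: (coefs_eq0 (c := fun i => c (i, j)) half) => x /andP[x0 x1].
apply: (coefs_eq0 (c := fun j => \sum_i c (i, j) * x ^+ i) half) => y /andP[y0 y1].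
rewrite -[RHS](h (x, y)); last by split => //=; lra.
rewrite (eq_bigr (fun k => c (k.1, k.2) * (x ^+ k.1 * y ^+ k.2))); last by case.
rewrite -(pair_bigA _ (fun a b => c (a, b) * (x ^+ a * y ^+ b))) /= exchange_big /=.
by apply: eq_bigr => b _; rewrite mulr_suml; apply: eq_bigr => a _; rewrite mulrA.
Qed.

End PolynomialSpaces.

(** * Bubble functions *)

Section ReferenceEstimates.
Context {R : realType}.
Notation mu := (@lebesgue_measure R).
Notation mu2 := (leb2 R).
Let mT0 : measurable (T0 : set (pt R)) := T0_measurable.
Let bT0 : bounded_set (T0 : set (pt R)) := T0_bounded.
Let oT0 : open (T0 : set (pt R)) := T0_open.

Lemma Ck_comb (I : finType) k (c : I -> R) (F : I -> sfield R) :
  (forall i, Ck k (F i)) -> Ck k (fun x => \sum_i c i * F i x).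
Proof. by move=> h; apply: Ck_sum => i _; exact: CkZ. Qed.

Lemma pd_comb (I : finType) (c : I -> R) (F : I -> sfield R) j x :
  (forall i, Ck 1 (F i)) ->
  pd j (fun x => \sum_i c i * F i x) x = \sum_i c i * pd j (F i) x.
Proof.
move=> h; rewrite /index_enum; elim: (Finite.enum I) => [|i s IH].
  rewrite big_nil (_ : (fun x => _) = (fun=> 0)); first exact: derive_cst.
  by apply/funext => y; rewrite big_nil.
rewrite big_cons -IH.
have Cs : Ck 1 (fun x => \sum_(i <- s) c i * F i x).
  by apply: Ck_sum => k _; exact: CkZ.
have CZ : Ck 1 (fun x => c i * F i x) by exact: CkZ.
rewrite (_ : (fun x => _) = (fun x => c i * F i x + \sum_(i <- s) c i * F i x)); last first.
  by apply/funext => y; rewrite big_cons.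
rewrite pdD; [|exact: Ck_derivable CZ|exact: Ck_derivable Cs].
congr (_ + _); rewrite pdM; [|exact: Ck_derivable (Ck_cst 1 (c i))|exact: Ck_derivable (h i)].
have -> : pd j (fun=> c i) x = 0 by exact: derive_cst.
by rewrite mulr0 addr0.
Qed.

(** The product of the three barycentric coordinates. *)
Definition ebub : sfield R := fun x => x.1 * x.2 * (1 - x.1 - x.2).

Lemma Ck_ebub k : Ck k ebub.
Proof.
rewrite (_ : ebub = fun x => lin 0 1 0 x * lin 0 0 1 x * lin 1 (-1) (-1) x).
  by apply: CkM; first apply: CkM; exact: Ck_lin.
by apply/funext => x; rewrite /ebub /lin; ring.
Qed.

Lemma ebub_gt0 x : T0 x -> 0 < ebub x.
Proof. by case=> ? ? ?; rewrite /ebub !mulr_gt0 //; lra. Qed.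

Lemma ebub_le1 x : T0 x -> ebub x <= 1.
Proof.
case=> x1 x2 x12; rewrite /ebub; have h1 : x.1 <= 1 by lra.
have h2 : x.2 <= 1 by lra.
apply: mulr_ile1; [apply: mulr_ge0; exact: ltW|lra| |lra].
by apply: mulr_ile1 => //; exact: ltW.
Qed.

(** The set where a continuous integrand is not 0 is open, and no nonempty open
    set is negligible. *)
Lemma ip_eq0 (D : set (pt R)) (f g : sfield R) : open D -> bounded_set D ->
  continuous f -> continuous g ->
  (forall x, D x -> 0 <= f x * g x) -> ip D f g = 0 -> forall x, D x -> f x * g x = 0.
Proof.
move=> oD bD cf cg pos I0 x Dx; have mD := open_measurable_pt oD.
have cfg : continuous (fun x => f x * g x) by move=> y; apply: continuousM; [exact: cf|exact: cg].
have ifg : mu2.-integrable D (EFin \o (fun x => f x * g x)).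
  exact: continuous_integrable_pt.
have E0 : (\int[mu2]_(x in D) `|(EFin \o (fun x => f x * g x)%R) x| = 0)%E.
  under eq_integral => y /set_mem Dy do rewrite /= ger0_norm ?pos //.
  rewrite -[LHS]fineK; first by rewrite -[fine _]/(ip D f g) I0.
  exact: (integrable_fin_num (mu := mu2) mD).
have mfg := measurable_int _ ifg.
have /(ae_eq_integral_abs mu2 mD mfg) H := E0.
pose S : set (pt R) := D `&` (fun x => f x * g x) @^-1` [set~ 0].
have oS : open S.
  apply: openI => //; apply: open_comp => [y _|]; first exact: cfg.
  by apply: closed_openC; exact: closed_eq.
have nS : mu2.-negligible S.
  move: H => [N [mN N0 sN]]; exists N; split => // y [Dy /= nz]; apply: sN => /= h.
  by apply: nz; have [] := h Dy.
have S0 := negligible_open_pt oS nS.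
by apply: contrapT => nz; have : S x by []; rewrite S0.
Qed.

(** The bubble is positive in the open triangle, so that weighting by it keeps
    the scalar product of polynomials definite. *)
Lemma elt_reference n : exists2 C : R, 0 < C & forall q : sfield R, polyl n q ->
  ip T0 q q <= C * ip T0 q (fun x => ebub x * q x) /\
  forall i, ip T0 (pd i (fun x => ebub x * q x)) (pd i (fun x => ebub x * q x)) <=
    C * ip T0 q (fun x => ebub x * q x).
Proof.
pose f := @mono R n; pose g k : sfield R := fun x => ebub x * f k x.
have cf k : continuous (f k) by exact: mono_cont.
have Cg m k : Ck m (g k) by apply: CkM; [exact: Ck_ebub|exact: Ck_mono].
have cg k : continuous (g k) by exact: (Ck_cont (Cg 0%N k)).
have L u : continuous u -> sqi mu2 T0 u by exact: continuous_sqi_pt.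
have L0 : sqi mu2 T0 (fun=> 0 : R) by apply: L => x; exact: cvg_cst.
have Lf k : sqi mu2 T0 (f k) by exact: L.
have Lg k : sqi mu2 T0 (g k) by exact: L.
have Ld i k : sqi mu2 T0 (pd i (g k)) by apply: L; exact: pd_cont (Cg 1%N k).
pose G k l := dp mu2 T0 (f k) (g l).
have gE c : (fun x => ebub x * \sum_k c k * f k x) = (fun x => \sum_k c k * g k x).
  by apply/funext => x; rewrite mulr_sumr; apply: eq_bigr => k _; rewrite mulrCA.
have GE c : ip T0 (fun x => \sum_k c k * f k x) (fun x => ebub x * \sum_k c k * f k x)
    = qform G c.
  by rewrite gE; exact: (dp_qform (mu := mu2) mT0 c L0 Lf Lg).
have Gpos c : (exists k, c k != 0) -> 0 < qform G c.
  move=> [k ck]; rewrite -GE.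
  have cq : continuous (fun x => \sum_k c k * f k x).
    by have := Ck_comb c (fun k => Ck_mono 0%N k) => /Ck_cont.
  have ce : continuous (fun x => ebub x * \sum_k c k * f k x).
    by rewrite gE; have := Ck_comb c (fun k => Cg 0%N k) => /Ck_cont.
  have pos x : T0 x -> 0 <= (\sum_k c k * f k x) * (ebub x * \sum_k c k * f k x).
    by move=> Tx; rewrite mulrCA mulr_ge0 ?(ltW (ebub_gt0 Tx)) // -expr2 sqr_ge0.
  rewrite lt_def Rintegral_ge0 // andbT; apply/eqP => I0.
  have Z := ip_eq0 oT0 bT0 cq ce pos I0.
  case/eqP: ck; apply: (mono_free (c := c)) => x Tx.
  have /eqP := Z x Tx; rewrite mulrCA mulf_eq0 gt_eqF ?ebub_gt0 //=.
  by rewrite mulf_eq0 orbb => /eqP.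
have [C0 C00 h0] := @qform_bound R _ G (fun k l => dp mu2 T0 (f k) (f l)) Gpos.
have hd i := @qform_bound R _ G (fun k l => dp mu2 T0 (pd i (g k)) (pd i (g l))) Gpos.
have [C1 C10 h1] := hd ord0; have [C2 C20 h2] := hd ord_max.
exists (C0 + C1 + C2); first by rewrite !addr_gt0.
move=> q /polyl_mono[c qE].
have -> : q = (fun x => \sum_k c k * f k x) by exact/funext.
have Gc : 0 <= qform G c.
  rewrite -GE; apply: Rintegral_ge0 => x Tx.
  by rewrite mulrCA mulr_ge0 ?(ltW (ebub_gt0 Tx)) // -expr2 sqr_ge0.
rewrite GE; split.
  have -> : ip T0 (fun x => \sum_k c k * f k x) (fun x => \sum_k c k * f k x) =
     qform (fun k l => dp mu2 T0 (f k) (f l)) c.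
    exact: (dp_qform (mu := mu2) mT0 c L0 Lf Lf).
  by apply: le_trans (h0 c) _; rewrite ler_wpM2r // -addrA lerDl addr_ge0 // ltW.
move=> i; rewrite gE (_ : pd i _ = (fun x => \sum_k c k * pd i (g k) x)); last first.
  by apply/funext => x; apply: pd_comb => k; exact: Cg.
have -> : ip T0 (fun x => \sum_k c k * pd i (g k) x) (fun x => \sum_k c k * pd i (g k) x) =
     qform (fun k l => dp mu2 T0 (pd i (g k)) (pd i (g l))) c.
  exact: (dp_qform (mu := mu2) mT0 c L0 (Ld i) (Ld i)).
have [->|->] := dirE i.
  by apply: le_trans (h1 c) _; rewrite ler_wpM2r // addrAC lerDr addr_ge0 // ltW.
by apply: le_trans (h2 c) _; rewrite ler_wpM2r // lerDr addr_ge0 // ltW.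
Qed.

Definition itv01 : set (measurableTypeR R) := `[0%R, 1%R]%classic.

Lemma continuous_sqi_itv (f : R -> R) : continuous f -> sqi mu itv01 f.
Proof.
move=> cf; split; first by apply: measurable_funTS; exact: continuous_measurable_fun.
have c2 : continuous (fun x => f x ^+ 2).
  by move=> x; apply: (@continuous_comp _ _ _ f (fun y : R => y ^+ 2));
    [exact: cf|exact: exprn_continuous].
exact: (integrable_lty (mu := mu) (measurable_itv _) (continuous_itv_integrable c2)).
Qed.

Lemma dp_itv_eq0 (f g : R -> R) : continuous f -> continuous g ->
  (forall s, 0 < s < 1 -> 0 <= f s * g s) -> f 0 * g 0 = 0 -> f 1 * g 1 = 0 ->
  dp mu itv01 f g = 0 -> forall s, 0 < s < 1 -> f s * g s = 0.
Proof.
move=> cf cg pos f0 f1 I0 s s01.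
have cfg : continuous (fun x => f x * g x) by move=> y; apply: continuousM; [exact: cf|exact: cg].
have ifg := continuous_itv_integrable cfg.
have mI : measurable itv01 by exact: measurable_itv.
have pos' x : itv01 x -> 0 <= f x * g x.
  rewrite /itv01 /= in_itv /= => /andP[]; rewrite le_eqVlt => /predU1P[<- _|x0].
    by rewrite f0.
  rewrite le_eqVlt => /predU1P[->|x1]; first by rewrite f1.
  by apply: pos; rewrite x0.
have E0 : (\int[mu]_(x in itv01) `|(EFin \o (fun x => f x * g x)%R) x| = 0)%E.
  under eq_integral => y /set_mem Dy do rewrite /= ger0_norm ?pos' //.
  rewrite -[LHS]fineK; first by rewrite -[fine _]/(dp mu itv01 f g) I0.
  exact: (integrable_fin_num (mu := mu) mI).
have mfg := measurable_int _ ifg.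
have /(ae_eq_integral_abs mu mI mfg) H := E0.
pose S : set R := `]0%R, 1%R[%classic `&` (fun x => f x * g x) @^-1` [set~ 0].
have oS : open S.
  apply: openI; first exact: interval_open.
  apply: open_comp => [y _|]; first exact: cfg.
  by apply: closed_openC; exact: closed_eq.
apply: contrapT => nz.
have Ss : S s by split => //=; rewrite in_itv /=.
have /nbhs_ballP[e /= e0 eS] : nbhs s S by exact: open_nbhs_nbhs.
move: H => [N [mN N0 sN]].
have BN : ball s e `<=` N.
  move=> y /eS[/=]; rewrite in_itv /= => /andP[y0 y1] nzy; apply: sN => /= h.
  have : itv01 y by rewrite /itv01 /= in_itv /= !ltW.
  by move=> /h [].
have : (mu (ball s e) <= mu N)%E by apply: le_measure; rewrite ?inE //; exact: measurable_ball.
rewrite N0 (lebesgue_measure_ball _ (ltW e0)) => h.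
have : e *+ 2 <= 0 by rewrite -lee_fin.
by rewrite leNgt pmulrn_lgt0 // e0.
Qed.

Definition upoly m (c : 'I_m.+1 -> R) (s : R) : R := \sum_i c i * s ^+ i.
(** Vanishes on the two sides other than the first axis, where it is [s (1 - s)]
    times the polynomial: the extension is constant along the second axis. *)
Definition edge_ext m (c : 'I_m.+1 -> R) : sfield R :=
  fun x => x.1 * (1 - x.1 - x.2) * upoly c x.1.

Lemma upoly_cont m (c : 'I_m.+1 -> R) : continuous (upoly c).
Proof.
apply: continuous_bigsum => i s.
apply: (@continuousM _ _ (fun=> c i) (fun s : R => s ^+ i)); first exact: cst_continuous.
exact: exprn_continuous.
Qed.

(** All the forms are quadratic in the coefficients of the edge polynomial, and
    the weighted one on the right is definite. *)
Lemma edge_reference m : exists2 C : R, 0 < C & forall c : 'I_m.+1 -> R,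
  let W := dp mu itv01 (upoly c) (fun s => s * (1 - s) * upoly c s) in
  [/\ dp mu itv01 (upoly c) (upoly c) <= C * W,
    ip T0 (edge_ext c) (edge_ext c) <= C * W &
    forall i, ip T0 (pd i (edge_ext c)) (pd i (edge_ext c)) <= C * W].
Proof.
pose f (i : 'I_m.+1) (s : R) := s ^+ i; pose g i (s : R) := s * (1 - s) * f i s.
have mI : measurable itv01 by exact: measurable_itv.
have cf i : continuous (f i) by exact: exprn_continuous.
have cw : continuous (fun s : R => s * (1 - s)).
  move=> s; apply: (@continuousM _ _ id (fun s : R => 1 - s)); first exact: cvg_id.
  by apply: cvgB; [exact: cvg_cst|exact: cvg_id].
have cg i : continuous (g i) by move=> s; apply: (@continuousM _ _ (fun s : R => s * (1 - s)) (f i)); [exact: cw|exact: cf].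
have Lf i := continuous_sqi_itv (cf i); have Lg i := continuous_sqi_itv (cg i).
have L0 : sqi mu itv01 (fun=> 0 : R) by apply: continuous_sqi_itv => x; exact: cvg_cst.
pose G k l := dp mu itv01 (f k) (g l).
have gE (c : 'I_m.+1 -> R) : (fun s : R => s * (1 - s) * upoly c s) = (fun s => \sum_k c k * g k s).
  by apply/funext => x; rewrite mulr_sumr; apply: eq_bigr => k _; rewrite mulrCA.
have GE c : dp mu itv01 (upoly c) (fun s => s * (1 - s) * upoly c s) = qform G c.
  by rewrite gE; exact: (dp_qform mI c L0 Lf Lg).
have pos (c : 'I_m.+1 -> R) (s : R) : 0 < s < 1 -> 0 <= upoly c s * (s * (1 - s) * upoly c s).
  move=> /andP[s0 s1]; rewrite mulrCA; apply: mulr_ge0; last by rewrite -expr2 sqr_ge0.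
  by apply: mulr_ge0; rewrite ?subr_ge0; exact: ltW.
have pos' (c : 'I_m.+1 -> R) s : itv01 s -> 0 <= upoly c s * (s * (1 - s) * upoly c s).
  rewrite /itv01 /= in_itv /= => /andP[s0 s1].
  rewrite mulrCA; apply: mulr_ge0; last by rewrite -expr2 sqr_ge0.
  by apply: mulr_ge0; rewrite ?subr_ge0.
have Gpos c : (exists k, c k != 0) -> 0 < qform G c.
  move=> [k ck]; rewrite -GE lt_def Rintegral_ge0 ?andbT; last by move=> s /pos'.
  apply/eqP => I0.
  have ce : continuous (fun s : R => s * (1 - s) * upoly c s).
    by move=> s; apply: (@continuousM _ _ (fun s : R => s * (1 - s)) (upoly c)); [exact: cw|exact: upoly_cont].
  have Z := dp_itv_eq0 (@upoly_cont _ c) ce (pos c) _ _ I0.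
  case/eqP: ck; apply: (coefs_eq0 (c := c) ltr01) => s s01.
  have /eqP : upoly c s * (s * (1 - s) * upoly c s) = 0.
    by apply: Z => //; rewrite ?subrr ?mul0r ?mulr0 ?mul0r ?mulr0.
  have /andP[s0 s1] := s01.
  rewrite mulrCA mulf_eq0 gt_eqF ?mulr_gt0 ?subr_gt0 //=.
  by rewrite mulf_eq0 orbb => /eqP.
pose F (k : 'I_m.+1) : sfield R := fun x => x.1 * (1 - x.1 - x.2) * x.1 ^+ k.
have CF j k : Ck j (F k).
  rewrite (_ : F k = fun x => lin 0 1 0 x * lin 1 (-1) (-1) x * lin 0 1 0 x ^+ k).
    by apply: CkM; [apply: CkM; exact: Ck_lin|apply: CkX; exact: Ck_lin].
  by apply/funext => x; rewrite /F /lin mul0r add0r mul1r addr0; congr (_ * _ * _); ring.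
have FE c : edge_ext c = (fun x => \sum_k c k * F k x).
  apply/funext => x; rewrite /edge_ext mulr_sumr; apply: eq_bigr => k _.
  by rewrite mulrCA.
have L u : continuous u -> sqi mu2 T0 u by exact: continuous_sqi_pt.
have L02 : sqi mu2 T0 (fun=> 0 : R) by apply: L => x; exact: cvg_cst.
have LF k : sqi mu2 T0 (F k) by apply: L; exact: (Ck_cont (CF 0%N k)).
have Ld i k : sqi mu2 T0 (pd i (F k)) by apply: L; exact: pd_cont (CF 1%N k).
have [C0 C00 h0] := @qform_bound R _ G (fun k l => dp mu itv01 (f k) (f l)) Gpos.
have [C3 C30 h3] := @qform_bound R _ G (fun k l => dp mu2 T0 (F k) (F l)) Gpos.
have hd i := @qform_bound R _ G (fun k l => dp mu2 T0 (pd i (F k)) (pd i (F l))) Gpos.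
have [C1 C10 h1] := hd ord0; have [C2 C20 h2] := hd ord_max.
exists (C0 + C1 + C2 + C3); first by rewrite !addr_gt0.
move=> c W; have WE : W = qform G c by exact: GE.
have W0 : 0 <= W by apply: Rintegral_ge0 => s /pos'.
split.
- have -> : dp mu itv01 (upoly c) (upoly c) = qform (fun k l => dp mu itv01 (f k) (f l)) c.
    exact: (dp_qform mI c L0 Lf Lf).
  rewrite WE; apply: le_trans (h0 c) _; rewrite -WE ler_wpM2r // -!addrA lerDl.
  by rewrite !addr_ge0 // ltW.
- rewrite FE; have -> : ip T0 (fun x => \sum_k c k * F k x) (fun x => \sum_k c k * F k x) =
     qform (fun k l => dp mu2 T0 (F k) (F l)) c.
    exact: (dp_qform (mu := mu2) mT0 c L02 LF LF).
  rewrite WE; apply: le_trans (h3 c) _; rewrite -WE ler_wpM2r // lerDr.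
  by rewrite !addr_ge0 // ltW.
- move=> i; rewrite FE (_ : pd i _ = (fun x => \sum_k c k * pd i (F k) x)); last first.
    by apply/funext => x; apply: pd_comb => k; exact: CF.
  have -> : ip T0 (fun x => \sum_k c k * pd i (F k) x) (fun x => \sum_k c k * pd i (F k) x) =
     qform (fun k l => dp mu2 T0 (pd i (F k)) (pd i (F l))) c.
    exact: (dp_qform (mu := mu2) mT0 c L02 (Ld i) (Ld i)).
  have [->|->] := dirE i.
    rewrite WE; apply: le_trans (h1 c) _; rewrite -WE ler_wpM2r //; lra.
  rewrite WE; apply: le_trans (h2 c) _; rewrite -WE ler_wpM2r //; lra.
Qed.

End ReferenceEstimates.

Section Scaling.
Context {R : realType}.
Notation mu := (@lebesgue_measure R).
Notation mu2 := (leb2 R).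
Implicit Types (a b c : pt R).

(** Quantitative nondegeneracy of a triangle of size [h]. *)
Definition shape (K h : R) a b c : Prop :=
  [/\ 0 < h, tdet a b c != 0, h ^+ 2 <= K * `|tdet a b c|,
     `|(b - a).1| <= h /\ `|(b - a).2| <= h &
     `|(c - a).1| <= h /\ `|(c - a).2| <= h].

Section OneShape.
Context (K h : R) a b c (sh : shape K h a b c).
Let D := tdet a b c.

Lemma shape_tdet_le : `|tdet a b c| <= 2 * h ^+ 2.
Proof.
have [h0 _ _ [b1 b2] [c1 c2]] := sh; rewrite /tdet /cross.
apply: (le_trans (ler_normB _ _)); rewrite !normrM.
have : `|(b - a).1| * `|(c - a).2| <= h * h by exact: ler_pM.
have : `|(b - a).2| * `|(c - a).1| <= h * h by exact: ler_pM.
rewrite expr2; lra.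
Qed.

Lemma ip_tri (f g : sfield R) : continuous f -> continuous g ->
  ip (tri a b c) f g = `|D| * ip T0 (f \o tmap a b c) (g \o tmap a b c).
Proof.
move=> cf cg; have [_ D0 _ _ _] := sh.
rewrite /ip (tri_integral D0) //; apply: continuous_integrable_pt.
- exact: tri_measurable.
- exact: tri_bounded.
- by move=> y; apply: continuousM; [exact: cf|exact: cg].
Qed.

Lemma ip_tri_pull (f g : sfield R) : continuous f -> continuous g ->
  ip (tri a b c) (f \o tcoord a b c) (g \o tcoord a b c) = `|D| * ip T0 f g.
Proof.
move=> cf cg; have [_ D0 _ _ _] := sh; rewrite ip_tri.
- by congr (_ * _); apply: eq_ip => x _ /=; rewrite tmapK.
- by move=> x; apply: continuous_comp; [exact: aff_cont|exact: cf].
- by move=> x; apply: continuous_comp; [exact: aff_cont|exact: cg].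
Qed.

(** The derivatives of the barycentric coordinates are of order 1 / h on a
    nondegenerate triangle. *)
Lemma pd_pull_bound (V : sfield R) i : Ck 1 V ->
  ip (tri a b c) (pd i (V \o tcoord a b c)) (pd i (V \o tcoord a b c)) <=
  2 * (K / h) ^+ 2 * `|D| * (ip T0 (pd ord0 V) (pd ord0 V) + ip T0 (pd ord_max V) (pd ord_max V)).
Proof.
move=> CV; have [h0 D0 hK [b1 b2] [c1 c2]] := sh.
have mT := tri_measurable a b c; have bT := tri_bounded D0.
have dp0 : 0 < `|D| by rewrite normr_gt0.
have bound (x : R) : `|x| <= h -> (x / D) ^+ 2 <= (K / h) ^+ 2.
  move=> xh; rewrite -real_normK ?num_real // normrM normfV.
  have l1 : `|x| / `|D| <= K / h.
    rewrite ler_pdivrMr // mulrAC ler_pdivlMr //.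
    by apply: le_trans hK; rewrite expr2 ler_wpM2r // ltW.
  have l0 : 0 <= `|x| / `|D| by exact: divr_ge0.
  by rewrite ler_sqr // nnegrE (le_trans l0).
set g1 := ((c - a).2 / D, - (b - a).2 / D); set g2 := (- (c - a).1 / D, (b - a).1 / D).
have G1 : (cdir g1 g2 i).1 ^+ 2 <= (K / h) ^+ 2.
  by rewrite /cdir; case: ifP => _ /=; apply: bound; rewrite ?normrN.
have G2 : (cdir g1 g2 i).2 ^+ 2 <= (K / h) ^+ 2.
  by rewrite /cdir; case: ifP => _ /=; apply: bound; rewrite ?normrN.
have cp j : continuous (pd j V) by exact: pd_cont.
have cpG j : continuous (pd j V \o tcoord a b c).
  by move=> x; apply: continuous_comp; [exact: aff_cont|exact: cp].
have L j : L2 (tri a b c) (pd j V \o tcoord a b c) by exact: continuous_sqi_pt.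
pose u j k x := k * (pd j V \o tcoord a b c) x.
have Lu j k : L2 (tri a b c) (u j k) by exact: (L2Z mT).
have uu j k : ip (tri a b c) (u j k) (u j k) = k ^+ 2 * (`|D| * ip T0 (pd j V) (pd j V)).
  by rewrite /u (ipZl mT k (L j) (Lu j k)) ipC (ipZl mT k (L j) (L j)) ip_tri_pull // mulrA.
have -> : pd i (V \o tcoord a b c) =
    fun x => u ord0 (cdir g1 g2 i).1 x + u ord_max (cdir g1 g2 i).2 x.
  by apply/funext => x; rewrite /tcoord pd_aff.
apply: le_trans (ip_normD mT (Lu _ _) (Lu _ _)) _; rewrite !uu.
have p0 j : 0 <= `|D| * ip T0 (pd j V) (pd j V) by rewrite mulr_ge0 // ip_ge0.
have := ler_wpM2r (p0 ord0) G1; have := ler_wpM2r (p0 ord_max) G2.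
move: (ip T0 _ _) (ip T0 _ _) => X Y; nra.
Qed.

End OneShape.

(** The weights of [h] in the inverse estimate are those of the scaling to the
    reference triangle. *)
Definition elt_bubble_bound (n : nat) (K C : R) : Prop :=
  forall a b c h, shape K h a b c -> forall q, is_poly n q ->
  exists v, [/\ smooth v,
    forall s : R, [/\ v (a + s *: (b - a)) = 0, v (a + s *: (c - a)) = 0 & v (b + s *: (c - b)) = 0],
    ip (tri a b c) q q <= C * ip (tri a b c) q v,
    ip (tri a b c) v v <= ip (tri a b c) q q &
    forall i, ip (tri a b c) (pd i v) (pd i v) <= C / h ^+ 2 * ip (tri a b c) q q].

Lemma elt_bubble (n : nat) (K : R) : 0 < K -> exists2 C : R, 0 < C & elt_bubble_bound n K C.
Proof.
move=> K0; have [C C0 hC] := @elt_reference R n.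
pose C' := 4 * K ^+ 2 * C + C.
have C'0 : 0 < C' by rewrite addr_gt0 // !mulr_gt0 // exprn_gt0.
exists C' => // a b c h sh q pq; have [h0 D0 hK _ _] := sh.
have mT := tri_measurable a b c; have bT := tri_bounded D0.
set D := tdet a b c in D0 hK.
pose qh : sfield R := q \o tmap a b c; pose vh : sfield R := fun x => ebub x * qh x.
have [h1 h2] := hC qh (polyl_aff _ _ _ (is_poly_polyl pq)).
have Cq k : Ck k q by exact: smooth_poly pq k.
have Cqh k : Ck k qh by apply: Ck_aff; exact: Cq.
have Cvh k : Ck k vh by apply: CkM; [exact: Ck_ebub|exact: Cqh].
have cqh := Ck_cont (Cqh 0%N); have cvh := Ck_cont (Cvh 0%N); have cq := Ck_cont (Cq 0%N).
pose v := vh \o tcoord a b c.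
have Cv k : Ck k v by apply: Ck_aff; exact: Cvh.
have cv := Ck_cont (Cv 0%N).
have Eqv : ip (tri a b c) q v = `|D| * ip T0 qh vh.
  by rewrite (ip_tri sh) //; congr (_ * _); apply: eq_ip => x _ //=; rewrite /v /= tmapK.
have Eqq : ip (tri a b c) q q = `|D| * ip T0 qh qh by rewrite (ip_tri sh).
have Evv : ip (tri a b c) v v = `|D| * ip T0 vh vh by rewrite /v (ip_tri_pull sh).
have dp0 : 0 < `|D| by rewrite normr_gt0.
have Lqh : L2 T0 qh by apply: continuous_sqi_pt => //; [exact: T0_measurable|exact: T0_bounded].
have Lvh : L2 T0 vh by apply: continuous_sqi_pt => //; [exact: T0_measurable|exact: T0_bounded].
have vq : ip T0 vh vh <= ip T0 qh qh.
  apply: (le_ip_ae (@T0_measurable R)) => //; apply: aeW => x Tx.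
  rewrite /vh exprMn ler_piMl ?sqr_ge0 // expr_le1 ?ebub_le1 //.
  by rewrite ltW // ebub_gt0.
have qv : ip T0 qh vh <= ip T0 qh qh.
  apply: (le_Rintegral (mu := mu2) (@T0_measurable R)).
  - exact: (ip_integrable (@T0_measurable R)).
  - exact: (ip_integrable (@T0_measurable R)).
  - move=> x Tx; rewrite /vh mulrCA ler_piMl ?ebub_le1 // -expr2; exact: sqr_ge0.
have p0 := ip_ge0 T0 qh.
have qv0 : 0 <= ip T0 qh vh.
  by have := le_trans p0 h1; rewrite pmulr_rge0.
exists v; split => //.
- have z (x : pt R) : x.1 = 0 \/ x.2 = 0 \/ x.1 + x.2 = 1 -> vh x = 0.
    rewrite /vh /ebub => -[->|[->|E]]; rewrite ?mul0r ?mulr0 ?mul0r //.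
    by rewrite -addrA -opprD E subrr mulr0 mul0r.
  have K1 s : a + s *: (b - a) = tmap a b c (s, 0).
    by rewrite [LHS]surjective_pairing /tmap /aff /lin; congr (_, _); rewrite /= /GRing.scale /=; ring.
  have K2 s : a + s *: (c - a) = tmap a b c (0, s).
    by rewrite [LHS]surjective_pairing /tmap /aff /lin; congr (_, _); rewrite /= /GRing.scale /=; ring.
  have K3 s : b + s *: (c - b) = tmap a b c (1 - s, s).
    by rewrite [LHS]surjective_pairing /tmap /aff /lin; congr (_, _); rewrite /= /GRing.scale /=; ring.
  move=> s; rewrite K1 K2 K3 /v /= !tmapK //; split; apply: z => /=.
  - by right; left.
  - by left.
  - by right; right; rewrite subrK.
- rewrite Eqq Eqv mulrCA ler_wpM2l // (le_trans h1) // ler_wpM2r //.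
  by rewrite /C' lerDr !mulr_ge0 // ?sqr_ge0 // ltW.
- by rewrite Eqq Evv ler_wpM2l.
- move=> i; apply: le_trans (pd_pull_bound sh i (Cvh 1%N)) _.
  rewrite Eqq -/D.
  have H0 := h2 ord0; have H1 := h2 ord_max.
  apply: (@le_trans _ _ (2 * (K / h) ^+ 2 * `|D| * (2 * (C * ip T0 qh qh)))).
    apply: ler_wpM2l; first by do 2! apply: mulr_ge0 => //; exact: sqr_ge0.
    rewrite mulr2n mulrDl mul1r; apply: lerD.
      by apply: le_trans H0 _; rewrite ler_wpM2l // ltW.
    by apply: le_trans H1 _; rewrite ler_wpM2l // ltW.
  have -> : 2 * (K / h) ^+ 2 * `|D| * (2 * (C * ip T0 qh qh)) =
     (4 * K ^+ 2 * C) / h ^+ 2 * (`|D| * ip T0 qh qh).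
    by field; rewrite gt_eqF.
  apply: ler_wpM2r; first exact: mulr_ge0.
  apply: ler_wpM2r; first by rewrite invr_ge0 sqr_ge0.
  by rewrite /C' lerDl ltW.
Qed.

Definition edge_fun (q : sfield R) a b (s : R) : R := q (a + s *: (b - a)).

Lemma edge_fun_poly m q a b c : is_poly m q ->
  exists e : 'I_m.+1 -> R, edge_fun q a b = upoly e.
Proof.
move=> /is_poly_polyl /(polyl_aff a (b - a) (c - a)) /polyl_mono[k hk].
exists (fun i => k (i, ord0)); apply/funext => s.
have := hk (s, 0); rewrite /= => E.
have -> : edge_fun q a b s = \sum_k0 k k0 * mono k0 (s, 0).
  rewrite -E /edge_fun; congr q; rewrite [LHS]surjective_pairing /aff /lin.
  by congr (_, _); rewrite /= /GRing.scale /=; ring.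
rewrite (eq_bigr (fun l => k (l.1, l.2) * (s ^+ l.1 * 0 ^+ l.2))); last by case.
rewrite -(pair_bigA _ (fun i j => k (i, j) * (s ^+ i * 0 ^+ j))) /=.
apply: eq_bigr => i _; rewrite (bigD1 ord0) //= expr0 mulr1 big1 ?addr0 // => j j0.
have /negbTE nj : nat_of_ord j != 0%N by apply: contra_neq j0 => nj; exact/val_inj.
by rewrite expr0n nj !mulr0.
Qed.

(** The integral [W] over the unit interval is not scaled by the length of the
    side, hence the power of [h] in the bound of [v]. *)
Definition edge_bubble_bound (m : nat) (K C : R) : Prop :=
  forall q, is_poly m q -> forall a b,
  let Q := edge_fun q a b in
  let W := dp mu itv01 Q (fun s => s * (1 - s) * Q s) in
  dp mu itv01 Q Q <= C * W /\
  forall c h, shape K h a b c ->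
  exists v, [/\ smooth v,
    forall s : R, [/\ v (a + s *: (b - a)) = s * (1 - s) * Q s,
      v (a + s *: (c - a)) = 0 & v (b + s *: (c - b)) = 0],
    ip (tri a b c) v v <= C * h ^+ 2 * W &
    forall i, ip (tri a b c) (pd i v) (pd i v) <= C * W].

Lemma edge_bubble (m : nat) (K : R) : 0 < K -> exists2 C : R, 0 < C & edge_bubble_bound m K C.
Proof.
move=> K0; have [C C0 hC] := @edge_reference R m.
pose C' := 8 * K ^+ 2 * C + 2 * C.
have C'0 : 0 < C' by rewrite addr_gt0 // !mulr_gt0 // exprn_gt0.
exists C' => // q pq a b Q W.
have W0 : 0 <= W.
  apply: Rintegral_ge0 => s; rewrite /itv01 /= in_itv /= => /andP[s0 s1].
  rewrite mulrCA; apply: mulr_ge0; last by rewrite -expr2 sqr_ge0.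
  by apply: mulr_ge0; rewrite ?subr_ge0.
have CC' : C <= C'.
  have k0 : 0 <= 8 * K ^+ 2 * C.
    by apply: mulr_ge0; [apply: mulr_ge0 => //; exact: sqr_ge0|exact: ltW].
  by rewrite /C'; lra.
split.
  have [e He] := edge_fun_poly a b a pq; have [h1 _ _] := hC e.
  by rewrite /W /Q He in W0 *; apply: le_trans h1 _; rewrite ler_wpM2r.
move=> c h sh; have [h0 D0 hK _ _] := sh.
set D := tdet a b c in D0 hK.
have [e He] := edge_fun_poly a b c pq.
have [_ h2 h3] := hC e; rewrite -He -/W in h2 h3.
pose vh := edge_ext e.
have Cvh k : Ck k vh.
  rewrite (_ : vh = fun x => lin 0 1 0 x * lin 1 (-1) (-1) x * \sum_i e i * (lin 0 1 0 x) ^+ i).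
    apply: CkM; first by apply: CkM; exact: Ck_lin.
    by apply: Ck_sum => i _; apply: CkZ; apply: CkX; exact: Ck_lin.
  apply/funext => x; rewrite /vh /edge_ext /upoly /lin mul0r add0r mul1r addr0.
  by congr (_ * _ * _); ring.
have cvh := Ck_cont (Cvh 0%N).
pose v := vh \o tcoord a b c.
have Cv k : Ck k v by apply: Ck_aff; exact: Cvh.
have dp0 : 0 < `|D| by rewrite normr_gt0.
have Dh : `|D| <= 2 * h ^+ 2 := shape_tdet_le sh.
exists v; split => //.
- have K1 s : a + s *: (b - a) = tmap a b c (s, 0).
    by rewrite [LHS]surjective_pairing /tmap /aff /lin; congr (_, _); rewrite /= /GRing.scale /=; ring.
  have K2 s : a + s *: (c - a) = tmap a b c (0, s).
    by rewrite [LHS]surjective_pairing /tmap /aff /lin; congr (_, _); rewrite /= /GRing.scale /=; ring.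
  have K3 s : b + s *: (c - b) = tmap a b c (1 - s, s).
    by rewrite [LHS]surjective_pairing /tmap /aff /lin; congr (_, _); rewrite /= /GRing.scale /=; ring.
  move=> s; rewrite K1 K2 K3 /v /= !tmapK //; split; rewrite /vh /edge_ext /=.
  - by rewrite subr0 /Q He.
  - by rewrite !mul0r.
  - have -> : 1 - (1 - s) - s = 0 by ring.
    by rewrite mulr0 mul0r.
- have -> : ip (tri a b c) v v = `|D| * ip T0 vh vh by rewrite /v (ip_tri_pull sh).
  apply: (@le_trans _ _ (2 * h ^+ 2 * (C * W))).
    by apply: ler_pM => //; rewrite ?normr_ge0 // ip_ge0.
  rewrite (_ : 2 * h ^+ 2 * (C * W) = 2 * C * h ^+ 2 * W); last by ring.
  rewrite ler_wpM2r // ler_wpM2r ?sqr_ge0 // /C' lerDr.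
  by rewrite !mulr_ge0 ?sqr_ge0 // ltW.
- move=> i; apply: le_trans (pd_pull_bound sh i (Cvh 1%N)) _; rewrite -/D.
  apply: (@le_trans _ _ (2 * (K / h) ^+ 2 * (2 * h ^+ 2) * (2 * (C * W)))).
    apply: ler_pM.
    + by do 2! apply: mulr_ge0 => //; exact: sqr_ge0.
    + by rewrite addr_ge0 // ip_ge0.
    + by rewrite ler_wpM2l // mulr_ge0 // sqr_ge0.
    + by rewrite mulr2n mulrDl mul1r; apply: lerD; exact: h3.
  have -> : 2 * (K / h) ^+ 2 * (2 * h ^+ 2) * (2 * (C * W)) = 8 * K ^+ 2 * C * W.
    by field; rewrite gt_eqF.
  by rewrite ler_wpM2r // /C' lerDl mulr_ge0 // ltW.
Qed.

End Scaling.

(** * Geometry of a triangulation *)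

Section Hulls.
Context {R : realType} (nv : nat) (X : 'I_nv -> pt R).
Notation mu2 := (leb2 R).
Implicit Types (i j k : 'I_nv) (s t e : {set 'I_nv}) (x : pt R).

Lemma sum_pt1 (I : finType) (F : I -> pt R) : (\sum_i F i).1 = \sum_i (F i).1.
Proof. by apply: (big_morph fst). Qed.
Lemma sum_pt2 (I : finType) (F : I -> pt R) : (\sum_i F i).2 = \sum_i (F i).2.
Proof. by apply: (big_morph snd). Qed.

(** Affine identities pass to convex combinations. *)
Lemma hull_affine s (p q r : R) x :
  (forall i, i \in s -> p * (X i).1 + q * (X i).2 = r) -> hull X s x ->
  p * x.1 + q * x.2 = r.
Proof.
move=> h [w [w0 ws w1 ->]]; rewrite sum_pt1 sum_pt2 !mulr_sumr -big_split /=.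
rewrite -[RHS]mulr1 -w1 mulr_sumr; apply: eq_bigr => i _.
have [si|nsi] := boolP (i \in s); last by rewrite ws // !scale0r /= !mulr0 addr0.
by rewrite -(h i si) /GRing.scale /=; ring.
Qed.

(** Moving off the line along its normal [(p, q)] leaves the hull. *)
Lemma hull_flat_interior s (p q r : R) : (p != 0) || (q != 0) ->
  (forall i, i \in s -> p * (X i).1 + q * (X i).2 = r) -> elt X s = set0.
Proof.
move=> pq h; apply/seteqP; split => // x /nbhs_ballP[e /= e0 eS].
pose n := 1 + `|p| + `|q|.
have n0 : 0 < n by rewrite /n -addrA ltr_wpDr // addr_ge0.
pose d := e / 2 / n.
have d0 : 0 < d by rewrite /d !divr_gt0.
have bd (z y : R) : `|z| <= n -> `|y - (y + d * z)| < e.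
  move=> zn; rewrite opprD addrA subrr add0r normrN normrM (gtr0_norm d0).
  apply: (@le_lt_trans _ _ (d * n)); first by rewrite ler_wpM2l // ltW.
  by rewrite /d divfK ?gt_eqF //; lra.
have xh := hull_affine h (eS x (ballxx x e0)).
have B : ball x e (x.1 + d * p, x.2 + d * q).
  split; rewrite /ball /=; apply: bd; rewrite /n; have := normr_ge0 p; have := normr_ge0 q; lra.
have := hull_affine h (eS _ B); rewrite /= -[RHS]xh => E.
have : d * (p ^+ 2 + q ^+ 2) = 0 by rewrite !expr2; lra.
move/eqP; rewrite mulf_eq0 gt_eqF //= paddr_eq0 ?sqr_ge0 // !sqrf_eq0.
by case/orP: pq => /negbTE ->; rewrite ?andbF.
Qed.

Lemma flat_pair (a b : pt R) : exists p q : R, ((p != 0) || (q != 0)) /\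
  p * a.1 + q * a.2 = p * b.1 + q * b.2.
Proof.
have [ab|ab] := eqVneq a.2 b.2.
  by exists 0, 1; rewrite oner_neq0 orbT ab !mul0r.
exists (a.2 - b.2), (b.1 - a.1); split; first by rewrite subr_eq0 ab.
by ring.
Qed.

Lemma small_hull_interior s : (#|s| <= 2)%N -> elt X s = set0.
Proof.
move=> s2; have [s0|[i si]] := set_0Vmem s.
  by apply: (@hull_flat_interior s 1 0 0); rewrite ?oner_neq0 // => i; rewrite s0 inE.
have [|[j]] := set_0Vmem (s :\ i).
  move=> h; have sE k : k \in s -> k = i.
    move=> ks; apply/eqP; apply: contraT => ki.
    have : k \in s :\ i by rewrite !inE ki ks.
    by rewrite h inE.
  apply: (@hull_flat_interior s 1 0 (X i).1); rewrite ?oner_neq0 // => k /sE ->.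
  by rewrite mul1r mul0r addr0.
rewrite !inE => /andP[ji sj].
have sE k : k \in s -> k = i \/ k = j.
  move=> ks; have [->|ki] := eqVneq k i; first by left.
  have [->|kj] := eqVneq k j; first by right.
  exfalso; move: s2; rewrite (cardsD1 i) si (cardsD1 j) !inE ji sj (cardsD1 k) !inE ki kj ks.
  by [].
have [p [q [pq E]]] := flat_pair (X i) (X j).
by apply: (hull_flat_interior pq (r := p * (X i).1 + q * (X i).2)) => k /sE[] ->.
Qed.

Section ThreeVertices.
Context (i j k : 'I_nv) (ij : i != j) (ik : i != k) (jk : j != k).
Let t : {set 'I_nv} := [set i; j; k]%SET.
Let a := X i.
Let b := X j.
Let c := X k.

Lemma sum_three_vertices (V : nmodType) (F : 'I_nv -> V) :
  (forall l, l \notin t -> F l = 0) -> \sum_l F l = F i + F j + F k.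
Proof.
move=> h; rewrite (bigD1 i) //= (bigD1 j) /=; last by rewrite eq_sym.
rewrite (bigD1 k) /=; last by rewrite eq_sym ik eq_sym jk.
rewrite big1 ?addr0 ?addrA // => l /andP[/andP[l1 l2] l3].
by apply: h; rewrite /t !inE (negbTE l1) (negbTE l2) (negbTE l3).
Qed.

Lemma hull3P x : hull X t x <->
  exists u v w : R, [/\ 0 <= u, 0 <= v, 0 <= w, u + v + w = 1 & x = u *: a + v *: b + w *: c].
Proof.
split.
  move=> [w [w0 wt w1 ->]]; exists (w i), (w j), (w k); split => //.
    by rewrite -w1 sum_three_vertices.
  by rewrite sum_three_vertices // => l lt; rewrite wt // scale0r.
move=> [u [v [w [u0 v0 w0 uvw ->]]]].
pose W l := if l == i then u else if l == j then v else if l == k then w else 0.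
have Wi : W i = u by rewrite /W eqxx.
have Wj : W j = v by rewrite /W eq_sym (negbTE ij) eqxx.
have Wk : W k = w by rewrite /W eq_sym (negbTE ik) eq_sym (negbTE jk) eqxx.
have Wt l : l \notin t -> W l = 0.
  by rewrite /t !inE !negb_or /W => /andP[/andP[/negbTE -> /negbTE ->] /negbTE ->].
exists W; split => //.
- by move=> l; rewrite /W; do 3 (case: ifP => // _).
- by rewrite sum_three_vertices // Wi Wj Wk.
- by rewrite sum_three_vertices ?Wi ?Wj ?Wk // => l /Wt ->; rewrite scale0r.
Qed.

(** If the determinant vanishes, the three vertices lie on one line. *)
Lemma tdet_neq0 : elt X t !=set0 -> tdet a b c != 0.
Proof.
move=> [x tx]; apply/eqP => D0.
suff [p [q [r [pq h]]]] : exists p q r : R, ((p != 0) || (q != 0)) /\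
    (forall l, l \in t -> p * (X l).1 + q * (X l).2 = r).
  by have := hull_flat_interior pq h; move: tx => /[swap] ->.
have tE l : l \in t -> [\/ l = i, l = j | l = k].
  by rewrite /t !inE -orbA => /or3P[] /eqP ->; [constructor 1|constructor 2|constructor 3].
have [ba|nba] := boolP ((b.1 - a.1 != 0) || (b.2 - a.2 != 0)).
  exists (- (b.2 - a.2)), (b.1 - a.1), (- (b.2 - a.2) * a.1 + (b.1 - a.1) * a.2).
  split; first by rewrite oppr_eq0 orbC.
  move: D0; rewrite /tdet /cross /= => D0.
  by move=> l /tE[] ->; rewrite -/a -/b -/c; lra.
move: nba; rewrite negb_or !negbK !subr_eq0 => /andP[/eqP b1 /eqP b2].
have [p [q [pq E]]] := flat_pair a c.
exists p, q, (p * a.1 + q * a.2); split => // l /tE[] -> //; rewrite -/a -/b -/c.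
by rewrite b1 b2.
Qed.

Context (D0 : tdet a b c != 0).

Definition T0_closure : set (pt R) := [set s | [/\ 0 <= s.1, 0 <= s.2 & s.1 + s.2 <= 1]].

(** The weights of the last two vertices are the affine coordinates. *)
Lemma hull3_coord x : hull X t x <-> T0_closure (tcoord a b c x).
Proof.
rewrite hull3P; split.
  move=> [u [v [w [u0 v0 w0 uvw ->]]]].
  have -> : u *: a + v *: b + w *: c = tmap a b c (v, w).
    have -> : u = 1 - v - w by rewrite -uvw; ring.
    rewrite [LHS]surjective_pairing /tmap /aff /lin; congr (_, _);
      rewrite /= /GRing.scale /=; ring.
  by rewrite tmapK // /T0_closure; split => //=; lra.
case: (tcoord a b c x) (tcoordK D0 x) => v w <- [/= v0 w0 vw].
exists (1 - v - w), v, w; split => //; [lra|ring|].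
by rewrite [LHS]surjective_pairing [RHS]surjective_pairing /tmap /aff /lin; congr (_, _);
  rewrite /= /GRing.scale /=; ring.
Qed.

Lemma T0_closure_closed : closed T0_closure.
Proof.
rewrite (_ : T0_closure = (lin 0 1 0 @^-1` `[0, +oo[) `&` (lin 0 0 1 @^-1` `[0, +oo[) `&`
   (lin 0 1 1 @^-1` `]-oo, 1])); last first.
  apply/seteqP; split => -[x y]; rewrite /T0_closure /lin /= !in_itv /= ?andbT.
    by case => ? ? ?; split; [split|]; lra.
  by case => -[? ?] ?; split; lra.
apply: closedI; first apply: closedI.
- by apply: closed_comp => [x _|]; [exact: lin_cont|exact: interval_closed].
- by apply: closed_comp => [x _|]; [exact: lin_cont|exact: interval_closed].
- by apply: closed_comp => [x _|]; [exact: lin_cont|exact: interval_closed].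
Qed.

Lemma hull3E : hull X t = tcoord a b c @^-1` T0_closure.
Proof. by apply/seteqP; split => x /hull3_coord. Qed.

Lemma hull3_closed : closed (hull X t).
Proof.
rewrite hull3E; apply: closed_comp => [x _|]; [exact: aff_cont|exact: T0_closure_closed].
Qed.

(** An interior point of the hull can be moved a little in both coordinate
    directions, so its barycentric coordinates are positive. *)
Lemma elt3E : elt X t = tri a b c.
Proof.
apply/seteqP; split; last first.
  move=> x Tx; have : nbhs x (tri a b c).
    by apply: open_nbhs_nbhs; split => //; exact: tri_open.
  apply: filterS => y [h1 h2 h3]; apply/hull3_coord; split; exact: ltW.
move=> x /nbhs_ballP[e /= e0 eS].
have cN : \forall y \near tcoord a b c x, ball x e (tmap a b c y).
  have Cx : tmap a b c y @[y --> tcoord a b c x] --> x.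
    by rewrite -[X in _ --> X](tcoordK D0); exact: aff_cont.
  by apply: Cx; exact: nbhsx_ballx.
have /nbhs_ballP[r /= r0 rS] := cN.
set s := tcoord a b c x in rS cN *.
have key (y : pt R) : ball s r y -> T0_closure y.
  by move=> /rS /eS /hull3_coord; rewrite tmapK.
have r2 : 0 < r / 2 by rewrite divr_gt0.
have bb (z w : R) : `|z - w| < r / 2 + r / 4 -> `|z - w| < r by move/lt_trans; apply; lra.
have nn (z d : R) : `|d| <= r / 2 -> `|z - (z - d)| < r.
  by move=> dr; rewrite opprB addrC subrK (le_lt_trans dr) //; lra.
have rr : `|r / 2| <= r / 2 by rewrite gtr0_norm.
have k1 : T0_closure (s.1 - r / 2, s.2) by apply: key; split; rewrite /ball /= ?subrr ?normr0 // nn.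
have k2 : T0_closure (s.1, s.2 - r / 2) by apply: key; split; rewrite /ball /= ?subrr ?normr0 // nn.
have k3 : T0_closure (s.1 - - (r / 2), s.2).
  by apply: key; split; rewrite /ball /= ?subrr ?normr0 // nn // normrN.
rewrite /tri /= -/s; move: k1 k2 k3 r2; rewrite /T0_closure /T0 /=; move: (r / 2) => q.
move: s.1 s.2 => z w [h1 h2 h3] [h4 h5 h6] [h7 h8 h9] q0.
split; lra.
Qed.

(** The reference triangle lies in the unit square. *)
Lemma hull3_measure : (mu2 (hull X t) <= `|tdet a b c|%:E)%E.
Proof.
have [mF hF] := tmap_scales D0.
have mh : measurable (hull X t) by apply: closed_measurable_pt; exact: hull3_closed.
have := hF _ mh.
rewrite (_ : tmap a b c @^-1` hull X t = T0_closure); last first.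
  by apply/seteqP; split => s; rewrite hull3E /= tmapK.
have T1 : (mu2 T0_closure <= 1)%E.
  apply: (@le_trans _ _ (mu2 ([set` `[0%R, 1%R]] `*` [set` `[0%R, 1%R]]))).
    apply: le_measure; rewrite ?inE.
    - by apply: closed_measurable_pt; exact: T0_closure_closed.
    - by apply: measurableX; exact: measurable_itv.
    - by move=> -[x y] [/= ? ? ?]; split; rewrite /= in_itv /=; apply/andP; split; lra.
  by rewrite leb2_box !lebesgue_measure_itv /= lte_fin ltr01 sube0 mule1.
move=> E; have D0' : 0 < `|tdet a b c| by rewrite normr_gt0.
have -> : mu2 (hull X t) = (`|tdet a b c|%:E * mu2 T0_closure)%E.
  by rewrite E muleA -EFinM mulfV ?mul1e // gt_eqF.
by rewrite -[leRHS]mule1 lee_wpmul2l // lee_fin ltW.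
Qed.

End ThreeVertices.
End Hulls.

Section EdgesOfTriangles.
Context {R : realType} (nv : nat) (X : 'I_nv -> pt R).
Notation mu2 := (leb2 R).
Implicit Types (i j k : 'I_nv) (t e : {set 'I_nv}) (x : pt R).

Lemma enum_pair i j : (i < j)%N -> enum [set i; j]%SET = [:: i; j].
Proof.
move=> ij; apply: (@irr_sorted_eq _ (fun x y : 'I_nv => (x < y)%N)).
- by move=> x y z; exact: ltn_trans.
- by move=> x; rewrite ltnn.
- have : sorted (fun x y : 'I_nv => (x < y)%N) (enum 'I_nv).
    by have := iota_ltn_sorted 0 nv; rewrite -val_enum_ord sorted_map.
  rewrite enumT /enum_mem; apply: sorted_filter => x y z; exact: ltn_trans.
- by rewrite /= ij.
- by move=> x; rewrite mem_enum !inE.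
Qed.

Lemma ept0 i j : (i < j)%N -> ept X [set i; j]%SET 0 = X i.
Proof. by move=> ij; rewrite /ept enum_pair. Qed.
Lemma ept1 i j : (i < j)%N -> ept X [set i; j]%SET 1 = X j.
Proof. by move=> ij; rewrite /ept enum_pair. Qed.

Lemma in_edges1 t e : (e \in edges [set t]%SET) = (#|e| == 2) && (e \subset t).
Proof.
rewrite inE; congr (_ && _); apply/existsP/idP.
  by move=> [t' /andP[]]; rewrite inE => /eqP ->.
by move=> et; exists t; rewrite !inE eqxx.
Qed.

Lemma edge_vertices t e : #|t| = 3 -> e \in edges [set t]%SET ->
  exists i j k, [/\ (i < j)%N, k != i, k != j, e = [set i; j]%SET & t = [set i; j; k]%SET].
Proof.
move=> t3; rewrite in_edges1 => /andP[/cards2P[i' [j' [ij' ->]]] et].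
have [i [j [ij ->{i' j' ij'} {}et]]] : exists i j, [/\ (i < j)%N, [set i'; j']%SET = [set i; j]%SET &
    [set i; j]%SET \subset t].
  have [h|h|h] := ltngtP i' j'; first by exists i', j'.
    by exists j', i'; rewrite finset.setUC [in X in X \subset t]finset.setUC.
  by move: ij'; rewrite (val_inj h) eqxx.
have nij : i != j by rewrite -val_eqE neq_ltn ij.
have := cardsD t [set i; j]%SET; rewrite (finset.setIidPr et) cards2 nij t3.
move/eqP/cards1P => [k tk].
have : k \in t :\: [set i; j]%SET by rewrite tk inE.
rewrite !inE negb_or => /andP[/andP[ki kj] kt].
exists i, j, k; split => //.
by rewrite -tk finset.setDE finset.setUIr finset.setUCr finset.setIT; apply/esym/finset.setUidPr.
Qed.

Lemma other_edge i j k e : i != j -> k != i -> k != j ->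
  e \in edges [set [set i; j; k]%SET]%SET -> e != [set i; j]%SET ->
  e = [set i; k]%SET \/ e = [set j; k]%SET.
Proof.
move=> ij ki kj; rewrite in_edges1 => /andP[/cards2P[x [y [xy ->]]] /fintype.subsetP sub] ne.
have := sub x; have := sub y; rewrite !inE !eqxx ?orbT => /(_ isT) hy /(_ isT) hx.
move: hx hy => /orP[/orP[] /eqP E|/eqP E] /orP[/orP[] /eqP E'|/eqP E'];
  move: xy ne; rewrite {}E {}E' ?eqxx // => _; try (by left); try (by right);
  rewrite finset.setUC ?eqxx //; by [left|right].
Qed.

(** Along the remaining edges, the parametrization runs on the lines through
    the third vertex. *)
Lemma eparam_other i j k e s : i != j -> k != i -> k != j ->
  e \in edges [set [set i; j; k]%SET]%SET -> e != [set i; j]%SET ->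
  (exists s', eparam X e s = X i + s' *: (X k - X i)) \/
  (exists s', eparam X e s = X j + s' *: (X k - X j)).
Proof.
move=> ij ki kj he ne.
have par u v : u != v -> exists s', eparam X [set u; v]%SET s = X u + s' *: (X v - X u).
  move=> uv; have [h|h|h] := ltngtP u v.
  - by exists s; rewrite /eparam ept0 // ept1.
  - exists (1 - s); rewrite /eparam finset.setUC ept0 // ept1 //.
    by rewrite [LHS]surjective_pairing [RHS]surjective_pairing; congr (_, _);
      rewrite /= /GRing.scale /=; ring.
  - by move: uv; rewrite (val_inj h) eqxx.
by have [->|->] := other_edge ij ki kj he ne; [left|right]; apply: par; rewrite eq_sym.
Qed.

Lemma orientE i j k : (i < j)%N -> k != i -> k != j ->
  orient X [set i; j; k]%SET [set i; j]%SET = Num.sg (tdet (X i) (X j) (X k)).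
Proof.
move=> ij ki kj; rewrite /orient ept0 // ept1 //.
have -> : ept X ([set i; j; k] :\: [set i; j])%SET 0 = X k.
  have -> : ([set i; j; k] :\: [set i; j])%SET = [set k]%SET.
    apply/setP => x; rewrite !inE; have [->|xk] := eqVneq x k.
      by rewrite (negbTE ki) (negbTE kj) orbT.
    by rewrite orbF; case: (_ || _).
  by rewrite /ept enum_set1.
by [].
Qed.

End EdgesOfTriangles.

Section SizeBounds.
Context {R : realType} (nv : nat) (X : 'I_nv -> pt R).
Notation mu2 := (leb2 R).
Implicit Types (i j k : 'I_nv) (t e : {set 'I_nv}) (x y : pt R).

Lemma eucl_distE x y : eucl_dist x y = Num.sqrt ((x.1 - y.1) ^+ 2 + (x.2 - y.2) ^+ 2).
Proof. by rewrite /eucl_dist dotvE /vec !mxE /= -!expr2. Qed.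

Lemma coord1_le_dist x y : `|x.1 - y.1| <= eucl_dist x y.
Proof. by rewrite eucl_distE -sqrtr_sqr ler_wsqrtr // lerDl sqr_ge0. Qed.
Lemma coord2_le_dist x y : `|x.2 - y.2| <= eucl_dist x y.
Proof. by rewrite eucl_distE -sqrtr_sqr ler_wsqrtr // lerDr sqr_ge0. Qed.

Lemma dist_le_coord x y : eucl_dist x y <= `|x.1 - y.1| + `|x.2 - y.2|.
Proof.
rewrite eucl_distE -[leRHS]ger0_norm ?addr_ge0 // -sqrtr_sqr ler_wsqrtr //.
rewrite -[in leLHS](real_normK (num_real (x.1 - y.1))).
rewrite -[in leLHS](real_normK (num_real (x.2 - y.2))) [leRHS]sqrrD.
by rewrite addrAC lerDl mulrn_wge0 // mulr_ge0.
Qed.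

Lemma eucl_dist_ge0 x y : 0 <= eucl_dist x y.
Proof. by rewrite eucl_distE sqrtr_ge0. Qed.

Lemma vertex_in_hull t i : i \in t -> hull X t (X i).
Proof.
move=> it; exists (fun j => (j == i)%:R); split => //.
- by move=> j jt; case: eqP => // ji; move: jt; rewrite ji it.
- by rewrite (bigD1 i) //= eqxx big1 ?addr0 // => j /negbTE ->.
- rewrite (bigD1 i) //= eqxx scale1r big1 ?addr0 // => j /negbTE ->.
  exact: scale0r.
Qed.

Lemma hull_bounded t : exists M : R, forall x, hull X t x -> `|x.1| <= M /\ `|x.2| <= M.
Proof.
exists (\sum_i (`|(X i).1| + `|(X i).2|)) => x [w [w0 wt w1 ->]].
have wle i : w i <= 1.
  by rewrite -w1 (bigD1 i) //= lerDl sumr_ge0.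
rewrite sum_pt1 sum_pt2; split; apply: (le_trans (ler_norm_sum _ _ _)); apply: ler_sum => i _.
  rewrite /GRing.scale /= normrM (ger0_norm (w0 i)).
  by apply: (@le_trans _ _ `|(X i).1|); [rewrite ler_piMl|rewrite lerDl].
rewrite /GRing.scale /= normrM (ger0_norm (w0 i)).
by apply: (@le_trans _ _ `|(X i).2|); [rewrite ler_piMl|rewrite lerDr].
Qed.

(** Vertices bound the hull, so the supremum that defines the diameter is finite. *)
Lemma dist_le_hsize t x y : hull X t x -> hull X t y -> eucl_dist x y <= hsize X t.
Proof.
move=> hx hy; apply: ub_le_sup; last by exists x, y.
have [M hM] := hull_bounded t.
exists (4 * M) => _ [x' [y' [/hM[a1 a2] /hM[b1 b2] ->]]].
apply: le_trans (dist_le_coord _ _) _.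
have := ler_normB x'.1 y'.1; have := ler_normB x'.2 y'.2; lra.
Qed.

Lemma hsize_ge0 t : 0 <= hsize X t.
Proof.
rewrite /hsize /ediam; have [[x hx]|h] := pselect (hull X t !=set0).
  by apply: le_trans (dist_le_hsize hx hx); exact: eucl_dist_ge0.
rewrite (_ : [set r | _] = set0) ?sup0 //.
by apply/seteqP; split => // r [x [y [hx _ _]]]; apply: h; exists x.
Qed.

(** On the edge, distances are differences of parameters times its length. *)
Lemma hsize_edge i j : (i < j)%N -> hsize X [set i; j]%SET <= eucl_dist (X j) (X i).
Proof.
move=> ij; have nij : i != j by rewrite -val_eqE neq_ltn ij.
have hi : hull X [set i; j]%SET (X i) by apply: vertex_in_hull; rewrite !inE eqxx.
apply: ge_sup; first by exists (eucl_dist (X i) (X i)), (X i), (X i).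
move=> _ [x [y [hx hy ->]]].
have E z : hull X [set i; j]%SET z -> exists2 s : R, 0 <= s <= 1 & z = X i + s *: (X j - X i).
  move=> [w [w0 wt w1 ->]].
  have S (V : nmodType) (F : 'I_nv -> V) : (forall l, l \notin [set i; j]%SET -> F l = 0) ->
      \sum_l F l = F i + F j.
    move=> hF; rewrite (bigD1 i) //= (bigD1 j) /=; last by rewrite eq_sym.
    rewrite big1 ?addr0 // => l /andP[l1 l2].
    by apply: hF; rewrite !inE (negbTE l1) (negbTE l2).
  have w1' : w i + w j = 1 by rewrite -S.
  have wi : w i = 1 - w j by rewrite -w1'; ring.
  have := w0 i; have := w0 j => wj0 wi0.
  exists (w j); first by rewrite wj0 /=; lra.
  rewrite S; last by move=> l /wt ->; exact: scale0r.
  by rewrite wi [LHS]surjective_pairing [RHS]surjective_pairing; congr (_, _);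
    rewrite /= /GRing.scale /=; ring.
have [s /andP[s0 s1] ->] := E x hx; have [s' /andP[s0' s1'] ->] := E y hy.
rewrite !eucl_distE ler_wsqrtr //= /GRing.scale /=.
set p := (X j).1 - (X i).1; set q := (X j).2 - (X i).2.
have -> : (X i).1 + s * p - ((X i).1 + s' * p) = (s - s') * p by ring.
have -> : (X i).2 + s * q - ((X i).2 + s' * q) = (s - s') * q by ring.
rewrite !exprMn -mulrDr ler_piMl ?addr_ge0 ?sqr_ge0 //.
by rewrite -real_normK ?num_real // expr_le1 // ler_norml; lra.
Qed.

End SizeBounds.

(** The vertices of [t], listed so that [i] and [j] are the endpoints of the
    edge [e] in the order that fixes its tangent. *)
Definition at_edge (nv : nat) (t e : {set 'I_nv}) (i j k : 'I_nv) : Prop :=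
  [/\ (i < j)%N, k != i, k != j, e = [set i; j]%SET & t = [set i; j; k]%SET].

Section MeshGeometry.
Context {R : realType} (Om : set (pt R)) (nv : nat) (X : 'I_nv -> pt R).
Context (T : {set {set 'I_nv}}) (c1 : R).
Notation mu2 := (leb2 R).
Implicit Types (i j k : 'I_nv) (t e : {set 'I_nv}) (x : pt R).
Context (pOm : polygonal_domain Om) (tr : triangulation Om X T).
Context (sr : shape_regular c1 X T) (c10 : 0 < c1).

Lemma Om_open : open Om. Proof. by case: pOm => -[]. Qed.
Lemma Om_bounded : bounded_set Om. Proof. by case: pOm => -[]. Qed.
Lemma Om_measurable : measurable Om.
Proof. by apply: open_measurable_pt; exact: Om_open. Qed.

Lemma card_elt t : t \in T -> #|t| = 3.
Proof. by case: tr => h _ _ /h[]. Qed.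

Lemma elt_nonempty t : t \in T -> elt X t !=set0.
Proof. by case: tr => h _ _ /h[]. Qed.

(** This is where the domain must lie on one side of its boundary. *)
Lemma elt_sub t : t \in T -> elt X t `<=` Om.
Proof.
move=> tT; have [_ cl _] := tr; have [[_ _ _ _ <-] _] := pOm.
by apply: interiorS; rewrite cl => x hx; exists t.
Qed.

Lemma elt_open t : open (elt X t). Proof. exact: open_interior. Qed.
Lemma elt_measurable t : measurable (elt X t).
Proof. by apply: open_measurable_pt; exact: elt_open. Qed.
Lemma elt_bounded t : t \in T -> bounded_set (elt X t).
Proof. move=> tT; have [M [Mr hM]] := Om_bounded; exists M; split => // M' MM' x /(elt_sub tT).
exact: hM. Qed.

(** The triangles meet in the hull of at most two vertices, which is flat. *)
Lemma elt_disjoint t t' : t \in T -> t' \in T -> t != t' -> elt X t `&` elt X t' = set0.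
Proof.
move=> tT t'T tt'; have [_ _ cap] := tr.
rewrite /elt -interiorI cap //; apply: small_hull_interior.
suff h : (#|t :&: t'| < #|t|)%N by rewrite (card_elt tT) ltnS in h.
rewrite proper_card // properE finset.subsetIl /=.
apply: contraNN tt' => /fintype.subsetP h; rewrite eqEcard (card_elt tT) (card_elt t'T) leqnn andbT.
by apply/fintype.subsetP => x /h; rewrite inE => /andP[].
Qed.

Lemma at_edge_neq t e i j k : at_edge t e i j k -> [/\ i != j, i != k & j != k].
Proof.
by case=> ij ki kj _ _; split; [rewrite -val_eqE neq_ltn ij|rewrite eq_sym|rewrite eq_sym].
Qed.

Lemma at_edge_elt t e i j k : t \in T -> at_edge t e i j k ->
  tdet (X i) (X j) (X k) != 0 /\ elt X t = tri (X i) (X j) (X k).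
Proof.
move=> tT te; have [ij ik jk] := at_edge_neq te; have [_ _ _ _ tE] := te.
have D0 : tdet (X i) (X j) (X k) != 0.
  by apply: tdet_neq0 => //; rewrite -tE; exact: elt_nonempty.
by split => //; rewrite tE; apply: elt3E.
Qed.

Lemma edgeP t e : t \in T -> e \in edges [set t]%SET -> exists i j k, at_edge t e i j k.
Proof. by move=> tT; apply: edge_vertices; exact: card_elt. Qed.

(** Shape regularity bounds the determinant from below, since it dominates the
    area; the sides are bounded by the diameter. *)
Lemma at_edge_shape t e i j k : t \in T -> at_edge t e i j k ->
  shape c1 (hsize X t) (X i) (X j) (X k).
Proof.
move=> tT te; have [D0 eE] := at_edge_elt tT te; have [ij ik jk] := at_edge_neq te.
have [_ _ _ _ tE] := te.
have hX l : l \in t -> hull X t (X l) by exact: vertex_in_hull.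
have [ti tj tk] : [/\ i \in t, j \in t & k \in t] by rewrite tE !inE !eqxx ?orbT.
have B1 : `|(X j - X i).1| <= hsize X t.
  exact: le_trans (coord1_le_dist _ _) (dist_le_hsize (hX _ tj) (hX _ ti)).
have B2 : `|(X j - X i).2| <= hsize X t.
  exact: le_trans (coord2_le_dist _ _) (dist_le_hsize (hX _ tj) (hX _ ti)).
have B3 : `|(X k - X i).1| <= hsize X t.
  exact: le_trans (coord1_le_dist _ _) (dist_le_hsize (hX _ tk) (hX _ ti)).
have B4 : `|(X k - X i).2| <= hsize X t.
  exact: le_trans (coord2_le_dist _ _) (dist_le_hsize (hX _ tk) (hX _ ti)).
split => //.
  rewrite lt_neqAle hsize_ge0 andbT; apply/eqP => h0; move: D0.
  move: B1 B2; rewrite -h0 !normr_le0 /tdet /cross => /eqP -> /eqP ->.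
  by rewrite !mul0r subrr eqxx.
have [lo _] := sr tT; have := le_trans lo (eq_ind_r (fun s => (mu2 (hull X s) <= _)%E)
  (hull3_measure ij ik jk D0) tE).
by rewrite lee_fin ler_pdivrMl.
Qed.

Lemma measure_T0_gt0 : 0 < fine (mu2 (T0 : set (pt R))) /\ (mu2 (T0 : set (pt R)) < +oo)%E.
Proof.
have f : (mu2 (T0 : set (pt R)) < +oo)%E by apply: bounded_lty_pt; [exact: T0_measurable|exact: T0_bounded].
split => //; rewrite fine_gt0 // f andbT lt_neqAle measure_ge0 andbT.
apply/eqP => m0.
have : (T0 : set (pt R)) = set0.
  apply: negligible_open_pt; first exact: T0_open.
  by exists T0; split => //; exact: T0_measurable.
apply/eqP/set0P; exists (1 / 4, 1 / 4); split => /=; lra.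
Qed.

(** The area of the element is that of the reference triangle times the
    determinant, and the element lies in the domain. *)
Lemma hsize_bound_at t e i j k : t \in T -> at_edge t e i j k ->
  hsize X t ^+ 2 <= c1 * (fine (mu2 Om) / fine (mu2 (T0 : set (pt R)))).
Proof.
move=> tT te; have [T0p T0f] := measure_T0_gt0.
have Omf : (mu2 Om < +oo)%E by apply: bounded_lty_pt; [exact: Om_measurable|exact: Om_bounded].
have [_ D0 h2 _ _] := at_edge_shape tT te; have [_ eE] := at_edge_elt tT te.
apply: le_trans h2 _; rewrite ler_pM2l // ler_pdivlMr //.
rewrite -lee_fin fineK ?ge0_fin_numE // EFinM fineK ?ge0_fin_numE // -tri_measure // -eE.
by apply: le_measure; rewrite ?inE; [exact: elt_measurable|exact: Om_measurable|exact: elt_sub].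
Qed.

Lemma elt_has_edge t : t \in T -> exists e i j k, at_edge t e i j k.
Proof.
move=> tT; have t3 := card_elt tT.
have [i it] : exists i, i \in t by apply/card_gt0P; rewrite t3.
have [j] : exists j, j \in t :\ i by apply/card_gt0P; move: t3; rewrite (cardsD1 i) it add1n => -[->].
rewrite !inE => /andP[ji jt].
have [] := edgeP tT (e := [set i; j]%SET).
  rewrite in_edges1 cards2 (eq_sym i) ji /=; apply/fintype.subsetP => x; rewrite !inE.
  by case/orP => /eqP ->.
by move=> i' [j' [k h]]; exists [set i; j]%SET, i', j', k.
Qed.

(** Two triangles on the same side of a common edge would overlap near its
    midpoint. *)
Lemma orient_opposite t t' e : t \in T -> t' \in T -> t != t' ->
  e \in edges [set t]%SET -> e \in edges [set t']%SET -> orient X t e = - orient X t' e.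
Proof.
move=> tT t'T tt' et et'.
have [i [j [k te]]] := edgeP tT et; have [i' [j' [k' te']]] := edgeP t'T et'.
have [ij ki kj eE tE] := te; have [ij' ki' kj' eE' tE'] := te'.
have E : [:: i; j] = [:: i'; j'] by rewrite -!enum_pair // -eE -eE'.
case: E te' ij' ki' kj' eE' tE' => <- <- te' ij' ki' kj' eE' tE'.
rewrite eE tE orientE // tE' orientE //.
have [D0 eltE] := at_edge_elt tT te; have [D0' eltE'] := at_edge_elt t'T te'.
have DD : ~ 0 < tdet (X i) (X j) (X k) * tdet (X i) (X j) (X k').
  move=> DD; have : elt X t `&` elt X t' = set0 by exact: elt_disjoint.
  apply/eqP/set0P; rewrite eltE eltE'.
  set a := X i in D0 D0' DD *; set b := X j in D0 D0' DD *.
  set c := X k in D0 D0' DD *; set c' := X k' in D0 D0' DD *.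
  pose s := tcoord a b c' c.
  pose r := (4 * (1 + `|s.1| + `|s.2|))^-1.
  have n1 := normr_ge0 s.1; have n2 := normr_ge0 s.2.
  have q0 : 0 < 4 * (1 + `|s.1| + `|s.2|) by lra.
  have r0 : 0 < r by rewrite /r invr_gt0.
  have rq : r * (1 + `|s.1| + `|s.2|) = 1 / 4.
    have : r * (4 * (1 + `|s.1| + `|s.2|)) = 1 by rewrite /r mulVf // gt_eqF.
    by lra.
  have s2 : 0 < s.2.
    have -> : s.2 = tdet a b c / tdet a b c'.
      by rewrite /s /tcoord /aff /lin /= /tdet /cross /=; field.
    by rewrite -(pmulr_lgt0 _ (_ : 0 < tdet a b c' ^+ 2)) ?exprn_even_gt0 // expr2 mulrA divfK // .
  have cE : c = tmap a b c' s by rewrite /s tcoordK.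
  (* the midpoint of the edge, moved by the fraction [r] towards [c] *)
  exists (tmap a b c ((1 - r) / 2, r)); split.
    rewrite /tri /= tmapK //.
    have m0 : 0 <= r * (`|s.1| + `|s.2|) by rewrite mulr_ge0 ?addr_ge0 // ltW.
    clearbody r; clear -r0 rq m0.
    by split => /=; lra.
  have -> : tmap a b c ((1 - r) / 2, r) = tmap a b c' ((1 - r) / 2 + r * s.1, r * s.2).
    rewrite [X in tmap a b X]cE; clearbody s; rewrite /tmap /aff /lin /=.
    by congr (_, _); ring.
  clearbody s; rewrite /tri /= tmapK //.
  have l1 : `|r * s.1| <= r * `|s.1| by rewrite normrM gtr0_norm.
  have l2 : r * s.2 <= r * `|s.2| by rewrite ler_pM2l // ler_norm.
  have rs2 : 0 < r * s.2 by rewrite mulr_gt0.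
  move: l1; rewrite ler_norml => /andP[l1 l1'].
  have m1 : 0 <= r * `|s.1| by rewrite mulr_ge0 // ltW.
  have m2 : 0 <= r * `|s.2| by rewrite mulr_ge0 // ltW.
  move: rq; rewrite !mulrDr mulr1 => rq.
  clear -rq r0 l1 l1' l2 rs2 m1 m2.
  clearbody r; split => /=; lra.
move: DD D0 D0'; move: (tdet _ _ _) (tdet _ _ _) => d' d DD D0 D0'.
have [dp|dn|d0] := ltrgt0P d; last by rewrite d0 eqxx in D0.
  have d'n : d' < 0.
    by rewrite lt_neqAle D0' leNgt; apply/negP => h; apply: DD; rewrite mulr_gt0.
  by rewrite gtr0_sg // ltr0_sg // opprK.
have d'p : 0 < d'.
  rewrite lt_neqAle eq_sym D0' leNgt; apply/negP => h; apply: DD; by rewrite nmulr_rgt0.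
by rewrite ltr0_sg // gtr0_sg.
Qed.

(** Just beyond an interior point of the edge of a single triangle, no other
    triangle is available to cover the domain. *)
Lemma boundary_edge_notin t e s : t \in T -> e \in edges [set t]%SET ->
  (forall t', t' \in T -> e \subset t' -> t' = t) ->
  0 < s < 1 -> ~ Om (eparam X e s).
Proof.
move=> tT et uniq /andP[s0 s1] Omx.
have [i [j [k te]]] := edgeP tT et; have [ij ki kj eE tE] := te.
have [nij nik njk] := at_edge_neq te.
have [D0 eltE] := at_edge_elt tT te.
have xE : eparam X e s = tmap (X i) (X j) (X k) (s, 0).
  rewrite /eparam eE ept0 // ept1 // /tmap /aff /lin [LHS]surjective_pairing.
  by congr (_, _); rewrite /= /GRing.scale /=; ring.
set x := eparam X e s in Omx xE.
have [_ cl cap] := tr.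
pose far t' := ~~ ((t' \in T) && `[< hull X t' x >]).
have near1 : \forall y \near x, Om y by apply: open_nbhs_nbhs; split => //; exact: Om_open.
have near2 : \forall y \near x, forall t', t' \in T -> ~ hull X t' x -> ~ hull X t' y.
  have : forall t', \forall y \near x, t' \in T -> ~ hull X t' x -> ~ hull X t' y.
    move=> t'; have [t'T|t'T] := boolP (t' \in T); last by near=> y.
    have [hx|hx] := pselect (hull X t' x); first by near=> y.
    have : nbhs x (~` hull X t').
      apply: open_nbhs_nbhs; split => //; apply: closed_openC.
      have [e' [i' [j' [k' te']]]] := elt_has_edge t'T.
      have [ij' ik' jk'] := at_edge_neq te'; have [D0' _] := at_edge_elt t'T te'.
      by have [_ _ _ _ ->] := te'; apply: hull3_closed.
    by apply: filterS => y hy _ _.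
  move=> h; exact: (@filter_forall _ _ (fun t' y => t' \in T -> ~ hull X t' x -> ~ hull X t' y) (nbhs x) (nbhs_filter x) h).
have /nbhs_ballP[r /= r0 rS] : nbhs x [set y | Om y /\ forall t', t' \in T -> ~ hull X t' x -> ~ hull X t' y].
  by apply: filterI.
pose w := X k - x.
pose d := r / (2 * (1 + `|w.1| + `|w.2|)).
have n1 := normr_ge0 w.1; have n2 := normr_ge0 w.2.
have q0 : 0 < 2 * (1 + `|w.1| + `|w.2|) by lra.
have d0 : 0 < d by rewrite /d divr_gt0.
have dq : d * (1 + `|w.1| + `|w.2|) = r / 2.
  have : d * (2 * (1 + `|w.1| + `|w.2|)) = r by rewrite /d divfK // gt_eqF.
  by lra.
have m1 : 0 <= d * `|w.1| by rewrite mulr_ge0 // ltW.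
have m2 : 0 <= d * `|w.2| by rewrite mulr_ge0 // ltW.
move: dq; rewrite !mulrDr mulr1 => dq.
(* a point just beyond the edge, on the side away from the third vertex *)
have By : ball x r (x - d *: w).
  by split; rewrite /ball /= /GRing.scale /= opprB addrC subrK normrM gtr0_norm //; lra.
have [Omy hy] := rS _ By.
have [t' t'T ht'] : [set y | exists2 t, t \in T & hull X t y] (x - d *: w).
  by rewrite -cl; exact: subset_closure.
have hx' : hull X t' x by apply: contrapT => /(hy _ t'T).
have tt' : t' = t.
  apply: uniq => //.
  have hx : hull X t x.
    rewrite tE; apply/hull3_coord => //; rewrite xE tmapK //; split => /=; lra.
  have : (hull X t `&` hull X t') x by [].
  rewrite cap // => -[W [W0 Wo W1 xW]].
  have Wt l : l \notin t -> W l = 0 by move=> lt; apply: Wo; rewrite !inE (negbTE lt).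
  have WS (V : nmodType) (F : 'I_nv -> V) : (forall l, l \notin t -> F l = 0) ->
      \sum_l F l = F i + F j + F k by rewrite tE; exact: sum_three_vertices.
  have W1' : W i + W j + W k = 1 by rewrite -WS.
  have xW' : x = tmap (X i) (X j) (X k) (W j, W k).
    rewrite xW WS; last by move=> l /Wt ->; rewrite scale0r.
    have -> : W i = 1 - W j - W k by rewrite -W1'; ring.
    rewrite [LHS]surjective_pairing /tmap /aff /lin.
    by congr (_, _); rewrite /= /GRing.scale /=; ring.
  have [Wj Wk] : W j = s /\ W k = 0.
    have : (W j, W k) = (s, 0) by rewrite -(tmapK D0 (W j, W k)) -xW' xE tmapK.
    by case.
  have Wi : W i = 1 - s by lra.
  rewrite eE; apply/fintype.subsetP => l; rewrite !inE => /orP[] /eqP ->; apply/negPn/negP => h.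
    by have := Wo i; rewrite !inE negb_and h orbT Wi => /(_ isT); lra.
  by have := Wo j; rewrite !inE negb_and h orbT Wj => /(_ isT); lra.
move: ht'; rewrite tt' tE => /(hull3_coord nij nik njk D0).
have -> : x - d *: w = tmap (X i) (X j) (X k) ((1 + d) * s, - d).
  rewrite /w xE /tmap /aff /lin [LHS]surjective_pairing.
  by congr (_, _); rewrite /= /GRing.scale /=; ring.
by rewrite tmapK // => -[_ /=]; lra.
Unshelve. all: by end_near.
Qed.

End MeshGeometry.

(** * The Green formula for gradients *)

Section GreenOnTriangles.
Context {R : realType}.
Notation mu := (@lebesgue_measure R).
Notation mu2 := (leb2 R).
Context (a b c : pt R) (D0 : tdet a b c != 0).
Implicit Types (phi v w : sfield R).

Lemma eq_segint w w' (p q : pt R) :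
  (forall s : R, 0 <= s <= 1 -> w (p + s *: (q - p)) = w' (p + s *: (q - p))) ->
  segint w p q = segint w' p q.
Proof. by move=> h; apply: eq_Rintegral => s; rewrite inE /= in_itv /= => /h. Qed.

Lemma segint0 w (p q : pt R) :
  (forall s : R, 0 <= s <= 1 -> w (p + s *: (q - p)) = 0) -> segint w p q = 0.
Proof.
by move=> h; rewrite (@eq_segint _ (fun=> 0)) // /segint /Rintegral integral0.
Qed.

Lemma segint_comb (k l : R) w w' (p q : pt R) : continuous w -> continuous w' ->
  segint (fun x => k * w x + l * w' x) p q = k * segint w p q + l * segint w' p q.
Proof.
move=> cw cw'.
have iw (u : sfield R) : continuous u -> mu.-integrable `[0%R, 1%R] (EFin \o (fun s : R => u (p + s *: (q - p)))).
  by move=> cu; apply: continuous_itv_integrable; exact: line_continuous.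
have cz (m : R) (u : sfield R) : continuous u -> continuous (fun x : pt R => m * u x : R).
  by move=> cu x; apply: (@continuousM _ _ (fun=> m) u); [exact: cst_continuous|exact: cu].
rewrite /segint RintegralD //; [|exact: (iw _ (cz k _ cw))|exact: (iw _ (cz l _ cw'))].
by rewrite !RintegralZl //; exact: iw.
Qed.

Lemma smooth_cont v : smooth v -> continuous v.
Proof. by move=> /(_ 0%N) /Ck_cont. Qed.

Lemma smoothM v w : smooth v -> smooth w -> smooth (fun x => v x * w x).
Proof. by move=> sv sw k; apply: CkM. Qed.

(** The mixed derivatives of [phi] cancel. *)
Lemma grad_vcurl phi v x : smooth phi -> smooth v ->
  dotv (grad phi x) (vcurl v x) =
  pd ord_max (fun y => pd ord0 phi y * v y) x - pd ord0 (fun y => pd ord_max phi y * v y) x.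
Proof.
move=> sp sv; rewrite dotvE /grad /vcurl /vec !mxE /=.
have d1 w i : smooth w -> derivable w x (dir R i) by move=> sw; exact: (@Ck_derivable _ 0 _ _ _ (sw 1%N)).
rewrite !pdM; do 1? by [apply: d1 => //; exact: smooth_pd].
by rewrite -(pd_comm (sp 2%N)); ring.
Qed.

(** The field [grad phi] is irrotational, so the boundary term is all that is
    left; it lives on the one side on which [v] does not vanish. *)
Lemma green_edge phi v : smooth phi -> smooth v ->
  (forall s : R, v (a + s *: (c - a)) = 0) -> (forall s : R, v (b + s *: (c - b)) = 0) ->
  Num.sg (tdet a b c) * ipv (tri a b c) (grad phi) (vcurl v) =
  - segint (fun x => ((b - a).1 * pd ord0 phi x + (b - a).2 * pd ord_max phi x) * v x) a b.
Proof.
move=> sp sv vac vbc.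
have s0 i : smooth (fun y => pd i phi y * v y) by apply: smoothM => //; exact: smooth_pd.
have S0 i : segint (fun y => pd i phi y * v y) b c = 0 /\ segint (fun y => pd i phi y * v y) a c = 0.
  by split; apply: segint0 => s _; rewrite ?vac ?vbc mulr0.
have [_ Gx] := tri_div D0 (s0 ord0 1%N); have [Gy _] := tri_div D0 (s0 ord_max 1%N).
have [Sx1 Sx2] := S0 ord0; have [Sy1 Sy2] := S0 ord_max.
rewrite Sx1 Sx2 in Gx; rewrite Sy1 Sy2 in Gy.
have int i j : mu2.-integrable (tri a b c) (EFin \o pd j (fun y => pd i phi y * v y)).
  apply: continuous_integrable_pt; [exact: tri_measurable|exact: tri_bounded|].
  by apply: smooth_cont; exact: smooth_pd.
have -> : ipv (tri a b c) (grad phi) (vcurl v) =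
  \int[mu2]_(x in tri a b c) pd ord_max (fun y => pd ord0 phi y * v y) x -
  \int[mu2]_(x in tri a b c) pd ord0 (fun y => pd ord_max phi y * v y) x.
  rewrite -(RintegralB (mu := mu2) (tri_measurable a b c) (int _ _) (int _ _)).
  by apply: eq_Rintegral => x _; exact: grad_vcurl.
rewrite mulrBr; apply: etrans (congr2 (fun x y => x - y) Gx Gy) _.
rewrite [X in _ = - X](@eq_segint _ (fun x => (b - a).1 * (pd ord0 phi x * v x) + (b - a).2 * (pd ord_max phi x * v x))); last first.
  by move=> s _; rewrite mulrDl !mulrA.
rewrite (segint_comb _ _ _ _ (smooth_cont (s0 ord0)) (smooth_cont (s0 ord_max))).
clear; move: (segint _ _ _) (segint _ _ _) (b - a) (c - a) => S S' d d'.
by ring.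
Qed.

Lemma ibp_bubble phi w i : smooth phi -> smooth w ->
  (forall s : R, [/\ w (a + s *: (b - a)) = 0, w (a + s *: (c - a)) = 0 & w (b + s *: (c - b)) = 0]) ->
  ip (tri a b c) (pd i phi) w = - ip (tri a b c) phi (pd i w).
Proof.
move=> sp sw w0.
have sM := smoothM sp sw.
have Z : \int[mu2]_(x in tri a b c) pd i (fun y => phi y * w y) x = 0.
  have S0 p q : (forall s : R, w (p + s *: (q - p)) = 0) -> segint (fun y => phi y * w y) p q = 0.
    by move=> h; apply: segint0 => s _; rewrite h mulr0.
  have S1 : segint (fun y => phi y * w y) a b = 0 by apply: S0 => s; case: (w0 s).
  have S2 : segint (fun y => phi y * w y) a c = 0 by apply: S0 => s; case: (w0 s).
  have S3 : segint (fun y => phi y * w y) b c = 0 by apply: S0 => s; case: (w0 s).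
  have [E1 E2] := tri_div D0 (sM 1%N); rewrite S1 S2 S3 !subrr !mulr0 subrr in E1 E2.
  have sgD : Num.sg (tdet a b c) != 0 by rewrite sgr_eq0.
  have [->|->] := dirE i; apply: (mulfI sgD); rewrite mulr0; first exact: E1.
  exact: E2.
have mt : measurable (tri a b c) by exact: tri_measurable.
have L v : smooth v -> L2 (tri a b c) v.
  by move=> sv; apply: smooth_L2 => //; [exact: tri_open|exact: tri_bounded].
have E : \int[mu2]_(x in tri a b c) pd i (fun y => phi y * w y) x =
    ip (tri a b c) phi (pd i w) + ip (tri a b c) w (pd i phi).
  have i1 : mu2.-integrable (tri a b c) (EFin \o (fun x => phi x * pd i w x)).
    by apply: ip_integrable => //; apply: L => //; exact: smooth_pd.
  have i2 : mu2.-integrable (tri a b c) (EFin \o (fun x => w x * pd i phi x)).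
    by apply: ip_integrable => //; apply: L => //; exact: smooth_pd.
  rewrite /ip -(RintegralD (mu := mu2) mt i1 i2).
  apply: eq_Rintegral => x _; rewrite pdM //; [exact: (@Ck_derivable _ 0 _ _ _ (sp 1%N))|exact: (@Ck_derivable _ 0 _ _ _ (sw 1%N))].
by rewrite ipC; apply/eqP; rewrite -addr_eq0 addrC -E Z.
Qed.

End GreenOnTriangles.

Section Tangential.
Context {R : realType}.

(** On an open edge where [phi] vanishes, so does its derivative along it. *)
Lemma tangential_derivative_eq0 (phi : sfield R) (a d : pt R) (s : R) : Ck 1 phi ->
  (forall r : R, 0 < r < 1 -> phi (a + r *: d) = 0) -> 0 < s < 1 ->
  d.1 * pd ord0 phi (a + s *: d) + d.2 * pd ord_max phi (a + s *: d) = 0.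
Proof.
move=> sp h /andP[s0 s1].
have H := is_derive_line (Ck1_directional (a + s *: d) d sp).
have nr : \forall r \near s, (fun r : R => phi (a + r *: d)) r = (fun=> 0 : R) r.
  near=> r; apply: h; apply/andP; split; near: r; [exact: lt_nbhsr|exact: lt_nbhsl].
rewrite -(@derive_val _ _ _ _ _ _ _ H) (near_eq_derive _ nr) ?oner_eq0 //.
exact: derive_cst.
Unshelve. all: by end_near.
Qed.

End Tangential.

(** * Functionals on H^1_0 *)

Section Subdomains.
Context {R : realType}.
Notation mu2 := (leb2 R).
Implicit Types (D E : set (pt R)) (v w : sfield R) (g V : vfield R).

Lemma L2_sub D E v : measurable D -> measurable E -> E `<=` D -> L2 D v -> L2 E v.
Proof.
move=> mD mE ED [mv fv]; split; first exact: (measurable_funS mD ED mv).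
apply: le_lt_trans fv; apply: ge0_le_integral_nonmeas => // x _; by rewrite lee_fin sqr_ge0.
Qed.

Lemma L2v_sub D E g : measurable D -> measurable E -> E `<=` D -> L2v D g -> L2v E g.
Proof. by move=> mD mE ED h i; apply: L2_sub (h i). Qed.

Lemma le_ip_sub D E v : measurable D -> measurable E -> E `<=` D -> L2 D v ->
  ip E v v <= ip D v v.
Proof.
move=> mD mE ED Lv; rewrite -lee_fin -!sqL2E_ip //; last exact: L2_sub Lv.
by apply: ge0_le_integral_nonmeas => // x _; rewrite lee_fin sqr_ge0.
Qed.

Lemma sum_ip_disjoint (I : finType) (P : {set I}) (E : I -> set (pt R)) D v : measurable D ->
  (forall i, measurable (E i)) -> (forall i, i \in P -> E i `<=` D) ->
  (forall i j, i \in P -> j \in P -> i != j -> E i `&` E j = set0) -> L2 D v ->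
  \sum_(i in P) ip (E i) v v <= ip D v v.
Proof.
move=> mD mE ED dj Lv.
have U : \big[setU/set0]_(i <- enum P) E i `<=` D.
  by move=> x; rewrite -bigcup_seq => -[i /=]; rewrite mem_enum => /ED; apply.
have mU : measurable (\big[setU/set0]_(i <- enum P) E i).
  by apply: bigsetU_measurable.
have LU : L2 (\big[setU/set0]_(i <- enum P) E i) v by apply: L2_sub Lv.
apply: le_trans (le_ip_sub mD mU U Lv); rewrite -lee_fin -sqL2E_ip // /sqL2.
rewrite (ge0_integral_bigsetU mu2) ?enum_uniq //.
- rewrite big_enum /= -sumEFin; apply: lee_sum => i iP.
  by rewrite -sqL2E_ip //; apply: L2_sub Lv => //; exact: ED.
- apply/trivIsetP => i j; rewrite /= !mem_enum; exact: dj.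
- by have [m _] := LU; apply/measurable_EFinP; exact: measurable_funX.
- by move=> x _; rewrite lee_fin sqr_ge0.
Qed.

End Subdomains.

(** Functionals of a function and its gradient that are continuous for the
    norm of H^1. The bound is kept in the form of Young's inequality, with a
    free parameter, so that sums of such functionals are again of this kind. *)
Definition l2_functional (R : realType) (D : set (pt R)) (L : sfield R -> vfield R -> R) : Prop :=
  (forall w w' g g', L2 D w -> L2 D w' -> L2v D g -> L2v D g' ->
     L (fun x => w x - w' x) (fun x => g x - g' x) = L w g - L w' g') /\
  exists K : R, forall w g (d : R), L2 D w -> L2v D g -> 0 < d ->
    `|L w g| <= d^-1 * (ip D w w + (ip D (fun x => g x ord0 ord0) (fun x => g x ord0 ord0) +
       ip D (fun x => g x ord_max ord0) (fun x => g x ord_max ord0))) + d * K.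

Section Density.
Context {R : realType}.
Notation mu2 := (leb2 R).
Implicit Types (D E : set (pt R)) (v w : sfield R) (g V : vfield R).

Lemma l2_functionalD D L L' : l2_functional D L -> l2_functional D L' ->
  l2_functional D (fun w g => L w g + L' w g).
Proof.
move=> [lin [K hK]] [lin' [K' hK']]; split.
  by move=> w w' g g' *; rewrite lin // lin' // opprD addrACA.
exists (2 * (K + K')) => w g d Lw Lg d0.
have d2 : 0 < 2 * d by rewrite mulr_gt0.
have := hK w g _ Lw Lg d2; have := hK' w g _ Lw Lg d2; rewrite invfM.
set N := ip D w w + _; move=> h1 h2.
have := ler_normD (L w g) (L' w g); lra.
Qed.

Lemma l2_functional_fun D E (V : sfield R) : measurable D -> measurable E -> E `<=` D -> L2 E V ->
  l2_functional D (fun w _ => ip E w V).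
Proof.
move=> mD mE ED LV; split.
  by move=> w w' g g' Lw Lw' _ _; rewrite ipBl //; apply: L2_sub ED _.
exists (ip E V V) => w g d Lw Lg d0.
have LwE : L2 E w by apply: L2_sub ED _.
have := @ip_young _ E mE d^-1 w V; rewrite invr_gt0 invrK => /(_ d0 LwE LV) h.
apply: le_trans h _; rewrite lerD2r ler_pM2l ?invr_gt0 //.
have := le_ip_sub mD mE ED Lw.
have := ip_ge0 D (fun x => g x ord0 ord0); have := ip_ge0 D (fun x => g x ord_max ord0); lra.
Qed.

Lemma l2_functional_comp D E (V : sfield R) i : measurable D -> measurable E -> E `<=` D -> L2 E V ->
  l2_functional D (fun _ g => ip E (fun x => g x i ord0) V).
Proof.
move=> mD mE ED LV; split.
  move=> w w' g g' _ _ Lg Lg'; rewrite -ipBl //; try by [apply: L2_sub ED _].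
  by apply: eq_ip => // x _; rewrite !mxE.
exists (ip E V V) => w g d Lw Lg d0.
have LwE : L2 E (fun x => g x i ord0) by apply: L2_sub ED _.
have := @ip_young _ E mE d^-1 _ V; rewrite invr_gt0 invrK => /(_ _ d0 LwE LV) h.
apply: le_trans h _; rewrite lerD2r ler_pM2l ?invr_gt0 //.
have := le_ip_sub mD mE ED (Lg i).
have := ip_ge0 D (fun x => g x ord0 ord0); have := ip_ge0 D (fun x => g x ord_max ord0).
have := ip_ge0 D w.
by have [->|->] := dirE i; lra.
Qed.

Lemma l2_functional_ext D L L' :
  (forall w g, L2 D w -> L2v D g -> L w g = L' w g) -> l2_functional D L' ->
  measurable D -> l2_functional D L.
Proof.
move=> e [lin [K hK]] mD; split.
  move=> w w' g g' Lw Lw' Lg Lg'; rewrite !e ?lin //; first exact: L2B.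
  move=> i; apply: (@L2_ext _ _ (fun x => g x i ord0 - g' x i ord0)) => [x _|]; first by rewrite !mxE.
  exact: L2B.
by exists K => w g d Lw Lg d0; rewrite e //; exact: hK.
Qed.

Lemma l2_functional_grad D E V : measurable D -> measurable E -> E `<=` D -> L2v E V ->
  l2_functional D (fun _ g => ipv E g V).
Proof.
move=> mD mE ED LV.
apply: (l2_functional_ext (L' := fun _ g => ip E (fun x => g x ord0 ord0) (fun x => V x ord0 ord0) +
  ip E (fun x => g x ord_max ord0) (fun x => V x ord_max ord0))) => //.
  by move=> w g _ Lg; rewrite ipvE //; apply: L2v_sub ED _.
by apply: l2_functionalD; apply: l2_functional_comp => //; exact: LV.
Qed.

Lemma smooth_L2v D v : open D -> bounded_set D -> smooth v -> L2v D (grad v).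
Proof.
move=> oD bD sv i; apply: (@L2_ext _ _ (pd i v)) => [x _|]; first by rewrite mxE.
by apply: smooth_L2 => //; exact: smooth_pd.
Qed.

(** Test functions that approximate [u] with error [d^2] make the functional
    at most a constant times [d]. *)
Lemma H10_density D L u : open D -> bounded_set D -> H10 D u -> l2_functional D L ->
  (forall phi, test_fun D phi -> L phi (grad phi) = 0) -> L u (wgrad D u) = 0.
Proof.
move=> oD bD [Lu wu dens] [lin [K hK]] h.
have mD := open_measurable_pt oD.
have [Lg _] := wgradP wu.
apply/eqP; apply: contraT => nz.
pose m := `|L u (wgrad D u)|.
have m0 : 0 < m by rewrite normr_gt0.
pose d := m / (2 * (1 + `|K|)).
have K0 := normr_ge0 K.
have q0 : 0 < 2 * (1 + `|K|) by lra.
have d0 : 0 < d by rewrite divr_gt0.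
have [phi tphi] := dens (d ^+ 2) (exprn_gt0 2 d0).
have sphi : smooth phi by case: tphi.
have Lphi : L2 D phi by exact: smooth_L2.
have Lgphi := smooth_L2v oD bD sphi.
have LB : L2v D (fun x => wgrad D u x - grad phi x).
  move=> i; apply: (@L2_ext _ _ (fun x => wgrad D u x i ord0 - grad phi x i ord0)) => [x _|]; first by rewrite !mxE.
  exact: L2B (Lg i) (Lgphi i).
rewrite sqL2E_ip; last exact: L2B.
rewrite sqL2v_ip // -EFinD lte_fin => small.
have := hK _ _ d (L2B mD Lu Lphi) LB d0; rewrite lin // h // subr0 -/m.
set N := (ip D (fun x => u x - phi x) _ + _) in small * => hm.
have h1 : d^-1 * N <= d by rewrite ler_pdivrMl // -expr2 ltW.
have dK : d * K <= d * `|K| by rewrite ler_wpM2l ?ler_norm // ltW.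
have h2 : d * (2 * (1 + `|K|)) = m by rewrite /d divfK // gt_eqF.
suff : False by [].
clear -hm h1 dK h2 d0 m0; clearbody d m N; lra.
Qed.

End Density.

(** * The coefficient and the energy norm *)

Section TwoByTwo.
Context {R : realType}.
Implicit Types (M N A : 'M[R]_2) (v w z : 'cV[R]_2).

Definition col2 (p q : R) : 'cV[R]_2 := vec (p, q).

Lemma col2E v : v = col2 (v ord0 ord0) (v ord_max ord0).
Proof.
by apply/colP => i; rewrite mxE; have [->|->] := dirE i.
Qed.

Lemma mulmx2E M v i : (M *m v) i ord0 = M i ord0 * v ord0 ord0 + M i ord_max * v ord_max ord0.
Proof.
rewrite mxE big_ord_recl big_ord1.
by rewrite (_ : lift ord0 ord0 = ord_max); last exact: val_inj.
Qed.

Lemma eq_mx2 M N : (forall i j, M i j = N i j) -> M = N.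
Proof. by move=> h; apply/matrixP. Qed.

Lemma dotv_mulmx M v w : M^T = M -> dotv (M *m v) w = dotv v (M *m w).
Proof.
move=> /matrixP sM; have := sM ord_max ord0; rewrite mxE => E.
by rewrite !dotvE !mulmx2E E; ring.
Qed.

Lemma dotv_ge0 v : 0 <= dotv v v.
Proof. by rewrite dotvE -!expr2 addr_ge0 ?sqr_ge0. Qed.

Lemma dotv_eq0 v : dotv v v = 0 -> v = 0.
Proof.
rewrite dotvE -!expr2 => /eqP; rewrite paddr_eq0 ?sqr_ge0 // !sqrf_eq0 => /andP[/eqP a /eqP b].
by rewrite (col2E v) a b; apply/colP => i; rewrite !mxE /=; case: ifP.
Qed.

Lemma dotv_gt0 v : v != 0 -> 0 < dotv v v.
Proof.
by move=> v0; rewrite lt_neqAle dotv_ge0 andbT eq_sym; apply: contraNneq v0 => /dotv_eq0 ->.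
Qed.

Lemma det2E M : \det M = M ord0 ord0 * M ord_max ord_max - M ord0 ord_max * M ord_max ord0.
Proof.
rewrite (expand_det_row _ ord0) big_ord_recl big_ord1 /cofactor !det_mx11 !mxE /= expr0 mul1r.
rewrite (_ : lift ord0 ord0 = ord_max); last exact: val_inj.
rewrite (_ : lift ord_max ord0 = ord0); last exact: val_inj.
by rewrite expr1; ring.
Qed.

(** By the theorem of Cayley and Hamilton, (M + d)^2 = (tr M + 2 d) M for
    d^2 = det M. *)
Lemma spd_sqrt M : spd M -> exists S, spd S /\ S *m S = M.
Proof.
move=> [sM pM].
have E : M ord_max ord0 = M ord0 ord_max by rewrite -[in LHS]sM mxE.
set p := M ord0 ord0; set r := M ord_max ord_max; set q := M ord0 ord_max.
have form x y : dotv (col2 x y) (M *m col2 x y) = p * x ^+ 2 + 2 * q * x * y + r * y ^+ 2.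
  by rewrite dotvE !mulmx2E !mxE /= E -/p -/q -/r; ring.
have nz x y : (x != 0) || (y != 0) -> col2 x y != 0.
  apply: contraTneq => /colP h; move: (h ord_max) (h ord0); rewrite /col2 /vec !mxE /= => -> ->.
  by rewrite eqxx.
have p0 : 0 < p by have := pM _ (nz 1 0 _); rewrite form oner_neq0 => /(_ isT); lra.
have r0 : 0 < r by have := pM _ (nz 0 1 _); rewrite form oner_neq0 orbT => /(_ isT); lra.
have d0 : 0 < p * r - q ^+ 2.
  have := pM _ (nz r (- q) _); rewrite form gt_eqF // => /(_ isT).
  rewrite (_ : _ + _ = r * (p * r - q ^+ 2)); last by ring.
  by rewrite pmulr_rgt0.
pose d := Num.sqrt (p * r - q ^+ 2).
have dd : d ^+ 2 = p * r - q ^+ 2 by rewrite sqr_sqrtr // ltW.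
have dp : 0 < d by rewrite sqrtr_gt0.
have s0 : 0 < p + r + 2 * d by lra.
pose s := Num.sqrt (p + r + 2 * d).
have ss : s ^+ 2 = p + r + 2 * d by rewrite sqr_sqrtr // ltW.
have sp : 0 < s by rewrite sqrtr_gt0.
have sn : s != 0 by rewrite gt_eqF.
exists (s^-1 *: (M + d%:M)); split; first split.
- by rewrite linearZ /= linearD /= sM tr_scalar_mx.
- move=> v v0; rewrite -scalemxAl mulmxDl mul_scalar_mx.
  have -> : dotv v (s^-1 *: (M *m v + d *: v)) = s^-1 * (dotv v (M *m v) + d * dotv v v).
    by rewrite !dotvE !mxE; ring.
  by rewrite mulr_gt0 ?invr_gt0 // addr_gt0 ?mulr_gt0 ?pM ?dotv_gt0.
- rewrite -scalemxAl -scalemxAr scalerA; apply: eq_mx2 => i j; rewrite !mxE.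
  rewrite big_ord_recl big_ord1 !mxE.
  rewrite (_ : lift ord0 ord0 = ord_max); last exact: val_inj.
  have -> : s^-1 * s^-1 = (p + r + 2 * d)^-1 by rewrite -ss expr2 invfM.
  have n0 : p + r + 2 * d != 0 by rewrite gt_eqF.
  have rE : r = (d ^+ 2 + q ^+ 2) / p by rewrite dd; field; rewrite gt_eqF.
  have mk (x y : R) : x = (p + r + 2 * d) * y -> (p + r + 2 * d)^-1 * x = y.
    by move=> ->; rewrite mulKf.
  by have [->|->] := dirE i; have [->|->] := dirE j; rewrite /= ?E -/p -/q -/r ?mulr1n ?mulr0n;
    apply: mk; rewrite ?addr0; ring: dd.
Qed.

(** The square root exists, so the choice in its definition is meaningful. *)
Lemma sqrtmxP M : spd M -> spd (sqrtmx M) /\ sqrtmx M *m sqrtmx M = M.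
Proof.
move=> /spd_sqrt [S hS]; rewrite /sqrtmx.
by case: xgetP => [S' -> //|/(_ S)].
Qed.

Section Elliptic.
Context (A : 'M[R]_2) (alpha : R) (al0 : 0 < alpha) (sA : A^T = A).
Context (eA : forall v, alpha * dotv v v <= dotv v (A *m v)).

Lemma elliptic_unit : A \in unitmx.
Proof.
rewrite unitmxE unitfE; apply/det0P => -[v v0 vA].
have : A *m v^T = 0 by rewrite -[A]sA -trmx_mul vA trmx0.
move=> Av; have := eA v^T; rewrite Av.
have -> : dotv v^T (0 : 'cV[R]_2) = 0 by rewrite dotvE !mxE !mulr0 addr0.
rewrite leNgt mulr_gt0 // dotv_gt0 //.
by apply: contraNneq v0 => h; rewrite -[v]trmxK h trmx0.
Qed.

Lemma elliptic_inv_spd : spd (invmx A).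
Proof.
split; first by rewrite trmx_inv sA.
move=> v v0; set y := invmx A *m v.
have vE : v = A *m y by rewrite /y mulKVmx // elliptic_unit.
rewrite vE dotv_mulmx // (lt_le_trans _ (eA y)) // mulr_gt0 // dotv_gt0 //.
by apply: contraNneq v0 => h; rewrite vE h mulmx0.
Qed.

(** With [y = A^-1 v], ellipticity reads [alpha |y|^2 <= y . v], and [y . v] is the
    squared norm of the square root applied to [v]. *)
Lemma elliptic_energy v :
  alpha * dotv (invmx A *m v) (invmx A *m v) <=
  dotv (sqrtmx (invmx A) *m v) (sqrtmx (invmx A) *m v).
Proof.
have [[sS _] SS] := sqrtmxP elliptic_inv_spd.
apply: le_trans (eA _) _; rewrite (mulKVmx elliptic_unit).
rewrite [leRHS]dotv_mulmx // mulmxA SS !dotvE; lra.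
Qed.

(** Makes [A^-1 p_h] square integrable. *)
Lemma elliptic_inv_bound i j : invmx A i j ^+ 2 <= (alpha ^+ 2)^-1.
Proof.
pose v : 'cV[R]_2 := \col_k (k == j)%:R.
have vv : dotv v v = 1.
  by rewrite dotvE !mxE; have [->|->] := dirE j; rewrite /= ?eqxx; ring.
have yE : (invmx A *m v) i ord0 = invmx A i j.
  by rewrite mulmx2E !mxE; have [->|->] := dirE j; rewrite /= ?eqxx; ring.
set y := invmx A *m v in yE.
have E := eA y; have vA : A *m y = v by rewrite /y mulKVmx // elliptic_unit.
rewrite vA in E.
(* Cauchy and Schwarz, in the form (alpha y - v)^2 >= 0 *)
have a2 : 0 < alpha ^+ 2 by rewrite exprn_gt0.
have yv : alpha ^+ 2 * dotv y y <= 1.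
  have s1 := sqr_ge0 (alpha * y ord0 ord0 - v ord0 ord0).
  have s2 := sqr_ge0 (alpha * y ord_max ord0 - v ord_max ord0).
  have E' : alpha * (alpha * dotv y y) <= alpha * dotv y v by rewrite ler_pM2l.
  move: E' vv s1 s2; rewrite !dotvE !expr2; lra.
rewrite -yE -[leRHS]mulr1 ler_pdivlMl //; apply: le_trans yv; rewrite ler_pM2l // dotvE -!expr2.
by have [->|->] := dirE i; rewrite ?lerDl ?lerDr sqr_ge0.
Qed.

End Elliptic.

Lemma invmx2E M i j : \det M != 0 ->
  invmx M i j = (\det M)^-1 * ((-1) ^+ (i + j) * M (if j == ord0 then ord_max else ord0) (if i == ord0 then ord_max else ord0)).
Proof.
move=> d0; rewrite /invmx unitmxE unitfE d0 !mxE /cofactor det_mx11 !mxE addnC; congr (_ * (_ * M _ _)).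
  by have [->|->] := dirE j; apply: val_inj.
by have [->|->] := dirE i; apply: val_inj.
Qed.

End TwoByTwo.

Section CoefficientFields.
Context {R : realType}.
Notation mu2 := (leb2 R).
Context (Om : set (pt R)) (mOm : measurable Om) (A : pt R -> 'M[R]_2).
Context (cA : coefficient Om A).

(** Away from 0 the inverse is [y] times a negative power of [y^2], for which
    measurability is known; the total inverse agrees at 0. *)
Lemma measurable_inv d (T : measurableType d) (D : set T) (f : T -> R) : measurable D -> measurable_fun D f ->
  measurable_fun D (fun x => (f x)^-1).
Proof.
move=> mD mf.
have E x : (f x)^-1 = f x * ((f x ^+ 2) `^ (-1)).
  rewrite powR_inv1 ?sqr_ge0 //; have [->|nz] := eqVneq (f x) 0; first by rewrite invr0 mul0r.
  by field.
rewrite (_ : (fun x => _) = (fun x => f x * ((f x ^+ 2) `^ (-1)))); last by apply/funext => x; exact: E.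
apply: measurable_funM => //.
apply: (@measurableT_comp _ _ _ _ _ _ (@powR R ^~ (-1))); first exact: measurable_powR.
exact: measurable_funX.
Qed.

(** A matrix that is not invertible is its own inverse, whence the case
    distinction on the determinant. *)
Lemma measurable_invmx i j : measurable_fun Om (fun x => invmx (A x) i j).
Proof.
have [mA _ _ _] := cA.
have md : measurable_fun Om (fun x => \det (A x)).
  rewrite (_ : (fun x => _) = (fun x => A x ord0 ord0 * A x ord_max ord_max - A x ord0 ord_max * A x ord_max ord0)).
    by apply: measurable_funB; apply: measurable_funM.
  by apply/funext => x; exact: det2E.
rewrite (_ : (fun x => _) = (fun x => if \det (A x) == 0 then A x i j else
  (\det (A x))^-1 * ((-1) ^+ (i + j) * A x (if j == ord0 then ord_max else ord0) (if i == ord0 then ord_max else ord0)))).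
  apply: measurable_fun_if => //.
  - by apply: measurable_fun_eqr.
  - by apply: measurable_funS (mA i j).
  - have sub : Om `&` (fun x => \det (A x) == 0) @^-1` [set false] `<=` Om by move=> x [].
    apply: measurable_funS mOm sub _; apply: measurable_funM; first exact: measurable_inv.
    exact: measurable_funM.
apply/funext => x; case: eqP => [d0|/eqP d0]; last exact: invmx2E.
by rewrite /invmx unitmxE unitfE d0 eqxx.
Qed.

Lemma L2v_mulmx (B : pt R -> 'M[R]_2) (q : vfield R) (K : R) :
  (forall i j, measurable_fun Om (fun x => B x i j)) ->
  (forall i j, {ae mu2, forall x, Om x -> B x i j ^+ 2 <= K}) ->
  L2v Om q -> L2v Om (fun x => B x *m q x).
Proof.
move=> mB bB Lq i.
have L j : L2 Om (fun x => B x i j * q x j ord0).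
  have mq : measurable_fun Om (fun x => q x j ord0) by case: (Lq j).
  apply: (@sqi_dom _ _ _ mu2 Om mOm _ (fun x => q x j ord0) K).
  - by apply: measurable_funM => //; exact: mB.
  - exact: Lq.
  - by apply: (ae_imp (mu := mu2) (bB i j)) => x h Ox; rewrite exprMn ler_wpM2r ?sqr_ge0 ?h.
apply: L2_ext (L2D mOm (L ord0) (L ord_max)) => x _; by rewrite mulmx2E.
Qed.

Lemma flux_L2v (G : vfield R) : L2v Om G -> L2v Om (fun x => A x *m G x).
Proof.
have [mA [M bA] _ _] := cA; apply: (L2v_mulmx (K := M ^+ 2)) => // i j.
apply: (ae_imp (mu := mu2) (bA i j)) => x h Ox.
by rewrite -(real_normK (num_real (A x i j))) lerXn2r ?nnegrE ?(le_trans _ (h Ox)) ?h.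
Qed.

Lemma Ainv_L2v (q : vfield R) : L2v Om q -> L2v Om (Ainv A q).
Proof.
have [_ _ sA [alpha al0 eA]] := cA.
apply: (L2v_mulmx (K := (alpha ^+ 2)^-1)) => [i j|i j]; first exact: measurable_invmx.
apply: (ae_imp2 (mu := mu2) sA eA) => x h1 h2 Ox.
exact: (elliptic_inv_bound al0 (h1 Ox) (h2 Ox)).
Qed.

(** The gradient of the exact solution differs from the discrete one by
    A^-1 (p - p_h), which the energy norm of the flux error controls. *)
Lemma energy_bound : exists2 alpha : R, 0 < alpha & forall G ph : vfield R,
  {ae mu2, forall x, Om x ->
    let d := Ainv A ph x - G x in
    let z := sqrtmx (invmx (A x)) *m (A x *m G x - ph x) in
    alpha * dotv d d <= dotv z z}.
Proof.
have [_ _ sA [alpha al0 eA]] := cA; exists alpha => // G ph.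
apply: (ae_imp2 (mu := mu2) sA eA) => x h1 h2 Ox /=.
have := elliptic_energy al0 (h1 Ox) (h2 Ox) (A x *m G x - ph x).
rewrite mulmxBr mulKmx; last exact: (elliptic_unit al0 (h1 Ox) (h2 Ox)).
rewrite -/(Ainv A ph x); congr (_ * _ <= _).
by rewrite !dotvE !mxE; ring.
Qed.

End CoefficientFields.

(** * Local lower bounds for the error *)

Section VectorYoung.
Context {R : realType}.
Notation mu2 := (leb2 R).
Context (D : set (pt R)) (oD : open D) (bD : bounded_set D).
Implicit Types (v : sfield R) (g : vfield R).

Let mD : measurable D := open_measurable_pt oD.

Lemma vcurl_L2v v : smooth v -> L2v D (vcurl v).
Proof.
move=> sv i; have L j : L2 D (pd j v) by apply: smooth_L2 => //; exact: smooth_pd.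
apply: (@L2_ext _ _ (if i == ord0 then pd ord_max v else (fun x => - pd ord0 v x))).
  by move=> x _; rewrite /vcurl /vec mxE /=; case: ifP.
by case: ifP => _; [exact: L|exact: L2N].
Qed.

Definition sqv g : R := ip D (fun x => g x ord0 ord0) (fun x => g x ord0 ord0) +
  ip D (fun x => g x ord_max ord0) (fun x => g x ord_max ord0).

Lemma sqv_ge0 g : 0 <= sqv g.
Proof. by rewrite addr_ge0 ?ip_ge0. Qed.

Lemma le_sqv g i : ip D (fun x => g x i ord0) (fun x => g x i ord0) <= sqv g.
Proof. by have [->|->] := dirE i; rewrite ?lerDl ?lerDr ip_ge0. Qed.

Lemma vcurl_young g v e : 0 < e -> L2v D g -> smooth v ->
  `|ipv D g (vcurl v)| <=
  e^-1 * sqv g + e * (ip D (pd ord0 v) (pd ord0 v) + ip D (pd ord_max v) (pd ord_max v)).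
Proof.
move=> e0 Lg sv; have L j : L2 D (pd j v) by apply: smooth_L2 => //; exact: smooth_pd.
rewrite ipvE //; last exact: vcurl_L2v.
have -> : ip D (fun x => g x ord0 ord0) (fun x => vcurl v x ord0 ord0) =
    ip D (fun x => g x ord0 ord0) (pd ord_max v).
  by apply: eq_ip => // x _; rewrite /vcurl /vec mxE.
have -> : ip D (fun x => g x ord_max ord0) (fun x => vcurl v x ord_max ord0) =
    - ip D (fun x => g x ord_max ord0) (pd ord0 v).
  rewrite [in RHS]ipC -(ipNl mD (L ord0) (Lg ord_max)).
  by rewrite ipC; apply: eq_ip => // x _; rewrite /vcurl /vec mxE.
apply: le_trans (ler_normB _ _) _.
have e1 : 0 < e^-1 by rewrite invr_gt0.
have := ip_young mD e1 (Lg ord0) (L ord_max); have := ip_young mD e1 (Lg ord_max) (L ord0).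
rewrite invrK /sqv => y1 y2; apply: le_trans (lerD y2 y1) _.
rewrite addrACA -!mulrDr; move: (ip D (pd ord0 v) _) (ip D (pd ord_max v) _) => z z'.
by rewrite (addrC z').
Qed.

Lemma ipvBl g g' V : L2v D g -> L2v D g' -> L2v D V ->
  ipv D (fun x => g x - g' x) V = ipv D g V - ipv D g' V.
Proof.
move=> Lg Lg' LV; rewrite !(ipvE mD) //; last first.
  move=> i; apply: (@L2_ext _ _ (fun x => g x i ord0 - g' x i ord0)) => [x _|]; first by rewrite !mxE.
  exact: (L2B mD (Lg i) (Lg' i)).
have E i : ip D (fun x => (g x - g' x) i ord0) (fun x => V x i ord0) =
    ip D (fun x => g x i ord0) (fun x => V x i ord0) - ip D (fun x => g' x i ord0) (fun x => V x i ord0).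
  by rewrite -(ipBl mD (Lg i) (Lg' i) (LV i)); apply: eq_ip => // x _; rewrite !mxE.
by rewrite !E; ring.
Qed.

Lemma L2vB g g' : L2v D g -> L2v D g' -> L2v D (fun x => g x - g' x).
Proof.
move=> Lg Lg' i; apply: (@L2_ext _ _ (fun x => g x i ord0 - g' x i ord0)) => [x _|]; first by rewrite !mxE.
exact: (L2B mD (Lg i) (Lg' i)).
Qed.

End VectorYoung.

Section LocalBounds.
Context {R : realType} (Om : set (pt R)) (nv : nat) (X : 'I_nv -> pt R).
Context (T : {set {set 'I_nv}}) (c1 : R).
Notation mu := (@lebesgue_measure R).
Notation mu2 := (leb2 R).
Context (pOm : polygonal_domain Om) (tr : triangulation Om X T).
Context (sr : shape_regular c1 X T) (c10 : 0 < c1).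
Context (u : sfield R) (Hu : H10 Om u) (psi : vfield R) (Lpsi : L2v Om psi).
Context (creg : curl_regular X T psi).
Implicit Types (t e : {set 'I_nv}) (v : sfield R).

Let oOm : open Om := Om_open pOm.
Let bOm : bounded_set Om := Om_bounded pOm.
Let mOm : measurable Om := Om_measurable pOm.
Let G : vfield R := wgrad Om u.
Let d : vfield R := fun x => psi x - G x.
Let c t := wcurl (elt X t) psi.

Lemma exact_grad_L2v : L2v Om G.
Proof. by case: Hu => _ /wgradP[]. Qed.

Let bE t (tT : t \in T) : bounded_set (elt X t) := elt_bounded pOm tr tT.
Let mE t : measurable (elt X t) := elt_measurable X t.
Let oE t : open (elt X t) := @elt_open _ _ X t.

Lemma elt_L2v t (g : vfield R) : t \in T -> L2v Om g -> L2v (elt X t) g.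
Proof. by move=> tT; apply: L2v_sub => //; exact: (elt_sub pOm tr). Qed.

Lemma elt_L2 t v : t \in T -> L2 Om v -> L2 (elt X t) v.
Proof. by move=> tT; apply: L2_sub => //; exact: (elt_sub pOm tr). Qed.

Lemma elt_smooth_L2 t v : t \in T -> smooth v -> L2 (elt X t) v.
Proof. by move=> tT; apply: smooth_L2 => //; exact: bE. Qed.

Lemma curl_L2 t : t \in T -> L2 (elt X t) (c t).
Proof.
move=> tT; have [[c0 hc0] _] := creg tT; rewrite /c /wcurl.
by case: xgetP => [c' _ []//|/(_ c0)].
Qed.

Lemma ttraceP t : t \in T -> is_ttrace X t psi (ttrace X t psi).
Proof.
move=> tT; have [_ [g hg]] := creg tT; rewrite /ttrace.
by case: xgetP => [c' _ []//|/(_ g)].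
Qed.

(** The integrals over the two other edges vanish with [v]. *)
Lemma green_one_edge t e i j k v : t \in T -> at_edge t e i j k -> smooth v ->
  (forall s : R, v (X i + s *: (X k - X i)) = 0) ->
  (forall s : R, v (X j + s *: (X k - X j)) = 0) ->
  ip (elt X t) (c t) v = ipv (elt X t) psi (vcurl v) + orient X t e * ipE X e (ttrace X t psi e) v.
Proof.
move=> tT te sv v1 v2; have [_ -> //] := ttraceP tT; congr (_ + _).
have [ij ki kj eE tE] := te; have [nij nik njk] := at_edge_neq te.
have et : e \in edges [set t]%SET.
  rewrite in_edges1 eE tE cards2 nij /=; apply/fintype.subsetP => l; rewrite !inE.
  by move=> ->.
rewrite (bigD1 e) //= big1 ?addr0 // => e' /andP[e't ne].
rewrite /ipE /Rintegral integral0_eq ?mulr0 // => s _.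
rewrite tE in e't; rewrite eE in ne.
have [[s' ->]|[s' ->]] := eparam_other X s nij ki kj e't ne; by rewrite ?v1 ?v2 mulr0.
Qed.

Lemma elt_grad_vcurl t e i j k v phi : t \in T -> at_edge t e i j k -> smooth v -> smooth phi ->
  (forall s : R, v (X i + s *: (X k - X i)) = 0) ->
  (forall s : R, v (X j + s *: (X k - X j)) = 0) ->
  ipv (elt X t) (grad phi) (vcurl v) = - (orient X t e *
    segint (fun x => ((X j - X i).1 * pd ord0 phi x + (X j - X i).2 * pd ord_max phi x) * v x) (X i) (X j)).
Proof.
move=> tT te sv sphi v1 v2; have [D0 ->] := at_edge_elt tr tT te.
have [ij ki kj eE tE] := te.
have E := green_edge D0 sphi sv v1 v2.
have oE' : orient X t e = Num.sg (tdet (X i) (X j) (X k)) by rewrite eE tE orientE.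
have sg2 : orient X t e * orient X t e = 1.
  by rewrite oE' -expr2 sqr_sg D0.
have := congr1 (fun z => orient X t e * z) E.
by rewrite -oE' mulrA sg2 mul1r mulrN => ->.
Qed.

Lemma orient_sq t e i j k : t \in T -> at_edge t e i j k -> `|orient X t e| = 1.
Proof.
move=> tT te; have [D0 _] := at_edge_elt tr tT te; have [ij ki kj eE tE] := te.
by rewrite eE tE orientE // normr_sg D0.
Qed.

Lemma grad_error_L2v : L2v Om d.
Proof. by apply: L2vB => //; exact: exact_grad_L2v. Qed.

Definition local_err t : R := sqv (elt X t) d.

(** Half of the norm [P] of the polynomial part is absorbed in the left-hand
    side: the parameters of Young's inequality are chosen for that. *)
Lemma curl_arith (C h2 P N Z E V D0 D1 icv izv : R) : 0 < C -> 0 < h2 ->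
  P <= C * (icv - izv) ->
  `|icv| <= (h2 / (8 * C ^+ 2))^-1 * E + h2 / (8 * C ^+ 2) * (D0 + D1) ->
  D0 <= C / h2 * P -> D1 <= C / h2 * P ->
  `|izv| <= 4 * C * Z + (4 * C)^-1 * V -> V <= P -> N <= 2 * Z + 2 * P ->
  0 <= E -> 0 <= Z ->
  h2 * N <= (32 * C ^+ 3 + 16 * C ^+ 2 + 2) * (E + h2 * Z).
Proof.
move=> C0 h0 PC hc d0 d1 hz VP NP E0 Z0.
have yc : C * icv <= 8 * C ^+ 3 / h2 * E + P / 4.
  apply: (@le_trans _ _ (C * ((h2 / (8 * C ^+ 2))^-1 * E + h2 / (8 * C ^+ 2) * (C / h2 * P + C / h2 * P)))).
    rewrite ler_pM2l //; apply: le_trans (ler_norm _) _; apply: le_trans hc _.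
    by rewrite lerD2l ler_pM2l ?lerD // divr_gt0 // mulr_gt0 // exprn_gt0.
  by rewrite le_eqVlt; apply/orP; left; apply/eqP; field; rewrite ?gt_eqF.
have yz : - (C * izv) <= 4 * C ^+ 2 * Z + P / 4.
  apply: (@le_trans _ _ (C * (4 * C * Z + (4 * C)^-1 * P))).
    rewrite -mulrN ler_pM2l //; apply: le_trans (ler_norm _) _; rewrite normrN.
    by apply: le_trans hz _; rewrite lerD2l ler_pM2l // invr_gt0 mulr_gt0.
  by rewrite le_eqVlt; apply/orP; left; apply/eqP; field; rewrite ?gt_eqF.
have PP : P <= 2 * (8 * C ^+ 3 / h2 * E) + 8 * C ^+ 2 * Z.
  by move: PC yc yz; rewrite mulrBr; lra.
have hP : h2 * P <= 16 * C ^+ 3 * E + 8 * C ^+ 2 * (h2 * Z).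
  apply: le_trans (ler_wpM2l (ltW h0) PP) _.
  by rewrite le_eqVlt; apply/orP; left; apply/eqP; field; rewrite gt_eqF.
have hN := ler_wpM2l (ltW h0) NP.
have hZ0 : 0 <= h2 * Z by rewrite mulr_ge0 // ltW.
have m1 : 0 <= C ^+ 3 * (h2 * Z) by rewrite mulr_ge0 // exprn_ge0 // ltW.
have m2 : 0 <= C ^+ 2 * E by rewrite mulr_ge0 // exprn_ge0 // ltW.
have -> : (32 * C ^+ 3 + 16 * C ^+ 2 + 2) * (E + h2 * Z) =
  32 * (C ^+ 3 * E) + 16 * (C ^+ 2 * E) + 2 * E + 32 * (C ^+ 3 * (h2 * Z)) +
  16 * (C ^+ 2 * (h2 * Z)) + 2 * (h2 * Z) by ring.
move: hN hP; rewrite mulrDr !(mulrCA h2) -!mulrA; lra.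
Qed.

Section CurlBound.
Context (n : nat) (C : R) (C0 : 0 < C) (hC : elt_bubble_bound n c1 C).

(** The bubble function that localizes the polynomial part of the curl is
    orthogonal, through its rotated gradient, to the gradient of [u]. *)
Lemma curl_bound t (q : sfield R) : t \in T -> is_poly n q ->
  hsize X t ^+ 2 * ip (elt X t) (c t) (c t) <=
  (32 * C ^+ 3 + 16 * C ^+ 2 + 2) * (local_err t +
    hsize X t ^+ 2 * ip (elt X t) (fun x => c t x - q x) (fun x => c t x - q x)).
Proof.
move=> tT pq; have [e [i [j [k te]]]] := elt_has_edge tr tT.
have sh := at_edge_shape tr sr c10 tT te; have [D0 eE] := at_edge_elt tr tT te.
have [v [sv v0]] := hC sh pq; rewrite -eE => qv vv pv.
have v1 (s : R) : v (X i + s *: (X k - X i)) = 0 by case: (v0 s).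
have v2 (s : R) : v (X j + s *: (X k - X j)) = 0 by case: (v0 s).
have v3 (s : R) : v (X i + s *: (X j - X i)) = 0 by case: (v0 s).
have [h0 _ _ _ _] := sh; have h2 : 0 < hsize X t ^+ 2 by rewrite exprn_gt0.
have Lv : L2 (elt X t) v by exact: elt_smooth_L2.
have Lq : L2 (elt X t) q by apply: elt_smooth_L2 => //; exact: smooth_poly pq.
have Lc := curl_L2 tT.
have cv : ip (elt X t) (c t) v = ipv (elt X t) d (vcurl v).
  rewrite (green_one_edge tT te sv v1 v2).
  have -> : ipE X e (ttrace X t psi e) v = 0.
    have [ij _ _ eE' _] := te.
    rewrite /ipE /Rintegral integral0_eq ?mulr0 // => s _.
    by rewrite /eparam eE' ept0 // ept1 // v3 mulr0.
  rewrite mulr0 addr0 /d ipvBl //; [|exact: elt_L2v|apply: elt_L2v => //; exact: exact_grad_L2v|apply: vcurl_L2v => //; exact: bE].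
  (* the exact gradient is orthogonal to the rotated gradient of [v] *)
  have -> : ipv (elt X t) G (vcurl v) = 0; last by rewrite subr0.
  apply: (@H10_density _ Om (fun _ g => ipv (elt X t) g (vcurl v)) u) => //.
    apply: l2_functional_grad => //; first exact: (elt_sub pOm tr).
    by apply: vcurl_L2v => //; exact: bE.
  move=> phi [sphi _ _]; rewrite (elt_grad_vcurl tT te sv sphi v1 v2).
  by rewrite segint0 ?mulr0 ?oppr0 // => s _; rewrite v3 mulr0.
set P := ip (elt X t) q q in qv vv pv *.
set N := ip (elt X t) (c t) (c t).
set Z := ip _ (fun x => c t x - q x) _.
have Ld : L2v (elt X t) d by apply: elt_L2v => //; exact: grad_error_L2v.
have Lcq : L2 (elt X t) (fun x => c t x - q x) by exact: L2B.
have C4 : 0 < 4 * C by rewrite mulr_gt0.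
have e2 : 0 < hsize X t ^+ 2 / (8 * C ^+ 2) by rewrite divr_gt0 // mulr_gt0 // exprn_gt0.
apply: (curl_arith C0 h2 (icv := ip (elt X t) (c t) v)
  (izv := ip (elt X t) (fun x => c t x - q x) v) (V := ip (elt X t) v v) _ _ (pv ord0) (pv ord_max)) => //.
- by rewrite (ipBl (mE t)) // opprB addrC subrK.
- rewrite cv; exact: (vcurl_young (@oE t) (bE tT) e2 Ld sv).
- exact: (ip_young (mE t) C4 Lcq Lv).
- have := ip_normD (mE t) Lcq Lq; congr (_ <= _).
  by apply: eq_ip => // x _; rewrite subrK.
- exact: sqv_ge0.
- exact: ip_ge0.
Qed.

End CurlBound.
(** The same absorption, with three products to estimate; [H] bounds the
    squared mesh size. *)
Lemma residual_arith (C H h2 P N Z E U V D idv iuv izv : R) : 0 < C -> 0 < h2 -> h2 <= H ->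
  P <= C * (idv - iuv - izv) ->
  `|idv| <= 8 * C * E + (8 * C)^-1 * V ->
  `|iuv| <= (h2 / (8 * C ^+ 2))^-1 * U + h2 / (8 * C ^+ 2) * D -> D <= C / h2 * P ->
  `|izv| <= 8 * C * Z + (8 * C)^-1 * V -> V <= P -> N <= 2 * Z + 2 * P ->
  0 <= E -> 0 <= U -> 0 <= Z ->
  h2 * N <= (32 * C ^+ 2 * H + 32 * C ^+ 3 + 32 * C ^+ 2 + 2) * (E + U + h2 * Z).
Proof.
move=> C0 h0 hH PC hd hu DP hz VP NP E0 U0 Z0.
have yd (y x : R) : `|x| <= 8 * C * y + (8 * C)^-1 * V -> C * `|x| <= 8 * C ^+ 2 * y + P / 8.
  move=> hx; apply: (@le_trans _ _ (C * (8 * C * y + (8 * C)^-1 * P))).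
    rewrite ler_pM2l //; apply: le_trans hx _; rewrite lerD2l ler_pM2l // invr_gt0 mulr_gt0 //.
  by rewrite le_eqVlt; apply/orP; left; apply/eqP; field; rewrite ?gt_eqF.
have y1 := yd _ _ hd; have y2 := yd _ _ hz.
have y3 : C * `|iuv| <= 8 * C ^+ 3 / h2 * U + P / 8.
  apply: (@le_trans _ _ (C * ((h2 / (8 * C ^+ 2))^-1 * U + h2 / (8 * C ^+ 2) * (C / h2 * P)))).
    rewrite ler_pM2l //; apply: le_trans hu _.
    by rewrite lerD2l ler_pM2l // divr_gt0 // mulr_gt0 // exprn_gt0.
  by rewrite le_eqVlt; apply/orP; left; apply/eqP; field; rewrite ?gt_eqF.
have PP : P <= 2 * (8 * C ^+ 2 * E + 8 * C ^+ 3 / h2 * U + 8 * C ^+ 2 * Z).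
  have P0 : C * (idv - iuv - izv) <= C * `|idv| + C * `|iuv| + C * `|izv|.
    rewrite -!mulrDr ler_pM2l //; have := ler_norm idv; have := ler_norm (- iuv).
    by have := ler_norm (- izv); rewrite !normrN; lra.
  have Pp : 0 <= 8 * C ^+ 2 * E + 8 * C ^+ 3 / h2 * U + 8 * C ^+ 2 * Z.
    by rewrite !addr_ge0 // mulr_ge0 // ?divr_ge0 ?mulr_ge0 ?exprn_ge0 // ltW.
  have := le_trans PC P0; lra.
have hP : h2 * P <= 16 * (C ^+ 2 * (h2 * E)) + 16 * (C ^+ 3 * U) + 16 * (C ^+ 2 * (h2 * Z)).
  apply: le_trans (ler_wpM2l (ltW h0) PP) _.
  by rewrite le_eqVlt; apply/orP; left; apply/eqP; field; rewrite gt_eqF.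
have hN := ler_wpM2l (ltW h0) NP.
have hE : h2 * E <= H * E by rewrite ler_wpM2r.
have hE' : C ^+ 2 * (h2 * E) <= C ^+ 2 * (H * E) by rewrite ler_wpM2l ?exprn_ge0 // ltW.
have H0 : 0 <= H by exact: le_trans (ltW h0) hH.
have hZ0 : 0 <= h2 * Z by rewrite mulr_ge0 // ltW.
have K2 : 0 <= C ^+ 2 by rewrite exprn_ge0 // ltW.
have K3 : 0 <= C ^+ 3 by rewrite exprn_ge0 // ltW.
pose K1 := C ^+ 2 * H; have K10 : 0 <= K1 by rewrite mulr_ge0.
have -> : (32 * C ^+ 2 * H + 32 * C ^+ 3 + 32 * C ^+ 2 + 2) * (E + U + h2 * Z) =
  32 * (C ^+ 2 * (H * E)) + 32 * (C ^+ 3 * E) + 32 * (C ^+ 2 * E) + 2 * E +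
  (32 * (K1 * U) + 32 * (C ^+ 3 * U) + 32 * (C ^+ 2 * U) + 2 * U) +
  (32 * (K1 * (h2 * Z)) + 32 * (C ^+ 3 * (h2 * Z)) + 32 * (C ^+ 2 * (h2 * Z)) + 2 * (h2 * Z)).
  by rewrite /K1; ring.
have p1 := mulr_ge0 K3 E0; have p2 := mulr_ge0 K2 E0; have p3 := mulr_ge0 K10 U0.
have p4 := mulr_ge0 K2 U0; have p5 := mulr_ge0 K10 hZ0; have p6 := mulr_ge0 K3 hZ0.
clear PP y1 y2 y3 yd hd hu hz PC DP; clearbody K1.
move: hN; rewrite mulrDr !(mulrCA h2) => hN; lra.
Qed.

Section ResidualBound.
Context (n : nat) (C : R) (C0 : 0 < C) (hC : elt_bubble_bound n c1 C).
Context (H : R) (hH : forall t, t \in T -> hsize X t ^+ 2 <= H).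

(** The component [i] of [grad u - grad u_h], tested with [v], becomes the
    product of [u - u_h] and a derivative of [v]: this is where the factor
    [h^2] of the estimator turns into the norm of [u - u_h]. *)
Lemma residual_bound t (uh r q : sfield R) m i : t \in T -> L2 Om uh -> is_poly m r ->
  {ae mu2, forall x, elt X t x -> uh x = r x} -> is_poly n q ->
  let res := fun x => (psi x - wgrad (elt X t) uh x) i ord0 in
  L2 (elt X t) res /\
  hsize X t ^+ 2 * ip (elt X t) res res <=
  (32 * C ^+ 2 * H + 32 * C ^+ 3 + 32 * C ^+ 2 + 2) * (local_err t +
    ip (elt X t) (fun x => u x - uh x) (fun x => u x - uh x) +
    hsize X t ^+ 2 * ip (elt X t) (fun x => res x - q x) (fun x => res x - q x)).
Proof.
move=> tT Luh pr uhr pq res; have [e [i0 [j [k te]]]] := elt_has_edge tr tT.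
have sh := at_edge_shape tr sr c10 tT te; have [D0 eE] := at_edge_elt tr tT te.
have Lu : L2 Om u by case: Hu.
have Luht : L2 (elt X t) uh by exact: elt_L2.
have Lut : L2 (elt X t) u by exact: elt_L2.
have sr' := smooth_poly pr.
have Lr : L2 (elt X t) r by exact: elt_smooth_L2.
have [[LW _] aer] := wgrad_smooth i (@oE t) (bE tT) Luht sr' uhr.
have Lpt := elt_L2v tT Lpsi; have Lres : L2 (elt X t) res.
  apply: (L2_ext (v := fun x => psi x i ord0 - wgrad (elt X t) uh x i ord0)) => [x _|].
    by rewrite /res !mxE.
  exact: (L2B (mE t) (Lpt i) (LW i)).
split => //.
have [v [sv v0]] := hC sh pq; rewrite -eE => qv vv pv.
have [h0 _ _ _ _] := sh; have h2 : 0 < hsize X t ^+ 2 by rewrite exprn_gt0.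
have Lv : L2 (elt X t) v by exact: elt_smooth_L2.
have Lpv : L2 (elt X t) (pd i v) by apply: elt_smooth_L2 => //; exact: smooth_pd.
have Lq : L2 (elt X t) q by apply: elt_smooth_L2 => //; exact: smooth_poly pq.
have Ld : L2 (elt X t) (fun x => d x i ord0) by apply: (elt_L2v tT grad_error_L2v).
have LG : L2 (elt X t) (fun x => G x i ord0) by apply: (elt_L2v tT exact_grad_L2v).
have Luu : L2 (elt X t) (fun x => u x - uh x) by exact: L2B.
have Lrq : L2 (elt X t) (fun x => res x - q x) by exact: L2B.
have Lpr : L2 (elt X t) (pd i r) by apply: elt_smooth_L2 => //; exact: smooth_pd.
have aev : {ae mu2, forall x, elt X t x -> v x = v x} by apply: (ae_imp (mu := mu2) uhr).
have aepv : {ae mu2, forall x, elt X t x -> pd i v x = pd i v x} by apply: (ae_imp (mu := mu2) uhr).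
(* [v] vanishes on the boundary of the element, so that both gradients can be
   moved to [v] *)
have Gv : ip (elt X t) (fun x => G x i ord0) v = - ip (elt X t) u (pd i v).
  apply/eqP; rewrite -addr_eq0; apply/eqP.
  apply: (@H10_density _ Om (fun w g => ip (elt X t) (fun x => g x i ord0) v + ip (elt X t) w (pd i v)) u) => //.
    by apply: l2_functionalD; [apply: l2_functional_comp|apply: l2_functional_fun] => //;
      exact: (elt_sub pOm tr).
  move=> phi [sphi _ _].
  have -> : ip (elt X t) (fun x => grad phi x i ord0) v = ip (elt X t) (pd i phi) v.
    by apply: eq_ip => // x _; rewrite mxE.
  by rewrite eE (ibp_bubble D0 i sphi sv v0) addNr.
have Wv : ip (elt X t) (fun x => wgrad (elt X t) uh x i ord0) v = - ip (elt X t) uh (pd i v).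
  have -> : ip (elt X t) (fun x => wgrad (elt X t) uh x i ord0) v = ip (elt X t) (pd i r) v.
    exact: (ae_eq_ip (mE t) (LW i) Lpr Lv Lv aer aev).
  rewrite eE (ibp_bubble D0 i sr' sv v0) -eE; congr (- _); apply/esym.
  exact: (ae_eq_ip (mE t) Luht Lr Lpv Lpv uhr aepv).
have rv : ip (elt X t) res v = ip (elt X t) (fun x => d x i ord0) v - ip (elt X t) (fun x => u x - uh x) (pd i v).
  have -> : ip (elt X t) res v = ip (elt X t) (fun x => psi x i ord0) v - ip (elt X t) (fun x => wgrad (elt X t) uh x i ord0) v.
    by rewrite -(ipBl (mE t)) //; apply: eq_ip => // x _; rewrite /res !mxE.
  have -> : ip (elt X t) (fun x => d x i ord0) v = ip (elt X t) (fun x => psi x i ord0) v - ip (elt X t) (fun x => G x i ord0) v.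
    by rewrite -(ipBl (mE t)) //; apply: eq_ip => // x _; rewrite /d !mxE.
  by rewrite (ipBl (mE t)) // Gv Wv; ring.
have C8 : 0 < 8 * C by rewrite mulr_gt0.
have e2 : 0 < (hsize X t ^+ 2 / (8 * C ^+ 2))^-1 by rewrite invr_gt0 divr_gt0 // mulr_gt0 // exprn_gt0.
apply: (residual_arith C0 h2 (hH tT) (P := ip (elt X t) q q) (idv := ip (elt X t) (fun x => d x i ord0) v)
  (iuv := ip (elt X t) (fun x => u x - uh x) (pd i v))
  (izv := ip (elt X t) (fun x => res x - q x) v) (V := ip (elt X t) v v) _ _ _ (pv i)) => //.
- by rewrite -rv (ipBl (mE t)) // opprB addrC subrK.
- apply: le_trans (ip_young (mE t) C8 Ld Lv) _; rewrite lerD2r ler_pM2l //; exact: le_sqv.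
- by have := ip_young (mE t) e2 Luu Lpv; rewrite invrK.
- exact: (ip_young (mE t) C8 Lrq Lv).
- have := ip_normD (mE t) Lrq Lq; congr (_ <= _).
  by apply: eq_ip => // x _; rewrite subrK.
- exact: sqv_ge0.
- exact: ip_ge0.
- exact: ip_ge0.
Qed.

End ResidualBound.
(** The weighted norm [W] of the edge polynomial replaces its norm [PQ] in the
    absorption. The factor [he / L] is at most 1. *)
Lemma edge_arith (C L he W PQ B NJ Z M dqj djb : R) : 0 < C -> 0 < L -> 0 <= he -> he <= L ->
  PQ <= C * W -> B <= PQ -> W = dqj + djb ->
  `|dqj| <= 4 * C * Z + (4 * C)^-1 * B ->
  L * `|djb| <= 2 * (L * W / 8) + 16 * C / L * M ->
  NJ <= 2 * Z + 2 * PQ -> 0 <= Z -> 0 <= M ->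
  he * L * NJ <= (64 * C ^+ 2 + 2) * (he * L * Z + M).
Proof.
move=> C0 L0 he0 heL PW BP WE hq hj NP Z0 M0.
have y1 : dqj <= 4 * C * Z + W / 4.
  apply: le_trans (ler_norm _) _; apply: le_trans hq _; rewrite lerD2l.
  rewrite ler_pdivrMl ?mulr_gt0 //; apply: le_trans BP _; apply: le_trans PW _.
  by rewrite le_eqVlt; apply/orP; left; apply/eqP; field.
have y2 : djb <= W / 4 + 16 * C / L ^+ 2 * M.
  apply: le_trans (ler_norm _) _; rewrite -(ler_pM2l L0); apply: le_trans hj _.
  by rewrite le_eqVlt; apply/orP; left; apply/eqP; field; rewrite gt_eqF.
have y3 : W <= 2 * (4 * C * Z + 16 * C / L ^+ 2 * M) by lra.
have hL0 : 0 <= he * L by rewrite mulr_ge0 // ltW.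
have y4 : he * L * W <= 8 * C * (he * L * Z) + 32 * C * M.
  apply: le_trans (ler_wpM2l hL0 y3) _.
  have -> : he * L * (2 * (4 * C * Z + 16 * C / L ^+ 2 * M)) =
    8 * C * (he * L * Z) + 32 * C * M * (he / L) by field; rewrite gt_eqF.
  by rewrite lerD2l ler_piMr ?mulr_ge0 ?(ltW C0) // ler_pdivrMr // mul1r.
have y5 : he * L * PQ <= 8 * (C ^+ 2 * (he * L * Z)) + 32 * (C ^+ 2 * M).
  apply: (@le_trans _ _ (C * (he * L * W))); first by rewrite mulrCA ler_wpM2l.
  apply: le_trans (ler_wpM2l (ltW C0) y4) _.
  by rewrite le_eqVlt; apply/orP; left; apply/eqP; ring.
have y6 := ler_wpM2l hL0 NP.
have hZ0 : 0 <= he * L * Z by rewrite mulr_ge0.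
have K2 : 0 <= C ^+ 2 by rewrite exprn_ge0 // ltW.
have p1 := mulr_ge0 K2 hZ0; have p2 := mulr_ge0 K2 M0.
clear y1 y2 y3 y4 hq hj.
have -> : (64 * C ^+ 2 + 2) * (he * L * Z + M) =
  64 * (C ^+ 2 * (he * L * Z)) + 2 * (he * L * Z) + 64 * (C ^+ 2 * M) + 2 * M by ring.
by move: y6; rewrite mulrDr !(mulrCA (he * L)) => y6; lra.
Qed.

Section EdgeBound.
Context (m : nat) (C : R) (C0 : 0 < C) (hC : edge_bubble_bound m c1 C).

Let elen e := eucl_dist (ept X e 1) (ept X e 0).

Lemma elen_gt0 t e i j k : t \in T -> at_edge t e i j k -> 0 < elen e.
Proof.
move=> tT te; have [D0 _] := at_edge_elt tr tT te; have [ij _ _ eE _] := te.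
rewrite /elen eE ept0 // ept1 // lt_neqAle eucl_dist_ge0 andbT eq_sym.
apply: contraNneq D0 => l0.
have := coord1_le_dist (X j) (X i); have := coord2_le_dist (X j) (X i).
rewrite l0 !normr_le0 => /eqP h2 /eqP h1.
by rewrite /tdet /cross /= h1 h2 !mul0r subrr.
Qed.

Lemma L2E_sqi e w : 0 < elen e -> L2E X e w -> sqi mu itv01 (w \o eparam X e).
Proof.
move=> l0 [mw fw]; split => //; move: fw; rewrite /sqL2E -/(elen e).
rewrite (_ : (\int[mu]_(s in `[0%R, 1%R]) _)%E = (\int[mu]_(s in itv01) (((w \o eparam X e) s) ^+ 2)%:E)%E) //.
have := @integral_ge0 _ _ R mu itv01 (fun s => (((w \o eparam X e) s) ^+ 2)%:E).
case: (\int[mu]_(s in itv01) _)%E => [r _ _|_|h]; first exact: ltry.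
  by rewrite gt0_muley // lte_fin.
by have := h (fun s _ => (sqr_ge0 _ : (0 <= _%:E)%E)).
Qed.

Let bub q i j (s : R) : R := s * (1 - s) * edge_fun q (X i) (X j) s.
Let wt q i j : R := dp mu itv01 (edge_fun q (X i) (X j)) (bub q i j).

Lemma edge_green t e i j k v (b : R -> R) : t \in T -> at_edge t e i j k -> smooth v ->
  (forall s : R, v (X i + s *: (X j - X i)) = b s) ->
  (forall s : R, v (X i + s *: (X k - X i)) = 0) ->
  (forall s : R, v (X j + s *: (X k - X j)) = 0) ->
  elen e * dp mu itv01 (ttrace X t psi e \o eparam X e) b =
  orient X t e * (ip (elt X t) (c t) v - ipv (elt X t) psi (vcurl v)).
Proof.
move=> tT te sv v0 v1 v2; rewrite (green_one_edge tT te sv v1 v2) [X in X - _]addrC addrK mulrA.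
have := orient_sq tT te => o1.
rewrite -expr2 -(real_normK (num_real (orient X t e))) o1 expr1n mul1r /ipE; congr (_ * _).
apply: eq_dp => // s _; rewrite -v0 /eparam; have [ij _ _ -> _] := te.
by rewrite ept0 // ept1.
Qed.

(** The two parameters give each side of the edge an eighth of [L W]. *)
Lemma edge_side_arith (C' L h2 W N E V D0 D1 ic iv : R) : 0 < C' -> 0 < L -> 0 < h2 ->
  `|ic| <= 16 * C' * h2 / L * N + (16 * C' * h2 / L)^-1 * V ->
  `|iv| <= (L / (32 * C'))^-1 * E + L / (32 * C') * (D0 + D1) ->
  V <= C' * h2 * W -> D0 <= C' * W -> D1 <= C' * W ->
  `|ic - iv| <= L * W / 8 + 16 * C' / L * (h2 * N + 2 * E).
Proof.
move=> C0' L0 h0 hc hv VW d0 d1; apply: le_trans (ler_normB _ _) _.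
have a : 0 < 16 * C' * h2 / L by rewrite divr_gt0 // !mulr_gt0.
have b : 0 < L / (32 * C') by rewrite divr_gt0 // mulr_gt0.
apply: (@le_trans _ _ ((16 * C' * h2 / L * N + (16 * C' * h2 / L)^-1 * (C' * h2 * W)) +
  ((L / (32 * C'))^-1 * E + L / (32 * C') * (C' * W + C' * W)))).
  apply: lerD; first by apply: le_trans hc _; rewrite lerD2l ler_pM2l // invr_gt0.
  by apply: le_trans hv _; rewrite lerD2l ler_pM2l // lerD.
by rewrite le_eqVlt; apply/orP; left; apply/eqP; field; rewrite ?gt_eqF.
Qed.

(** The part of a jump estimate that concerns one of the adjacent triangles. *)
Lemma edge_side t e i j k q : t \in T -> at_edge t e i j k -> is_poly m q ->
  exists v, [/\ smooth v,
    forall s : R, [/\ v (X i + s *: (X j - X i)) = bub q i j s,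
      v (X i + s *: (X k - X i)) = 0 & v (X j + s *: (X k - X j)) = 0] &
    `|ip (elt X t) (c t) v - ipv (elt X t) d (vcurl v)| <=
    elen e * wt q i j / 8 + 16 * C / elen e *
      (hsize X t ^+ 2 * ip (elt X t) (c t) (c t) + 2 * local_err t)].
Proof.
move=> tT te pq; have sh := at_edge_shape tr sr c10 tT te; have [D0 eE] := at_edge_elt tr tT te.
have [_ Hv] := hC pq (X i) (X j); have [v [sv v0 vv pv]] := Hv _ _ sh.
exists v; split => //.
have L0 := elen_gt0 tT te.
have [h0 _ _ _ _] := sh; have h2 : 0 < hsize X t ^+ 2 by rewrite exprn_gt0.
have Lv : L2 (elt X t) v by exact: elt_smooth_L2.
have Lc := curl_L2 tT.
have Ld : L2v (elt X t) d by apply: elt_L2v => //; exact: grad_error_L2v.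
rewrite -eE in vv pv.
have a : 0 < 16 * C * hsize X t ^+ 2 / elen e by rewrite divr_gt0 // !mulr_gt0.
have b : 0 < elen e / (32 * C) by rewrite divr_gt0 // mulr_gt0.
exact: (edge_side_arith C0 L0 h2 (ip_young (mE t) a Lc Lv)
  (vcurl_young (@oE t) (bE tT) b Ld sv) vv (pv ord0) (pv ord_max)).
Qed.

(** Two adjacent triangles induce opposite orientations on their common edge
    and a test function vanishes on the boundary: in both cases the gradient
    of a function in H^1_0 has no tangential jump. *)
Lemma edge_bound e (q : sfield R) : e \in edges T -> is_poly m q ->
  let J := tjump X T psi e \o eparam X e in
  let Q := q \o eparam X e in
  [/\ 0 < elen e, sqi mu itv01 J &
  hsize X e * elen e * dp mu itv01 J J <= (64 * C ^+ 2 + 2) *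
    (hsize X e * elen e * dp mu itv01 (fun s => J s - Q s) (fun s => J s - Q s) +
     \sum_(t in [set t in T | e \subset t]%SET)
       (hsize X t ^+ 2 * ip (elt X t) (c t) (c t) + 2 * local_err t))].
Proof.
move=> eT pq J Q.
have [e2 [t0 t0T et0]] : #|e| == 2 /\ exists2 t, t \in T & e \subset t.
  by move: eT; rewrite inE => /andP[-> /existsP[t /andP[tT et]]]; split => //; exists t.
have edge_of t : e \subset t -> e \in edges [set t]%SET by rewrite in_edges1 e2.
have [i [j [k0 te0]]] := edgeP tr t0T (edge_of _ et0).
have L0 := elen_gt0 t0T te0.
have [ij _ _ eE _] := te0.
have sameij t : t \in T -> e \subset t -> exists k, at_edge t e i j k.
  move=> tT et; have [i' [j' [k te]]] := edgeP tr tT (edge_of _ et).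
  have [ij' _ _ eE' _] := te.
  have E : [:: i; j] = [:: i'; j'] by rewrite -!enum_pair // -eE -eE'.
  by case: E te => -> -> te; exists k.
have QE : Q = edge_fun q (X i) (X j).
  by apply/funext => s; rewrite /Q /edge_fun /= /eparam eE ept0 // ept1.
have [PW _] := hC pq (X i) (X j); rewrite -/(bub q i j) -/(wt q i j) in PW.
have cq : continuous q by apply: smooth_cont; exact: smooth_poly pq.
have cQ : continuous Q by rewrite QE; exact: line_continuous.
have sQ : sqi mu itv01 Q by exact: continuous_sqi_itv.
have mI : measurable (itv01 : set (measurableTypeR R)) by exact: measurable_itv.
have sb : sqi mu itv01 (bub q i j).
  apply: continuous_sqi_itv => s; apply: (@continuousM _ _ (fun s : R => s * (1 - s)) (edge_fun q (X i) (X j))).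
    apply: (@continuousM _ _ (fun s : R => s) (fun s : R => 1 - s)); first exact: cvg_id.
    by apply: cvgB; [exact: cvg_cst|exact: cvg_id].
  by have := cQ s; rewrite QE.
have BQ : dp mu itv01 (bub q i j) (bub q i j) <= dp mu itv01 Q Q.
  apply: (le_dp_ae mI) => //; apply: aeW => s; rewrite /itv01 /= in_itv /= => /andP[s0 s1].
  rewrite /bub -QE exprMn ler_piMl ?sqr_ge0 // expr_le1 ?mulr_ge0 ?subr_ge0 //.
  by rewrite mulr_ile1 // ?subr_ge0 //; lra.
set S := [set t in T | e \subset t]%SET.
have SP t : t \in S -> t \in T /\ e \subset t by rewrite inE => /andP[].
set M := \sum_(t in S) _.
have term0 t : 0 <= hsize X t ^+ 2 * ip (elt X t) (c t) (c t) + 2 * local_err t.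
  by rewrite addr_ge0 // mulr_ge0 ?sqr_ge0 ?ip_ge0 ?sqv_ge0.
have M0 : 0 <= M by apply: sumr_ge0.
have trS t : t \in S -> sqi mu itv01 (ttrace X t psi e \o eparam X e).
  by move=> /SP[tT et]; apply: L2E_sqi => //; have [h _] := ttraceP tT; apply: h; exact: edge_of.
suff [sJ key] : sqi mu itv01 J /\ elen e * `|dp mu itv01 J (bub q i j)| <=
    2 * (elen e * wt q i j / 8) + 16 * C / elen e * M.
  split => //.
  have sJQ := sqiB mI sJ sQ.
  have heL : hsize X e <= elen e by rewrite /elen eE ept0 // ept1 // hsize_edge.
  have C4 : 0 < 4 * C by rewrite mulr_gt0.
  apply: (edge_arith C0 L0 (hsize_ge0 X e) heL PW (B := dp mu itv01 (bub q i j) (bub q i j))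
    (dqj := - dp mu itv01 (fun s => J s - Q s) (bub q i j)) _ _ _ key).
  - by rewrite -QE.
  - by rewrite (dpBl mI) // opprB subrK QE.
  - by rewrite normrN; apply: (dp_young mI).
  - have := dp_normD mI sJQ sQ; rewrite -QE; congr (_ <= _).
    by apply: eq_dp => // s _; rewrite subrK.
  - exact: dp_ge0.
  - exact: M0.
have W0 : 0 <= wt q i j.
  by rewrite -(pmulr_rge0 _ C0); apply: le_trans PW; exact: dp_ge0.
have triv : (forall x, tjump X T psi e x = 0) -> sqi mu itv01 J /\ elen e * `|dp mu itv01 J (bub q i j)| <=
    2 * (elen e * wt q i j / 8) + 16 * C / elen e * M.
  move=> h; have s0 : sqi mu itv01 (fun=> 0 : R) by apply: continuous_sqi_itv; exact: cst_continuous.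
  have J0 s : J s = 0 by rewrite /J /= h.
  split; first by apply: sqi_ext s0 => s _; rewrite J0.
  have -> : dp mu itv01 J (bub q i j) = 0.
    by rewrite /dp /Rintegral integral0_eq // => s _; rewrite J0 mul0r.
  rewrite normr0 mulr0 addr_ge0 ?mulr_ge0 ?invr_ge0 //; exact: ltW.
have enumS := mem_enum S; have uniqS := enum_uniq S.
have MS : M = \sum_(t <- enum S) (hsize X t ^+ 2 * ip (elt X t) (c t) (c t) + 2 * local_err t).
  by rewrite big_enum.
have dens t v : t \in T -> smooth v -> l2_functional Om (fun _ g => ipv (elt X t) g (vcurl v)).
  move=> tT sv; apply: l2_functional_grad => //; first exact: (elt_sub pOm tr).
  by apply: vcurl_L2v => //; exact: bE.
have split_d t v : t \in T -> smooth v ->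
    ipv (elt X t) d (vcurl v) = ipv (elt X t) psi (vcurl v) - ipv (elt X t) G (vcurl v).
  move=> tT sv; rewrite /d ipvBl //; [exact: elt_L2v|apply: elt_L2v => //; exact: exact_grad_L2v|].
  by apply: vcurl_L2v => //; exact: bE.
move: (erefl (tjump X T psi e)); rewrite {2}/tjump -/S.
case ES : (enum S) => [|t [|t' [|t'' s]]] JE; try by apply: triv => x; rewrite JE.
- have tS : t \in S by rewrite -enumS ES inE.
  have [tT et] := SP t tS; have [k te] := sameij t tT et.
  have JE' : J = ttrace X t psi e \o eparam X e by rewrite /J JE.
  split; first by rewrite JE'; exact: trS.
  have [v [sv v0 vb]] := edge_side tT te pq.
  have v1 (s : R) : v (X i + s *: (X j - X i)) = bub q i j s by case: (v0 s).
  have v2 (s : R) : v (X i + s *: (X k - X i)) = 0 by case: (v0 s).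
  have v3 (s : R) : v (X j + s *: (X k - X j)) = 0 by case: (v0 s).
  have Gv : ipv (elt X t) G (vcurl v) = 0.
    apply: (H10_density oOm bOm Hu (dens t v tT sv)) => phi [sphi _ supp].
    rewrite (elt_grad_vcurl tT te sv sphi v2 v3) segint0 ?mulr0 ?oppr0 // => s /andP[s0 s1].
    (* the bubble vanishes at the endpoints, and [phi] on the open edge *)
    rewrite v1 /bub; have [->|sn0] := eqVneq s 0; first by rewrite !mul0r mulr0.
    have [->|sn1] := eqVneq s 1; first by rewrite subrr mulr0 mul0r mulr0.
    have s01 : 0 < s < 1 by rewrite !lt_neqAle s0 s1 eq_sym sn0 sn1.
    rewrite (tangential_derivative_eq0 (sphi 1%N) _ s01) ?mul0r // => r r01.
    apply: contrapT => /eqP nz.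
    have : Om (eparam X e r).
      apply: supp; apply: subset_closure; rewrite /= /eparam eE ept0 // ept1 //.
    apply: (boundary_edge_notin pOm tr tT (edge_of _ et)) => // t' t'T et'.
    have : t' \in enum S by rewrite enumS inE t'T.
    by rewrite ES inE => /eqP.
  have E := edge_green tT te sv v1 v2 v3.
  rewrite -JE' in E.
  have -> : elen e * `|dp mu itv01 J (bub q i j)| =
      `|ip (elt X t) (c t) v - ipv (elt X t) d (vcurl v)|.
    rewrite -{1}(gtr0_norm L0) -normrM E normrM (orient_sq tT te) mul1r.
    by rewrite split_d // Gv subr0.
  apply: le_trans vb _.
  have -> : M = hsize X t ^+ 2 * ip (elt X t) (c t) (c t) + 2 * local_err t.
    by rewrite MS ES big_seq1.
  rewrite lerD2r; have : 0 <= elen e * wt q i j by rewrite mulr_ge0 // ltW.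
  by move: (elen e * _) => z; lra.
- have tS : t \in S by rewrite -enumS ES !inE eqxx.
  have t'S : t' \in S by rewrite -enumS ES !inE eqxx orbT.
  have tt' : t != t' by move: uniqS; rewrite ES /= inE andbT.
  have [tT et] := SP t tS; have [k te] := sameij t tT et.
  have [t'T et'] := SP t' t'S; have [k' te'] := sameij t' t'T et'.
  have JE' : J = (fun s => (ttrace X t psi e \o eparam X e) s - (ttrace X t' psi e \o eparam X e) s).
    by rewrite /J JE.
  split; first by rewrite JE'; apply: (sqiB mI); exact: trS.
  have [v [sv v0 vb]] := edge_side tT te pq.
  have [w [sw w0 wb]] := edge_side t'T te' pq.
  have v1 (s : R) : v (X i + s *: (X j - X i)) = bub q i j s by case: (v0 s).
  have v2 (s : R) : v (X i + s *: (X k - X i)) = 0 by case: (v0 s).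
  have v3 (s : R) : v (X j + s *: (X k - X j)) = 0 by case: (v0 s).
  have w1 (s : R) : w (X i + s *: (X j - X i)) = bub q i j s by case: (w0 s).
  have w2 (s : R) : w (X i + s *: (X k' - X i)) = 0 by case: (w0 s).
  have w3 (s : R) : w (X j + s *: (X k' - X j)) = 0 by case: (w0 s).
  have opp := orient_opposite tr tT t'T tt' (edge_of _ et) (edge_of _ et').
  have Gv : ipv (elt X t) G (vcurl v) + ipv (elt X t') G (vcurl w) = 0.
    apply: (H10_density oOm bOm Hu (l2_functionalD (dens t v tT sv) (dens t' w t'T sw))) => phi [sphi _ supp].
    rewrite (elt_grad_vcurl tT te sv sphi v2 v3) (elt_grad_vcurl t'T te' sw sphi w2 w3) opp.
    rewrite mulNr opprK; apply/eqP; rewrite subr_eq0; apply/eqP; congr (_ * _).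
    by apply: eq_segint => s _; rewrite v1 w1.
  have E := edge_green tT te sv v1 v2 v3; have E' := edge_green t'T te' sw w1 w2 w3.
  have -> : elen e * `|dp mu itv01 J (bub q i j)| =
      `|(ip (elt X t) (c t) v - ipv (elt X t) d (vcurl v)) +
        (ip (elt X t') (c t') w - ipv (elt X t') d (vcurl w))|.
    have EJ : elen e * dp mu itv01 J (bub q i j) =
        elen e * dp mu itv01 (ttrace X t psi e \o eparam X e) (bub q i j) -
        elen e * dp mu itv01 (ttrace X t' psi e \o eparam X e) (bub q i j).
      by rewrite JE' (dpBl mI (trS _ tS) (trS _ t'S) sb) mulrBr.
    rewrite -{1}(gtr0_norm L0) -normrM EJ E E'.
    rewrite opp mulNr -opprD normrN -mulrDr normrM (orient_sq t'T te') mul1r.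
    rewrite !split_d //; congr (`| _ |).
    have -> : ipv (elt X t') G (vcurl w) = - ipv (elt X t) G (vcurl v).
      by apply/eqP; rewrite -addr_eq0 addrC Gv.
    move: (ip _ _ v) (ip _ _ w) (ipv _ psi (vcurl v)) (ipv _ psi (vcurl w)) (ipv _ G (vcurl v)) => *.
    by ring.
  apply: le_trans (ler_normD _ _) _; apply: le_trans (lerD vb wb) _.
  have -> : M = (hsize X t ^+ 2 * ip (elt X t) (c t) (c t) + 2 * local_err t) +
    (hsize X t' ^+ 2 * ip (elt X t') (c t') (c t') + 2 * local_err t').
    by rewrite MS ES big_cons big_seq1.
  rewrite [X in _ <= _ + X]mulrDr addrACA lerD2r.
  by rewrite mulr_natl.
Qed.

End EdgeBound.
End LocalBounds.

(** * The divergence of the flux error *)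

Section FluxDivergence.
Context {R : realType} (Om : set (pt R)) (A : pt R -> 'M[R]_2) (f u : sfield R).
Notation mu2 := (leb2 R).
Context (pOm : polygonal_domain Om) (cA : coefficient Om A).
Context (Lf : L2 Om f) (wu : weak_solution Om A f u).

Let oOm : open Om := Om_open pOm.
Let bOm : bounded_set Om := Om_bounded pOm.
Let mOm : measurable Om := Om_measurable pOm.
Let p : vfield R := fun x => A x *m wgrad Om u x.

Lemma exact_flux_L2v : L2v Om p.
Proof.
by case: wu => -[_ /wgradP[LG _] _] _; exact: (flux_L2v mOm cA LG).
Qed.

(** Test functions are admissible in the weak formulation. *)
Lemma exact_flux_wdiv : is_wdiv Om p (fun x => - f x).
Proof.
split; first exact: (L2N mOm Lf).
move=> phi tphi; have [sphi _ _] := tphi.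
have Lphi := test_L2 oOm bOm tphi.
have [Hphi hw] : H10 Om phi /\ forall i, {ae mu2, forall x, Om x -> wgrad Om phi x i ord0 = pd i phi x}.
  split=> [|i]; first exact: test_H10.
  have aer : {ae mu2, forall x, Om x -> phi x = phi x} by exact: aeW.
  by have [] := wgrad_smooth i oOm bOm Lphi sphi aer.
have [_ /(_ phi Hphi) E] := wu.
have [_ /wgradP[Lw _] _] := Hphi.
rewrite (ipNl mOm Lf Lphi) opprK -E.
have Lg := smooth_L2v oOm bOm sphi.
rewrite (ipvE mOm exact_flux_L2v Lg) (ipvE mOm exact_flux_L2v Lw).
have same i : ip Om (fun x => p x i ord0) (fun x => grad phi x i ord0) =
    ip Om (fun x => p x i ord0) (fun x => wgrad Om phi x i ord0).
  apply: (ae_eq_ip mOm (exact_flux_L2v i) (exact_flux_L2v i) (Lg i) (Lw i)).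
    exact: aeW.
  by apply: (ae_imp (mu := mu2) (hw i)) => x h Ox; rewrite h // mxE.
by congr (_ + _); exact: same.
Qed.

Lemma flux_error_wdiv (ph : vfield R) : Hdiv Om ph ->
  L2 Om (wdiv Om (fun x => p x - ph x)) /\
  {ae mu2, forall x, Om x -> wdiv Om (fun y => p y - ph y) x = - (f x + wdiv Om ph x)}.
Proof.
move=> [Lph /wdivP[Ld hd]]; have [Lnf hf] := exact_flux_wdiv.
have h : is_wdiv Om (fun x => p x - ph x) (fun x => - f x - wdiv Om ph x).
  split; first exact: (L2B mOm Lnf Ld).
  move=> phi tphi; have [sphi _ _] := tphi; have Lphi := test_L2 oOm bOm tphi.
  have Lg := smooth_L2v oOm bOm sphi.
  by rewrite (ipvBl oOm exact_flux_L2v Lph Lg) hf // hd // (ipBl mOm Lnf Ld Lphi) opprB opprK addrC.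
have hw := wdivP (ex_intro _ _ h); split; first by case: hw.
apply: (ae_imp (mu := mu2) (is_wdiv_unique oOm bOm hw h)) => x E Ox.
by rewrite E // opprD.
Qed.

End FluxDivergence.

Section WeightedNorms.
Context {R : realType}.
Notation mu := (@lebesgue_measure R).
Notation mu2 := (leb2 R).

(** The default value 0 is a polynomial too. *)
Lemma bestappr_poly (N : sfield R -> \bar R) n w : is_poly n (bestappr N n w).
Proof.
rewrite /bestappr; case: xgetP => [q _ []//|_].
exists (fun _ _ => 0) => x; rewrite big1 // => i _; rewrite big1 // => j _.
by rewrite !mul0r.
Qed.

Lemma sqL2_weight (D : set (pt R)) (k : R) (v : sfield R) : measurable D -> L2 D v ->
  sqL2 D (fun x => k * v x) = (k ^+ 2 * ip D v v)%:E.
Proof.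
move=> mD Lv; rewrite sqL2E_ip; last exact: (L2Z mD k Lv).
have LZ := L2Z mD k Lv.
by rewrite (ipZl mD k Lv LZ) ipC (ipZl mD k Lv Lv) mulrA.
Qed.

Lemma sqL2v_weight (D : set (pt R)) (k : R) (g : vfield R) : measurable D -> L2v D g ->
  sqL2v D (fun x => k *: g x) = (k ^+ 2 * sqv D g)%:E.
Proof.
move=> mD Lg.
have LZ : L2v D (fun x => k *: g x).
  by move=> i; apply: L2_ext (L2Z mD k (Lg i)) => x _; rewrite !mxE.
have E i : ip D (fun x => (k *: g x) i ord0) (fun x => (k *: g x) i ord0) =
    k ^+ 2 * ip D (fun x => g x i ord0) (fun x => g x i ord0).
  have L' := L2Z mD k (Lg i).
  have -> : ip D (fun x => (k *: g x) i ord0) (fun x => (k *: g x) i ord0) =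
      ip D (fun x => k * g x i ord0) (fun x => k * g x i ord0).
    by apply: eq_ip => // x _; rewrite !mxE.
  by rewrite (ipZl mD k (Lg i) L') ipC (ipZl mD k (Lg i) (Lg i)) mulrA.
by rewrite sqL2v_ip // !E -mulrDr.
Qed.

Lemma sqL2E_weight (nv : nat) (X : 'I_nv -> pt R) (e : {set 'I_nv}) (k : R) (w : sfield R) :
  0 <= k -> sqi mu itv01 (w \o eparam X e) ->
  sqL2E X e (fun x => Num.sqrt k * w x) =
  (k * eucl_dist (ept X e 1) (ept X e 0) * dp mu itv01 (w \o eparam X e) (w \o eparam X e))%:E.
Proof.
move=> k0 sw; rewrite /sqL2E.
have mI : measurable (itv01 : set (measurableTypeR R)) by exact: measurable_itv.
have sZ := sqiZ mI (Num.sqrt k) sw.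
have -> : (\int[mu]_(s in `[0%R, 1%R]) ((Num.sqrt k * w (eparam X e s)) ^+ 2)%:E)%E =
    (dp mu itv01 (fun s => Num.sqrt k * (w \o eparam X e) s) (fun s => Num.sqrt k * (w \o eparam X e) s))%:E.
  by rewrite -sqi_sqE.
rewrite (dpZl mI _ sw sZ) dpC (dpZl mI _ sw sw) mulrA -expr2 sqr_sqrtr // -EFinM.
by congr EFin; ring.
Qed.

End WeightedNorms.

Section Incidence.
Context (nv : nat) (T : {set {set 'I_nv}}).

Lemma edges_of (t e : {set 'I_nv}) : t \in T -> e \in edges [set t]%SET -> e \in edges T.
Proof.
move=> tT; rewrite in_edges1 inE => /andP[-> et]; apply/existsP; exists t.
by rewrite tT et.
Qed.

(** Both sides sum over incident pairs of a triangle and an edge. *)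
Lemma exchange_edges (V : nmodType) (F : {set 'I_nv} -> {set 'I_nv} -> V) :
  \sum_(t in T) \sum_(e in edges [set t]%SET) F t e =
  \sum_(e in edges T) \sum_(t in [set t in T | e \subset t]%SET) F t e.
Proof.
rewrite (exchange_big_dep (mem (edges T))) /=; last by move=> t e; exact: edges_of.
apply: eq_bigr => e eT; apply: eq_bigl => t.
by rewrite in_edges1 inE; move: eT; rewrite inE => /andP[-> _].
Qed.

(** Every edge is a subset of the three vertices; this crude count is enough. *)
Lemma card_edges (t : {set 'I_nv}) : #|t| = 3 -> (#|edges [set t]%SET| <= 8)%N.
Proof.
move=> t3; have -> : 8%N = #|powerset t| by rewrite card_powerset t3.
apply: subset_leq_card; apply/fintype.subsetP => e; rewrite in_edges1 powersetE.
by case/andP.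
Qed.

End Incidence.

(** * Summation over the mesh *)

Lemma summation_arith (R : realType) (k1 k2 k3 sa sn ss se su s1 s3 so : R) :
  0 < k1 -> 0 < k2 -> 0 < k3 ->
  sn <= k1 * (se + s1) -> ss <= k3 * (2 * se + 2 * su + s3) ->
  sa <= 2 * k2 * (so + 8 * (sn + 2 * se)) ->
  0 <= so -> 0 <= s3 -> 0 <= s1 -> 0 <= su -> 0 <= se ->
  sn + sa + ss <= (k1 + 16 * (k2 * k1) + 2 * k3 + 32 * k2) * (se + su + (s1 + so + s3)).
Proof.
move=> k10 k20 k30 SN SS SA so0 s30 s10 su0 se0.
have k21 : 0 < k2 * k1 by rewrite mulr_gt0.
have SN2 : k2 * sn <= k2 * k1 * (se + s1) by rewrite -mulrA ler_pM2l.
have p (k x : R) : 0 < k -> 0 <= x -> 0 <= k * x by move=> k0 x0; rewrite mulr_ge0 // ltW.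
have := p _ _ k10 su0; have := p _ _ k10 s30; have := p _ _ k10 so0.
have := p _ _ k20 su0; have := p _ _ k20 s30; have := p _ _ k20 so0; have := p _ _ k20 se0; have := p _ _ k20 s10.
have := p _ _ k30 so0; have := p _ _ k30 s30; have := p _ _ k30 se0; have := p _ _ k30 s10; have := p _ _ k30 su0.
have := p _ _ k21 su0; have := p _ _ k21 s30; have := p _ _ k21 so0.
have := p _ _ k10 s10; have := p _ _ k10 se0; have := p _ _ k21 s10; have := p _ _ k21 se0.
move: SN SS SA SN2; move: (k2 * k1) => k; lra.
Qed.

Section Summation.
Context {R : realType} (nv : nat) (T : {set {set 'I_nv}}).
Implicit Types (t e : {set 'I_nv}).
Context (card3 : forall t, t \in T -> #|t| = 3).
Context (K1 K2 K3 : R) (K10 : 0 < K1) (K20 : 0 < K2) (K30 : 0 < K3).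
Context (E U O1 O3 N S a o : {set 'I_nv} -> R).
Context (E0 : forall t, 0 <= E t) (U0 : forall t, 0 <= U t) (O10 : forall t, 0 <= O1 t).
Context (O30 : forall t, 0 <= O3 t) (o0 : forall e, 0 <= o e) (a0 : forall e, 0 <= a e).
Context (N0 : forall t, 0 <= N t).
Context (hN : forall t, t \in T -> N t <= K1 * (E t + O1 t)).
Context (hS : forall t, t \in T -> S t <= K3 * (2 * E t + 2 * U t + O3 t)).
Context (ha : forall e, e \in edges T ->
  a e <= K2 * (o e + \sum_(t in [set t in T | e \subset t]%SET) (N t + 2 * E t))).
Context (ha0 : forall e, (2 < #|[set t in T | e \subset t]%SET|)%N -> a e = 0).

(** A jump is counted once for each adjacent triangle, hence at most twice. *)
Lemma sum_edge_terms : \sum_(t in T) \sum_(e in edges [set t]%SET) a e <=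
  2 * K2 * (\sum_(e in edges T) o e + 8 * \sum_(t in T) (N t + 2 * E t)).
Proof.
have NE0 t : 0 <= N t + 2 * E t by rewrite addr_ge0 ?mulr_ge0.
have step : \sum_(t in T) \sum_(e in edges [set t]%SET) a e <= \sum_(e in edges T) 2 * a e.
  rewrite exchange_edges; apply: ler_sum => e _; rewrite sumr_const.
  have [h|h] := ltnP 2 #|[set t in T | e \subset t]%SET|; first by rewrite ha0 // mul0rn mulr0.
  by rewrite -[leLHS]mulr_natl ler_wpM2r // ler_nat.
apply: le_trans step _; rewrite -mulr_sumr -mulrA ler_pM2l //.
apply: (@le_trans _ _ (\sum_(e in edges T) K2 * (o e + \sum_(t in [set t in T | e \subset t]%SET) (N t + 2 * E t)))).
  by apply: ler_sum => e /ha.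
rewrite -mulr_sumr ler_pM2l // big_split lerD2l -exchange_edges /= mulr_sumr.
apply: ler_sum => t tT; rewrite sumr_const -[leLHS]mulr_natl ler_wpM2r // ler_nat.
by apply: card_edges; exact: card3.
Qed.

Lemma sum_estimator :
  \sum_(t in T) (N t + \sum_(e in edges [set t]%SET) a e + S t) <=
  (K1 + 16 * (K2 * K1) + 2 * K3 + 32 * K2) * (\sum_(t in T) E t + \sum_(t in T) U t +
    (\sum_(t in T) O1 t + \sum_(e in edges T) o e + \sum_(t in T) O3 t)).
Proof.
rewrite !big_split /=; have := sum_edge_terms; rewrite big_split /= -mulr_sumr.
have SN : \sum_(t in T) N t <= K1 * (\sum_(t in T) E t + \sum_(t in T) O1 t).
  by rewrite -big_split /= mulr_sumr; apply: ler_sum => t /hN.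
have SS : \sum_(t in T) S t <= K3 * (2 * \sum_(t in T) E t + 2 * \sum_(t in T) U t + \sum_(t in T) O3 t).
  by rewrite !mulr_sumr -!big_split /= mulr_sumr; apply: ler_sum => t /hS.
have : 0 <= \sum_(t in T) E t by exact: sumr_ge0.
have : 0 <= \sum_(t in T) U t by exact: sumr_ge0.
have : 0 <= \sum_(t in T) O1 t by exact: sumr_ge0.
have : 0 <= \sum_(t in T) O3 t by exact: sumr_ge0.
have : 0 <= \sum_(e in edges T) o e by exact: sumr_ge0.
by move=> *; apply: summation_arith.
Qed.

End Summation.

Lemma dotvZ (R : realType) (k : R) (v w : 'cV[R]_2) : dotv (k *: v) (k *: w) = k ^+ 2 * dotv v w.
Proof. by rewrite !dotvE !mxE; ring. Qed.

Lemma add_components (R : realType) (k e u s0 s1 o0 o1 : R) :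
  s0 <= k * (e + u + o0) -> s1 <= k * (e + u + o1) ->
  s0 + s1 <= k * (2 * e + 2 * u + (o0 + o1)).
Proof. by move=> h0 h1; apply: le_trans (lerD h0 h1) _; rewrite le_eqVlt; apply/orP; left; apply/eqP; ring. Qed.

(** When the energy error is infinite there is nothing to prove; otherwise all
    terms are real. *)
Lemma ereal_conclusion (R : realType) (X1 : \bar R) (al K s g r hd us os : R) :
  0 < al -> 0 < K -> ((al * s)%:E <= X1)%E -> g <= s ->
  r <= hd + K * (g + us + os) -> 0 <= s -> 0 <= hd -> 0 <= us -> 0 <= os ->
  (r%:E <= (1 + K + K / al)%:E * (X1 + hd%:E + us%:E + os%:E))%E.
Proof.
move=> al0 K0 sX gs rb s0 hd0 us0 os0.
have Kal : 0 < K / al by rewrite divr_gt0.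
case: X1 sX => [x||//]; last first.
  by move=> _; rewrite !addye // gt0_muley ?leey // lte_fin; lra.
rewrite -!EFinD -EFinM !lee_fin => sx.
have Ks : K * s <= K / al * x.
  by rewrite -mulrA ler_pM2l // ler_pdivlMl.
have x0 : 0 <= x by apply: le_trans sx; rewrite mulr_ge0 // ltW.
have Kg : K * g <= K * s by rewrite ler_pM2l.
have p (k y : R) : 0 < k -> 0 <= y -> 0 <= k * y by move=> k0 y0; rewrite mulr_ge0 // ltW.
have := p _ _ K0 x0; have := p _ _ K0 hd0.
have := p _ _ Kal us0; have := p _ _ Kal os0; have := p _ _ Kal hd0.
move: rb Ks; move: (K / al) => k; lra.
Qed.

Unset Implicit Arguments.

Theorem theorem3p1 (R : realType) (Om : set (pt R)) (A : pt R -> 'M[R]_2)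
    (c1 : R) (fam : mixed_family) (l n : nat) (kappa : R) :
  polygonal_domain Om -> coefficient Om A -> 0 < c1 ->
  0 <= kappa <= 1 -> (l + 1 <= n)%N ->
  exists2 C : R, 0 < C &
    forall (f u : sfield R) (nv : nat) (X : 'I_nv -> pt R)
           (T : {set {set 'I_nv}})
           (fh : sfield R) (ph : vfield R) (uh : sfield R),
      L2 Om f -> weak_solution Om A f u ->
      triangulation Om X T -> shape_regular c1 X T ->
      is_Lh_proj Om l X T f fh ->
      mixed_solution Om A fam l X T fh ph uh ->
      curl_regular X T (Ainv A ph) ->
      let p : vfield R := fun x => A x *m wgrad Om u x in
      (eta2 Om A kappa X T f ph uh <=
       C%:E * (sqL2v Om (fun x => sqrtmx (invmx (A x)) *m (p x - ph x))%R
               + hdiv_err2 Om kappa X T (fun x => p x - ph x)%R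
               + sqL2 Om (fun x => u x - uh x)%R
               + osc2 A n X T ph uh))%E.
Proof.
move=> pOm cA c10 _ _.
have oOm := Om_open pOm; have bOm := Om_bounded pOm; have mOm := Om_measurable pOm.
have [C1 C10 hC1] := elt_bubble n c10.
have [C2 C20 hC2] := edge_bubble n.+1 c10.
have [al al0 hal] := energy_bound cA.
have [T0p T0f] := @measure_T0_gt0 R.
pose H := c1 * (fine (leb2 R Om) / fine (leb2 R (T0 : set (pt R)))).
have H0 : 0 <= H.
  by rewrite /H mulr_ge0 ?divr_ge0 ?fine_ge0 // ltW.
pose K1 := 32 * C1 ^+ 3 + 16 * C1 ^+ 2 + 2.
pose K2 := 64 * C2 ^+ 2 + 2.
pose K3 := 32 * C1 ^+ 2 * H + 32 * C1 ^+ 3 + 32 * C1 ^+ 2 + 2.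
have K10 : 0 < K1 by rewrite /K1 !addr_gt0 // mulr_gt0 // exprn_gt0.
have K20 : 0 < K2 by rewrite /K2 addr_gt0 // mulr_gt0 // exprn_gt0.
have K30 : 0 < K3.
  have a1 : 0 <= 32 * C1 ^+ 2 * H by rewrite mulr_ge0 // mulr_ge0 // exprn_ge0 // ltW.
  have a2 : 0 < C1 ^+ 3 by rewrite exprn_gt0.
  have a3 : 0 < C1 ^+ 2 by rewrite exprn_gt0.
  by rewrite /K3; lra.
pose K := K1 + 16 * (K2 * K1) + 2 * K3 + 32 * K2.
have K0 : 0 < K by rewrite /K !addr_gt0 // !mulr_gt0.
exists (1 + K + K / al); first by rewrite addr_gt0 ?divr_gt0 // addr_gt0.
move=> f u nv X T fh ph uh Lf wu tr sr _ [Mph Luh _ _] creg.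
cbv zeta; set p : vfield R := (fun x => A x *m wgrad Om u x).
have Hu : H10 Om u by case: wu.
have Hph : Hdiv Om ph by case: Mph.
have Lph : L2v Om ph by case: Hph.
pose psi := Ainv A ph.
have Lpsi : L2v Om psi by exact: Ainv_L2v.
have [Luh' puh] := Luh.
have hH t : t \in T -> hsize X t ^+ 2 <= H.
  by move=> tT; have [e [i [j [k te]]]] := elt_has_edge tr tT; exact: (hsize_bound_at pOm tr sr c10 tT te).
have mE t : measurable (elt X t) by exact: elt_measurable.
have Esub t : t \in T -> elt X t `<=` Om by exact: (elt_sub pOm tr).
have sub t v : t \in T -> L2 Om v -> L2 (elt X t) v.
  by move=> tT; apply: L2_sub => //; exact: Esub.
pose c t := wcurl (elt X t) psi.
have Lc t : t \in T -> L2 (elt X t) (c t) by move=> tT; exact: (curl_L2 creg tT).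
pose res t i := fun x => residual A X t ph uh x i ord0.
pose qc t := bestappr (sqL2 (elt X t)) n (c t).
pose qr t i := bestappr (sqL2 (elt X t)) n (res t i).
pose qe e := bestappr (sqL2E X e) n.+1 (tjump X T psi e).
pose J e := tjump X T psi e \o eparam X e.
pose Q e := qe e \o eparam X e.
pose len e := eucl_dist (ept X e 1) (ept X e 0).
pose mu1 := @lebesgue_measure R.
pose E t := local_err Om X u psi t.
pose U t := ip (elt X t) (fun x => u x - uh x) (fun x => u x - uh x).
pose N t := hsize X t ^+ 2 * ip (elt X t) (c t) (c t).
pose O1 t := hsize X t ^+ 2 * ip (elt X t) (fun x => c t x - qc t x) (fun x => c t x - qc t x).
pose S1 t i := hsize X t ^+ 2 * ip (elt X t) (res t i) (res t i).
pose O3i t i := hsize X t ^+ 2 * ip (elt X t) (fun x => res t i x - qr t i x) (fun x => res t i x - qr t i x).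
pose S t := S1 t ord0 + S1 t ord_max.
pose O3 t := O3i t ord0 + O3i t ord_max.
pose a e := hsize X e * len e * dp mu1 itv01 (J e) (J e).
pose o e := hsize X e * len e * dp mu1 itv01 (fun s => J e s - Q e s) (fun s => J e s - Q e s).
pose w := wdiv Om (fun x => p x - ph x).
have [Lw aew] : L2 Om w /\ {ae leb2 R, forall x, Om x -> w x = - (f x + wdiv Om ph x)}.
  exact: (flux_error_wdiv pOm cA Lf wu Hph).
have Ldh : L2 Om (wdiv Om ph) by have [_ /wdivP[]] := Hph.
have Lfd : L2 Om (fun x => f x + wdiv Om ph x) by exact: (L2D mOm Lf Ldh).
pose D t := (hsize X t `^ kappa) ^+ 2 * ip (elt X t) (fun x => f x + wdiv Om ph x) (fun x => f x + wdiv Om ph x).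
pose Hd t := (hsize X t `^ kappa) ^+ 2 * ip (elt X t) w w.
have n0 k (v : sfield R) B : 0 <= k ^+ 2 * ip B v v :> R by rewrite mulr_ge0 ?sqr_ge0 ?ip_ge0.
have DHd t : t \in T -> D t <= Hd t.
  move=> tT; rewrite /D /Hd ler_wpM2l ?sqr_ge0 //; apply: (le_ip_ae (mE t)).
  - exact: (sub t _ tT Lfd).
  - exact: (sub t _ tT Lw).
  - by apply: (ae_imp (mu := leb2 R) aew) => x h /(Esub t tT) /h ->; rewrite sqrrN.
have resB t i : t \in T -> L2 (elt X t) (res t i) /\ S1 t i <= K3 * (E t + U t + O3i t i).
  move=> tT; have [r pr uhr] := puh t tT.
  exact: (residual_bound pOm tr sr c10 Hu Lpsi C10 hC1 hH i tT Luh' pr uhr (bestappr_poly _ _ _)).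
have edgeB e : e \in edges T -> [/\ 0 < len e, sqi mu1 itv01 (J e) &
    a e <= K2 * (o e + \sum_(t in [set t in T | e \subset t]%SET) (N t + 2 * E t))].
  by move=> eT; exact: (edge_bound pOm tr sr c10 Hu Lpsi creg C20 hC2 eT (bestappr_poly _ _ _)).
have total : \sum_(t in T) (N t + \sum_(e in edges [set t]%SET) a e + S t) <=
  K * (\sum_(t in T) E t + \sum_(t in T) U t +
    (\sum_(t in T) O1 t + \sum_(e in edges T) o e + \sum_(t in T) O3 t)).
  have le0 e : 0 <= hsize X e * len e by rewrite mulr_ge0 ?hsize_ge0 ?eucl_dist_ge0.
  apply: sum_estimator => //.
  - by move=> t; exact: (card_elt tr).
  - by move=> t; exact: sqv_ge0.
  - by move=> t; exact: ip_ge0.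
  - by move=> t; exact: n0.
  - by move=> t; rewrite addr_ge0 //; exact: n0.
  - by move=> e; rewrite mulr_ge0 ?dp_ge0.
  - by move=> e; rewrite mulr_ge0 ?dp_ge0.
  - by move=> t; exact: n0.
  - move=> t tT; exact: (curl_bound pOm tr sr c10 Hu Lpsi creg C10 hC1 tT (bestappr_poly _ _ _)).
  - move=> t tT; have [_ b0] := resB t ord0 tT; have [_ b1] := resB t ord_max tT.
    exact: (add_components b0 b1).
  - by move=> e /edgeB[].
  (* an edge of three or more triangles carries no jump *)
  - move=> e big; rewrite /a (_ : dp _ _ _ _ = 0) ?mulr0 // /dp /Rintegral integral0_eq // => s _.
    rewrite /J /= /tjump; move: big; rewrite cardE.
    by case: (enum _) => [|t [|t' [|t'' s']]] //= _; rewrite mul0r.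
have Ld : L2v Om (fun x => psi x - wgrad Om u x) by exact: (grad_error_L2v pOm Hu Lpsi).
(* the triangles are disjoint subsets of the domain *)
have sumE : \sum_(t in T) E t <= sqv Om (fun x => psi x - wgrad Om u x).
  rewrite big_split /=; apply: lerD; apply: sum_ip_disjoint => //; try exact: Ld.
    by move=> t t' tT t'T; exact: (elt_disjoint tr).
  by move=> t t' tT t'T; exact: (elt_disjoint tr).
have Lu : L2 Om u by case: Hu.
have Luu : L2 Om (fun x => u x - uh x) by exact: (L2B mOm).
have sumU : \sum_(t in T) U t <= ip Om (fun x => u x - uh x) (fun x => u x - uh x).
  apply: sum_ip_disjoint => // t t' tT t'T; exact: (elt_disjoint tr).
have energy : ((al * sqv Om (fun x => psi x - wgrad Om u x))%:E <=
    sqL2v Om (fun x => sqrtmx (invmx (A x)) *m (p x - ph x)))%E.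
  rewrite -[al](sqr_sqrtr (ltW al0)) -(sqL2v_weight _ mOm Ld).
  apply: (@ae_le_integral_nonmeas _ _ _ (leb2 R)) => //.
  - apply/measurable_EFinP; apply: (eq_measurable_fun (fun x => al * ((psi x - wgrad Om u x) ord0 ord0 ^+ 2 + (psi x - wgrad Om u x) ord_max ord0 ^+ 2))).
      by move=> x _; rewrite dotvZ sqr_sqrtr ?(ltW al0) // dotvE -!expr2.
    apply: measurable_funM => //; apply: measurable_funD; apply: measurable_funX; [case: (Ld ord0)|case: (Ld ord_max)] => //.
  - by move=> x _; rewrite lee_fin dotv_ge0.
  - by move=> x _; rewrite lee_fin dotv_ge0.
  - apply: (ae_imp (mu := leb2 R) (hal (wgrad Om u) ph)) => x h Ox; rewrite lee_fin.
    by apply: le_trans (h Ox); rewrite dotvZ sqr_sqrtr // ltW.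
have etaE : eta2 Om A kappa X T f ph uh =
    (\sum_(t in T) (D t + (N t + \sum_(e in edges [set t]%SET) a e + S t)))%:E.
  rewrite /eta2 -sumEFin; apply: eq_bigr => t tT; rewrite /eta2_T.
  have [Lr0 _] := resB t ord0 tT; have [Lr1 _] := resB t ord_max tT.
  have Lr : L2v (elt X t) (residual A X t ph uh) by move=> i; have [->|->] := dirE i.
  rewrite (sqL2_weight _ (mE t)); last exact: (sub t _ tT Lfd).
  rewrite (sqL2E_ip (Lc t tT)) (sqL2v_weight _ (mE t) Lr).
  rewrite (eq_bigr (fun e => (a e)%:E)); last first.
    move=> e et; have [_ sJ _] := edgeB e (edges_of tT et).
    by rewrite (sqL2E_weight (hsize_ge0 X e) sJ).
  rewrite sumEFin -EFinM -!EFinD; congr EFin; rewrite -!addrA; congr (_ + (_ + (_ + _))).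
  by rewrite /sqv mulrDr.
have oscE : osc2 A n X T ph uh =
    (\sum_(t in T) O1 t + \sum_(e in edges T) o e + \sum_(t in T) O3 t)%:E.
  rewrite /osc2 !EFinD -!sumEFin; congr (_ + _ + _)%E; apply: eq_bigr.
  - move=> t tT; rewrite sqL2_weight //; apply: (L2B (mE t) (Lc t tT)).
    by apply: smooth_L2; [exact: elt_open|exact: (elt_bounded pOm tr tT)|exact: smooth_poly (bestappr_poly _ _ _)].
  - move=> e eT; have [_ sJ _] := edgeB e eT; rewrite (sqL2E_weight (hsize_ge0 X e)) //.
    apply: (sqiB (mu := mu1)) => //; first exact: measurable_itv.
    apply: continuous_sqi_itv; apply: line_continuous; apply: smooth_cont.
    exact: smooth_poly (bestappr_poly _ _ _).
  - move=> t tT; have Lr : L2v (elt X t) (rem_eltv X t n (residual A X t ph uh)).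
      move=> i; have [Lri _] := resB t i tT.
      apply: (@L2_ext _ _ (fun x => res t i x - qr t i x)); first by move=> x _; rewrite /rem_eltv mxE.
      apply: (L2B (mE t) Lri).
      by apply: smooth_L2; [exact: elt_open|exact: (elt_bounded pOm tr tT)|exact: smooth_poly (bestappr_poly _ _ _)].
    rewrite (sqL2v_weight _ (mE t) Lr) /sqv mulrDr; congr (_ * _ + _ * _)%:E.
      by apply: eq_ip => x _; rewrite /rem_eltv mxE.
    by apply: eq_ip => x _; rewrite /rem_eltv mxE.
have hdE : hdiv_err2 Om kappa X T (fun x => p x - ph x) = (\sum_(t in T) Hd t)%:E.
  rewrite /hdiv_err2 -sumEFin; apply: eq_bigr => t tT.
  exact: (sqL2_weight (hsize X t `^ kappa) (mE t) (sub t w tT Lw)).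
rewrite etaE oscE hdE (sqL2E_ip Luu).
apply: (ereal_conclusion al0 K0 energy sumE) => //.
- rewrite big_split /=; apply: lerD; first by apply: ler_sum => t /DHd.
  by apply: le_trans total _; rewrite ler_pM2l // lerD2r lerD2l.
- exact: sqv_ge0.
- by apply: sumr_ge0 => t _; exact: n0.
- exact: ip_ge0.
- rewrite !addr_ge0 // sumr_ge0 // => [t _|e _|t _]; first exact: n0.
    by rewrite mulr_ge0 ?dp_ge0 // mulr_ge0 ?hsize_ge0 ?eucl_dist_ge0.
  by rewrite addr_ge0 //; exact: n0.
Qed.
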